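(* Let $U\subset\mathbb{R}^2$ be compact and let $\phi:U\to[0,\infty)$ be the restriction of a smooth function defined on an open neighbourhood of $U$ whose Hessian is positive definite everywhere (so that the graph $S=\{(\xi,\phi(\xi)):\xi\in U\}$ is a smooth convex surface with everywhere nonvanishing Gaussian curvature). For $g\in L^2(U)$ and $(x,s)\in\mathbb{R}^2\times\mathbb{R}$ define the extension operator $$\mathcal{E}g(x,s)=\int_Ug(\xi)e^{i(s\phi(\xi)+x\cdot\xi)}\,\mathrm{d}\xi,$$ and for $t\ge0$ let $g_t(\xi)=e^{-t\phi(\xi)}g(\xi)$. Then there exists a constant $c<\infty$, depending only on $U$ and $\phi$, such that for every $g\in L^2(U)$ the function $Q:(0,\infty)\to\mathbb{R}$, $$Q(t)=c\,\|g_t\|_{L^2(U)}^4-\|\mathcal{E}g_t\|_{L^4_{x,s}(\mathbb{R}^2\times\mathbb{R})}^4,$$ is completely monotone (decreasing).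
   Context: A function $Q:(0,\infty)\to\mathbb{R}$ is completely monotone (decreasing) if it is infinitely differentiable and $(-1)^kQ^{(k)}(t)\ge0$ for all $t>0$ and all positive integers $k$. *)

(* Defs.v *)
From HB Require Import structures.
From mathcomp Require Import all_boot all_order all_algebra.
From mathcomp Require Import all_classical all_reals all_analysis.
Set Implicit Arguments. Unset Strict Implicit. Unset Printing Implicit Defensive.
Import Order.TTheory GRing.Theory Num.Theory.
Import numFieldNormedType.Exports.
Local Open Scope classical_set_scope.
Local Open Scope ring_scope.

Section Defs.
Variable R : realType.

Definition leb2 := (@lebesgue_measure R \x @lebesgue_measure R)%E.
Definition leb3 := (leb2 \x @lebesgue_measure R)%E.

Definition dir (b : bool) : R * R := if b then (0, 1) else (1, 0).

Definition iterpartial (l : seq bool) (f : R * R -> R) : R * R -> R :=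
  foldr (fun b h => 'D_(dir b) h) f l.

Definition smooth_on (V : set (R * R)) (f : R * R -> R) : Prop :=
  forall (l : seq bool) (x : R * R), V x ->
    {for x, continuous (iterpartial l f)} /\
    forall b : bool, derivable (iterpartial l f) x (dir b).

Definition hess (f : R * R -> R) (i j : bool) (x : R * R) : R :=
  iterpartial [:: i; j] f x.

Definition hessian_posdef (f : R * R -> R) (x : R * R) : Prop :=
  forall v : R * R, v <> 0 ->
    0 < v.1 * v.1 * hess f false false x + v.1 * v.2 * hess f false true x
        + v.2 * v.1 * hess f true false x + v.2 * v.2 * hess f true true x.

(** A complex-valued function g = gr + i gi on R^2 belongs to L^2(U). *)
Definition in_L2 (U : set (R * R)) (gr gi : R * R -> R) : Prop :=
  measurable_fun U gr /\ measurable_fun U gi /\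
  (\int[leb2]_(xi in U) ((gr xi ^+ 2 + gi xi ^+ 2)%:E) < +oo)%E.

Definition L2sq (U : set (R * R)) (gr gi : R * R -> R) : R :=
  fine (\int[leb2]_(xi in U) ((gr xi ^+ 2 + gi xi ^+ 2)%:E))%E.

Definition phase (phi : R * R -> R) (x : R * R) (s : R) (xi : R * R) : R :=
  s * phi xi + (x.1 * xi.1 + x.2 * xi.2).

(** real and imaginary parts of
    Eg(x,s) = \int_U g(xi) e^{i (s phi(xi) + x.xi)} dxi, g = gr + i gi *)
Definition ext_re (U : set (R * R)) (phi : R * R -> R) (gr gi : R * R -> R)
    (x : R * R) (s : R) : R :=
  \int[leb2]_(xi in U) (gr xi * cos (phase phi x s xi)
                         - gi xi * sin (phase phi x s xi)).
Definition ext_im (U : set (R * R)) (phi : R * R -> R) (gr gi : R * R -> R)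
    (x : R * R) (s : R) : R :=
  \int[leb2]_(xi in U) (gr xi * sin (phase phi x s xi)
                         + gi xi * cos (phase phi x s xi)).

Definition ext_L4_4 (U : set (R * R)) (phi : R * R -> R) (gr gi : R * R -> R)
    : \bar R :=
  (\int[leb3]_(p in [set: (R * R) * R])
     (((ext_re U phi gr gi p.1 p.2) ^+ 2
       + (ext_im U phi gr gi p.1 p.2) ^+ 2) ^+ 2)%:E)%E.

Definition damp (phi : R * R -> R) (t : R) (g : R * R -> R) : R * R -> R :=
  fun xi => expR (- (t * phi xi)) * g xi.

Definition completely_monotone (Q : R -> R) : Prop :=
  (forall (k : nat) (t : R), 0 < t -> derivable (derive1n k Q) t 1) /\
  (forall (k : nat) (t : R), (0 < k)%N -> 0 < t ->
     0 <= (-1) ^+ k * derive1n k Q t).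

End Defs.

(* Main.v *)
(* Write f = g (x) g on U * U and tau (xi, eta) = phi xi + phi eta. The square of E g_t is the
   transform F (e^{- t tau} f), where F h (x, s) integrates h against e^{i (s tau + x . (xi + eta))};
   hence ||E g_t||_4^4 = ||F (e^{- t tau} f)||_2^2 and ||g_t||_2^4 = ||e^{- t tau} f||_2^2.

   F is bounded on L^2 (U * U): after a TT* argument with triangular cutoffs, Schur's test asks for
   |{xi : a <= phi xi + phi (y - xi) <= b}| <= C (b - a) uniformly in y. This slab estimate follows
   from local strong convexity of phi, by dilating the slab about the minimiser.

   Therefore D (a, b) = c <a f, b f> - Re <F (a f), F (b f)> is a bounded positive semidefinite form
   on the bounded multipliers. Multiplying by e^{i h tau} translates F in s, so
   D (tau a, b) = D (a, tau b). With e_t = e^{- t tau} and G_k t = D (tau^k e_t, e_t) this gives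
   Q = G_0 and G_k' = - 2 G_{k+1}. The G_{2j} are nonnegative, so each G_{2j} is convex; being
   bounded, it is nonincreasing, and the G_{2j+1} are nonnegative too. *)

Require Import Defs.
From HB Require Import structures.
From mathcomp Require Import all_boot all_order all_algebra.
From mathcomp Require Import all_classical all_reals all_analysis.
From mathcomp Require Import measurable_realfun ring lra.
Set Implicit Arguments. Unset Strict Implicit. Unset Printing Implicit Defensive.
Import Order.TTheory GRing.Theory Num.Theory.
Import numFieldNormedType.Exports.
Local Open Scope classical_set_scope.
Local Open Scope ring_scope.

(** * Integration preliminaries *)

(** The kernel of F* F on pairs of points of U * U is formally a delta function on equal [tau] and
    equal sums, so Schur's test cannot be applied to it directly. A triangular weight of half-width
    N in each of the variables x1, x2, s replaces the three deltas by Fejer kernels. These are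
    dominated by series of indicators of dyadic intervals whose integrals are bounded uniformly in
    N, so only measures of slabs matter, and N tends to infinity at the very end.

    The monotonicity argument sees F only through its L^2 bound and its behaviour under translation
    in s. The shift property moves whole powers of [tau] across D, which produces a value D (a, a)
    for even powers only; odd orders are not squares in this sense and are therefore reached through
    convexity.

    Complex quantities are carried throughout as pairs of real ones. This costs a factor 2 in the
    constant, and makes the shift property appear as the imaginary part of a complex identity. *)

Section RealIntegrals.
Context d (T : measurableType d) (R : realType).
Variable mu : {measure set T -> \bar R}.
Implicit Types f g : T -> R.

Notation L1 f := (mu.-integrable [set: T] (EFin \o f)).

Lemma integrable_mfun f : L1 f -> measurable_fun setT f.
Proof. by move=> /integrableP[/measurable_EFinP]. Qed.

Lemma le_integrableR f g : measurable_fun setT f ->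
  (forall x, `|f x| <= g x) -> L1 g -> L1 f.
Proof.
move=> mf fg; apply: le_integrable => //; first exact/measurable_EFinP.
by move=> x _; rewrite lee_fin (le_trans (fg x))// ler_norm.
Qed.

Lemma integrableDR f g : L1 f -> L1 g -> L1 (fun x => f x + g x).
Proof. by move=> lf lg; apply: (integrableD measurableT lf lg). Qed.

Lemma integrableBR f g : L1 f -> L1 g -> L1 (fun x => f x - g x).
Proof. by move=> lf lg; apply: (integrableB measurableT lf lg). Qed.

Lemma integrableZR k f : L1 f -> L1 (fun x => k * f x).
Proof. by move=> lf; apply: (integrableZl measurableT k lf). Qed.

Lemma ge0_integrableR f : measurable_fun setT f -> (forall x, 0 <= f x) ->
  (\int[mu]_x (f x)%:E < +oo)%E -> L1 f.
Proof.
move=> mf f0 foo; apply/integrableP; split; first exact/measurable_EFinP.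
rewrite (eq_integral (fun x => (f x)%:E))// => x _.
by rewrite /= ger0_norm.
Qed.

Lemma RintegralK f : L1 f -> (\int[mu]_x f x)%:E = (\int[mu]_x (f x)%:E)%E.
Proof. by move=> lf; rewrite fineK//; exact: integrable_fin_num. Qed.

(* The Young bound |u v| <= u^2 + v^2 makes products of square-integrable functions integrable. *)
Lemma integrable_mul2 f g : measurable_fun setT f -> measurable_fun setT g ->
  L1 (fun x => f x ^+ 2) -> L1 (fun x => g x ^+ 2) -> L1 (fun x => f x * g x).
Proof.
move=> mf mg f2 g2; apply: (le_integrableR _ _ (integrableDR f2 g2)).
  exact: measurable_funM.
by move=> x; rewrite ler_norml; apply/andP; split; nra.
Qed.

End RealIntegrals.

Section Tensor.
Context d1 d2 (T1 : measurableType d1) (T2 : measurableType d2) (R : realType).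
Variable m1 : {sigma_finite_measure set T1 -> \bar R}.
Variable m2 : {sigma_finite_measure set T2 -> \bar R}.
Variables (u : T1 -> R) (v : T2 -> R).
Hypothesis iu : m1.-integrable setT (EFin \o u).
Hypothesis iv : m2.-integrable setT (EFin \o v).

Lemma integrable_tensor :
  (m1 \x m2)%E.-integrable setT (EFin \o (fun p : T1 * T2 => u p.1 * v p.2)).
Proof.
have mu := integrable_mfun iu; have mv := integrable_mfun iv.
apply/integrable12ltyP.
  apply/measurable_EFinP; apply: measurable_funM.
    exact: (measurableT_comp mu).
  exact: (measurableT_comp mv).
rewrite (eq_integral (fun x => `|u x|%:E * \int[m2]_y `|v y|%:E)%E); last first.
  move=> x _; rewrite -ge0_integralZl//=.
  - by apply: eq_integral => y _; rewrite normrM EFinM.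
  - by apply/measurable_EFinP; apply: measurableT_comp.
rewrite ge0_integralZr//=; last 2 first.
- by apply/measurable_EFinP; apply: measurableT_comp.
- by apply: integral_ge0 => *; rewrite lee_fin.
case/integrableP: iu => _ /= uoo; case/integrableP: iv => _ /= voo.
by rewrite lte_mul_pinfty// ?integral_ge0// ge0_fin_numE// integral_ge0.
Qed.

Lemma Rintegral_tensor : \int[(m1 \x m2)%E]_p (u p.1 * v p.2) =
  (\int[m1]_x u x) * (\int[m2]_y v y).
Proof.
have := integral12_prod_meas1 integrable_tensor; rewrite /Rintegral => <-.
rewrite /fubini_F /= (eq_integral (fun x => (u x)%:E * (\int[m2]_y v y)%:E)%E).
  by rewrite integralZr// fineM//; exact: integrable_fin_num.
by move=> x _; rewrite (RintegralK iv) -integralZl.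
Qed.

End Tensor.

(* The library equips [\x] only with its sub-probability instance as a sigma-finite measure,
   hence this copy. *)
Section SigmaFiniteProduct.
Context d1 d2 (T1 : measurableType d1) (T2 : measurableType d2) (R : realType).
Variable m1 : {sigma_finite_measure set T1 -> \bar R}.
Variable m2 : {sigma_finite_measure set T2 -> \bar R}.

Definition prodm := (m1 \x m2)%E.

HB.instance Definition _ := Measure.on prodm.

Lemma prodm_sigma_finite : sigma_finite setT prodm.
Proof.
have /sigma_finiteP[F [TF ndF Foo]] := sigma_finiteT m1.
have /sigma_finiteP[G [TG ndG Goo]] := sigma_finiteT m2.
exists (fun n => F n `*` G n).
  rewrite -setXTT TF TG predeqE => -[x y]; split.
    move=> [/= [n _ Fnx] [k _ Gky]]; exists (maxn n k) => //; split.
    - by move: x Fnx; exact/subsetPset/ndF/leq_maxl.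
    - by move: y Gky; exact/subsetPset/ndG/leq_maxr.
  by move=> [n _ []/= ? ?]; split; exists n.
move=> k; have [? ?] := Foo k; have [? ?] := Goo k.
split; first exact: measurableX.
by rewrite /prodm product_measure1E// lte_mul_pinfty// ge0_fin_numE.
Qed.

HB.instance Definition _ := Measure_isSigmaFinite.Build _ _ _ prodm prodm_sigma_finite.

End SigmaFiniteProduct.

HB.instance Definition _ (R : realType) := Measure.on (@leb2 R).
HB.instance Definition _ (R : realType) := Measure_isSigmaFinite.Build _ _ _ (@leb2 R)
  (prodm_sigma_finite (@lebesgue_measure R) (@lebesgue_measure R)).
HB.instance Definition _ (R : realType) := Measure.on (@leb3 R).
HB.instance Definition _ (R : realType) := Measure_isSigmaFinite.Build _ _ _ (@leb3 R)
  (prodm_sigma_finite (@leb2 R) (@lebesgue_measure R)).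

Lemma measurable_cos_comp d (T : measurableType d) (R : realType) (f : T -> R) :
  measurable_fun setT f -> measurable_fun setT (fun x => cos (f x)).
Proof.
by apply: measurableT_comp; apply: continuous_measurable_fun; exact: continuous_cos.
Qed.

Lemma measurable_sin_comp d (T : measurableType d) (R : realType) (f : T -> R) :
  measurable_fun setT f -> measurable_fun setT (fun x => sin (f x)).
Proof.
by apply: measurableT_comp; apply: continuous_measurable_fun; exact: continuous_sin.
Qed.

(** * Schur's test for a weighted oscillatory transform *)

Section TTstar.
Context dz dx (Z : measurableType dz) (X : measurableType dx) (R : realType).
Variable m : {sigma_finite_measure set Z -> \bar R}.
Variable mu : {sigma_finite_measure set X -> \bar R}.
Variables (th : Z * X -> R) (w : Z -> R) (h : X -> R) (E : set X).
Variables (K : X * X -> \bar R) (C : R).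
Hypothesis mth : measurable_fun setT th.
Hypothesis w0 : forall z, 0 <= w z.
Hypothesis iw : m.-integrable setT (EFin \o w).
Hypothesis ih : mu.-integrable setT (EFin \o h).
Hypothesis mE : measurable E.
Hypothesis hE : forall x, ~ E x -> h x = 0.
Hypothesis mK : measurable_fun setT K.
Hypothesis K0 : forall pq, (0 <= K pq)%E.
Hypothesis C0 : 0 <= C.
Hypothesis kernel_le : forall p q,
  (`|\int[m]_z (w z * cos (th (z, p) - th (z, q)))|%:E <= K (p, q))%E.
Hypothesis schur1 : forall p, (\int[mu]_q (K (p, q) * (\1_E q)%:E) <= C%:E)%E.
Hypothesis schur2 : forall q, (\int[mu]_p (K (p, q) * (\1_E p)%:E) <= C%:E)%E.

Let mh : measurable_fun setT h := integrable_mfun ih.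
Let mw : measurable_fun setT w := integrable_mfun iw.

(** With [sin_tr], the real and imaginary parts of the integral of h e^{i th} for a real function
    [h]. *)
Definition cos_tr z := \int[mu]_p (h p * cos (th (z, p))).
Definition sin_tr z := \int[mu]_p (h p * sin (th (z, p))).

Let mthz z : measurable_fun setT (fun p => th (z, p)).
Proof. exact: measurableT_comp. Qed.

Let ihc z : mu.-integrable setT (EFin \o (fun p => h p * cos (th (z, p)))).
Proof.
apply: (le_integrableR _ _ (integrable_norm ih)).
  by apply: measurable_funM => //; exact: measurable_cos_comp.
by move=> x /=; rewrite normrM ler_piMr// ler_norml cos_geN1 cos_le1.
Qed.

Let ihs z : mu.-integrable setT (EFin \o (fun p => h p * sin (th (z, p)))).
Proof.
apply: (le_integrableR _ _ (integrable_norm ih)).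
  by apply: measurable_funM => //; exact: measurable_sin_comp.
by move=> x /=; rewrite normrM ler_piMr// ler_norml sin_geN1 sin_le1.
Qed.

Let g z (pq : X * X) := h pq.1 * h pq.2 * cos (th (z, pq.1) - th (z, pq.2)).

(** The modulus squared is a double integral of h p h q e^{i (th p - th q)}; its sine part is
    antisymmetric in p and q, so only the cosine of the difference survives. *)
Lemma cos_tr_sqr z :
  cos_tr z ^+ 2 + sin_tr z ^+ 2 = \int[(prodm mu mu)]_pq g z pq.
Proof.
rewrite !expr2 /cos_tr /sin_tr -!Rintegral_tensor// -RintegralD//.
- by apply: eq_Rintegral => pq _; rewrite /g cosB; ring.
- exact: (integrable_tensor (ihc z) (ihc z)).
- exact: (integrable_tensor (ihs z) (ihs z)).
Qed.

Let G (zpq : Z * (X * X)) := w zpq.1 * g zpq.1 zpq.2.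

Let mG : measurable_fun [set: (Z * (X * X))%type] G.
Proof.
apply: measurable_funM; first exact: measurableT_comp.
apply: measurable_funM.
  apply: measurable_funM.
    exact: (measurableT_comp mh (measurableT_comp measurable_fst measurable_snd)).
  exact: (measurableT_comp mh (measurableT_comp measurable_snd measurable_snd)).
have mt1 : measurable_fun setT (fun x : Z * (X * X) => (x.1, x.2.1)).
  apply: measurable_fun_pair => //=.
  exact: (measurableT_comp measurable_fst measurable_snd).
have mt2 : measurable_fun setT (fun x : Z * (X * X) => (x.1, x.2.2)).
  apply: measurable_fun_pair => //=.
  exact: (measurableT_comp measurable_snd measurable_snd).
apply: measurable_cos_comp; apply: measurable_funB; exact: (measurableT_comp mth).
Qed.

Let iG : (m \x (prodm mu mu))%E.-integrable setT (EFin \o G).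
Proof.
have ihh := integrable_norm (integrable_tensor ih ih).
have := @integrable_tensor _ _ _ _ _ m (prodm mu mu) w _ iw ihh; apply: le_integrableR; first exact: mG.
move=> [z [p q]]; rewrite /G /g /= normrM ger0_norm// ler_wpM2l// normrM.
by rewrite ler_piMr// ler_norml cos_geN1 cos_le1.
Qed.

(** The real kernel obtained by composing the weighted transform with its adjoint. *)
Let kap (pq : X * X) := \int[m]_z (w z * cos (th (z, pq.1) - th (z, pq.2))).

Let fubini_step : (\int[m]_z (w z * (cos_tr z ^+ 2 + sin_tr z ^+ 2))%:E =
  \int[prodm mu mu]_pq (h pq.1 * h pq.2 * kap pq)%:E)%E.
Proof.
transitivity (\int[m]_z \int[prodm mu mu]_pq (EFin \o G) (z, pq))%E.
  apply: eq_integral => z _; rewrite cos_tr_sqr EFinM RintegralK.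
    rewrite -integralZl//.
    apply: (le_integrableR _ _ (integrable_norm (integrable_tensor ih ih))).
      apply: measurable_funM; first by apply: measurable_funM; exact: measurableT_comp.
      by apply: measurable_cos_comp; apply: measurable_funB; exact: (measurableT_comp (mthz z)).
    by move=> [p q]; rewrite /g normrM ler_piMr// ler_norml cos_geN1 cos_le1.
  apply: (le_integrableR _ _ (integrable_norm (integrable_tensor ih ih))).
    apply: measurable_funM; first by apply: measurable_funM; exact: measurableT_comp.
    by apply: measurable_cos_comp; apply: measurable_funB; exact: (measurableT_comp (mthz z)).
  by move=> [p q]; rewrite /g normrM ler_piMr// ler_norml cos_geN1 cos_le1.
rewrite (Fubini iG); apply: eq_integral => -[p q] _; rewrite /kap /=.
have iwc : m.-integrable setT (EFin \o (fun z => w z * cos (th (z, p) - th (z, q)))).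
  apply: (le_integrableR _ _ iw).
    apply: measurable_funM => //; apply: measurable_cos_comp; apply: measurable_funB;
    exact: (measurableT_comp mth).
  by move=> z; rewrite normrM ger0_norm// ler_piMr// ler_norml cos_geN1 cos_le1.
rewrite EFinM RintegralK// -integralZl//.
by apply: eq_integral => z _; rewrite /G /g /=; congr EFin; ring.
Qed.

Theorem schur_bound :
  (\int[m]_z (w z * (cos_tr z ^+ 2 + sin_tr z ^+ 2))%:E <=
   C%:E * \int[mu]_p (h p ^+ 2)%:E)%E.
Proof.
rewrite fubini_step.
have mh2 : measurable_fun setT (fun p => (2^-1 * h p ^+ 2)%:E).
  apply/measurable_EFinP; apply: measurable_funM => //; exact: measurable_funX.
have m1E : measurable_fun setT (fun p : X => (\1_E p : R)%:E).
  by apply/measurable_EFinP; exact: measurable_indic.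
(* Young's inequality splits |h p h q| K into [A1] + [A2]. In each half the square depends on one
   variable only, and integrating the kernel in the other costs [C] by one of the two Schur
   conditions. *)
pose A1 (pq : X * X) := ((2^-1 * h pq.1 ^+ 2)%:E * (K pq * (\1_E pq.2)%:E))%E.
pose A2 (pq : X * X) := ((2^-1 * h pq.2 ^+ 2)%:E * (K pq * (\1_E pq.1)%:E))%E.
have mA1 : measurable_fun setT A1.
  apply: emeasurable_funM; first exact: (measurableT_comp mh2).
  by apply: emeasurable_funM => //; exact: (measurableT_comp m1E).
have mA2 : measurable_fun setT A2.
  apply: emeasurable_funM; first exact: (measurableT_comp mh2).
  by apply: emeasurable_funM => //; exact: (measurableT_comp m1E).
have h20 p : (0 <= (2^-1 * h p ^+ 2)%:E)%E by rewrite lee_fin mulr_ge0// sqr_ge0.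
have KE0 pq q : (0 <= K pq * (\1_E q : R)%:E)%E by rewrite mule_ge0// lee_fin.
have A10 pq : (0 <= A1 pq)%E by rewrite mule_ge0.
have A20 pq : (0 <= A2 pq)%E by rewrite mule_ge0.
have mhk : measurable_fun setT (fun pq => (h pq.1 * h pq.2 * kap pq)%:E).
  have := measurable_fubini_G iG; apply: eq_measurable_fun => -[p q] _.
  rewrite /fubini_G /kap /=.
  have iwc : m.-integrable setT (EFin \o (fun z => w z * cos (th (z, p) - th (z, q)))).
    apply: (le_integrableR _ _ iw).
      apply: measurable_funM => //; apply: measurable_cos_comp; apply: measurable_funB;
      exact: (measurableT_comp mth).
    by move=> z; rewrite normrM ger0_norm// ler_piMr// ler_norml cos_geN1 cos_le1.
  rewrite EFinM RintegralK// -integralZl//.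
  by apply: eq_integral => z _; rewrite /G /g /=; congr EFin; ring.
have half1 : (\int[prodm mu mu]_pq A1 pq <= C%:E * \int[mu]_p (2^-1 * h p ^+ 2)%:E)%E.
  rewrite fubini_tonelli1// /fubini_F -ge0_integralZl//.
  apply: ge0_le_integral => //.
  - by move=> p _; apply: integral_ge0.
  - exact: measurable_fun_fubini_tonelli_F.
  - exact: measurable_funeM.
  move=> p _; rewrite /A1 /= ge0_integralZl//=; last first.
    by apply: emeasurable_funM => //; exact: (measurableT_comp mK).
  by rewrite muleC lee_wpmul2r// schur1.
have half2 : (\int[prodm mu mu]_pq A2 pq <= C%:E * \int[mu]_p (2^-1 * h p ^+ 2)%:E)%E.
  rewrite fubini_tonelli2// /fubini_G -ge0_integralZl//.
  apply: ge0_le_integral => //.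
  - by move=> p _; apply: integral_ge0.
  - exact: measurable_fun_fubini_tonelli_G.
  - exact: measurable_funeM.
  move=> p _; rewrite /A2 /= ge0_integralZl//=; last first.
    by apply: emeasurable_funM => //; exact: (measurableT_comp mK).
  by rewrite muleC lee_wpmul2r// schur2.
apply: (@le_trans _ _ (\int[prodm mu mu]_pq (A1 pq + A2 pq))%E); last first.
  rewrite ge0_integralD//; apply: (le_trans (leeD half1 half2)).
  rewrite -ge0_muleDr ?integral_ge0//.
  rewrite -ge0_integralD//; apply: lee_wpmul2l; first by rewrite lee_fin.
  by rewrite le_eqVlt; apply/orP; left; apply/eqP; apply: eq_integral => p _;
    rewrite -EFinD; congr EFin; field.
apply: (@le_trans _ _ (\int[prodm mu mu]_pq `|(h pq.1 * h pq.2 * kap pq)%:E|)%E).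
  by apply: (le_trans (lee_abs _)); exact: le_abse_integral.
apply: ge0_le_integral => //.
- exact: measurableT_comp.
- exact: emeasurable_funD.
move=> [p q] _; rewrite /A1 /A2 /=.
have [Ep|nEp] := pselect (E p); last first.
  by rewrite (hE nEp) !mul0r normr0 adde_ge0// mule_ge0.
have [Eq|nEq] := pselect (E q); last first.
  by rewrite (hE nEq) mulr0 mul0r normr0 adde_ge0// mule_ge0.
rewrite !indicE !mem_set//= !mule1 -ge0_muleDl// -EFinD normrM EFinM.
apply: lee_pmul => //; last exact: kernel_le.
by rewrite lee_fin ler_norml; have := sqr_ge0 (h p + h q); have := sqr_ge0 (h p - h q);
  lra.
Qed.

End TTstar.

(** * Affine changes of variable for Lebesgue measure *)

Section Affine.
Variable R : realType.
Notation leb := (@lebesgue_measure R).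
Implicit Types (f : R -> \bar R) (a b c : R).

Lemma measurable_affine a b :
  measurable_fun setT (fun x : R => a * x + b : measurableTypeR R).
Proof. by apply: measurable_funD => //; apply: measurable_funM. Qed.

(** The rescaled pushforward gives every half-open interval its length, so uniqueness of Lebesgue
    measure applies. *)
Lemma lebesgue_measure_affine a b (A : set R) : 0 < a -> measurable A ->
  leb A = (a%:E * pushforward leb (fun x : R => (a * x + b)%R : measurableTypeR R) A)%E.
Proof.
move=> a0 mA; pose k : {nonneg R} := NngNum (ltW a0).
have maff := measurable_affine a b.
pose m : {measure set (measurableTypeR R) -> \bar R} := mscale k
  (measure_function_pushforward__canonical__measure_function_Measure leb maff).
rewrite -[RHS]/(m A); apply: lebesgue_measure_unique => //= _ [[c d]] _ <-.
rewrite /m /mscale /= /pushforward /=.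
rewrite (_ : _ @^-1` _ = `](c - b) / a, (d - b) / a]%classic); last first.
  apply/seteqP; split => x /=; rewrite !in_itv/= ltr_pdivrMr// ler_pdivlMr//;
  by rewrite ltrBlDr lerBrDr mulrC.
rewrite !lebesgue_measure_itv/= !lte_fin ltr_pM2r ?invr_gt0// ltrD2r.
case: ifPn => _; last by rewrite mule0.
by rewrite -!EFinB -EFinM; congr EFin; field; rewrite gt_eqF.
Qed.

Lemma ge0_integral_affine a b f : 0 < a -> measurable_fun setT f ->
  (forall x, 0 <= f x)%E ->
  (\int[leb]_x f x = a%:E * \int[leb]_x f (a * x + b)%R)%E.
Proof.
move=> a0 mf f0; pose k : {nonneg R} := NngNum (ltW a0).
have maff := measurable_affine a b.
pose m : {measure set (measurableTypeR R) -> \bar R} := mscale k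
  (measure_function_pushforward__canonical__measure_function_Measure leb maff).
rewrite (eq_measure_integral m); last first.
  by move=> A mA _; rewrite /= (lebesgue_measure_affine b a0).
by rewrite ge0_integral_mscale//= ge0_integral_pushforward.
Qed.

Lemma ge0_integral_shift b f : measurable_fun setT f ->
  (forall x, 0 <= f x)%E -> (\int[leb]_x f (x + b)%R = \int[leb]_x f x)%E.
Proof.
move=> mf f0; rewrite [RHS](ge0_integral_affine b ltr01)// mul1e.
by apply: eq_integral => x _; rewrite mul1r.
Qed.

Lemma ge0_integral_opp f : measurable_fun setT f ->
  (forall x, 0 <= f x)%E -> (\int[leb]_x f (- x)%R = \int[leb]_x f x)%E.
Proof.
move=> mf f0.
rewrite [RHS](eq_measure_integral (pushforward leb (-%R : _ -> measurableTypeR R))).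
  by rewrite ge0_integral_pushforward//; exact: measurable_oppr.
by move=> A mA _; rewrite /= lebesgue_measureN.
Qed.

Lemma ge0_integral_reflect c f : measurable_fun setT f ->
  (forall x, 0 <= f x)%E -> (\int[leb]_x f (c - x)%R = \int[leb]_x f x)%E.
Proof.
move=> mf f0; rewrite -(ge0_integral_shift c mf f0) -[RHS]ge0_integral_opp//.
  by apply: eq_integral => x _; rewrite addrC.
by apply: (measurableT_comp mf); exact: measurable_funD.
Qed.

End Affine.

Section Affine2.
Variable R : realType.
Notation leb := (@lebesgue_measure R).
Implicit Types (f : R * R -> \bar R).

Lemma ge0_integral_reflect2 (y : R * R) f : measurable_fun setT f ->
  (forall x, 0 <= f x)%E ->
  (\int[@leb2 R]_x f ((y.1 - x.1)%R, (y.2 - x.2)%R) = \int[@leb2 R]_x f x)%E.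
Proof.
move=> mf f0; rewrite fubini_tonelli1//; last first.
  apply: (measurableT_comp mf); apply: measurable_fun_pair;
  by apply: measurable_funB.
rewrite fubini_tonelli1// /fubini_F /=.
have inner x1 : (\int[leb]_x2 f ((y.1 - x1)%R, (y.2 - x2)%R) =
    \int[leb]_x2 f ((y.1 - x1)%R, x2))%E.
  apply: (ge0_integral_reflect y.2 (f := fun x2 => f ((y.1 - x1)%R, x2))) => //.
  exact: measurableT_comp.
under eq_integral => x1 _ do rewrite inner.
rewrite (ge0_integral_reflect y.1 (f := fun x1 => \int[leb]_x2 f (x1, x2))%E)//.
  exact: (measurable_fun_fubini_tonelli_F (m2 := [the {sigma_finite_measure set _ -> \bar R} of leb]) f mf f0).
by move=> x; exact: integral_ge0.
Qed.

Lemma ge0_integral_dilate2 (a : R) (y : R * R) f : 0 < a -> measurable_fun setT f ->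
  (forall x, 0 <= f x)%E ->
  (\int[@leb2 R]_x f x =
   (a ^+ 2)%:E * \int[@leb2 R]_x f ((a * x.1 + y.1)%R, (a * x.2 + y.2)%R))%E.
Proof.
move=> a0 mf f0.
have mg : measurable_fun setT (fun x : R * R => f ((a * x.1 + y.1)%R, (a * x.2 + y.2)%R)).
  apply: (measurableT_comp mf); apply: measurable_fun_pair;
  by apply: measurable_funD => //; apply: measurable_funM.
rewrite fubini_tonelli1// fubini_tonelli1// /fubini_F /=.
rewrite (ge0_integral_affine y.1 a0 (f := fun x1 => \int[leb]_x2 f (x1, x2))%E); last 2 first.
- exact: (measurable_fun_fubini_tonelli_F (m2 := [the {sigma_finite_measure set _ -> \bar R} of leb]) f mf f0).
- by move=> x; exact: integral_ge0.
rewrite expr2 EFinM -muleA; congr (_ * _)%E.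
rewrite -ge0_integralZl//; last first.
- by rewrite lee_fin ltW.
- by move=> x _; rewrite integral_ge0.
- exact: (measurable_fun_fubini_tonelli_F (m2 := [the {sigma_finite_measure set _ -> \bar R} of leb]) _ mg).
apply: eq_integral => x1 _.
apply: (ge0_integral_affine y.2 a0 (f := fun x2 => f ((a * x1 + y.1)%R, x2))) => //.
exact: measurableT_comp.
Qed.

End Affine2.

(** * The extension estimate on L^2 *)

Section TriangleWeight.
Variable R : realType.
Notation leb := (@lebesgue_measure R).

Lemma Rintegral_derive (F f : R -> R) (a b : R) : a < b -> continuous f ->
  (forall x, is_derive x (1 : R) F (f x)) -> \int[leb]_(x in `[a, b]) f x = F b - F a.
Proof.
move=> ab cf dF; rewrite /Rintegral (@continuous_FTC2 _ f F a b)//.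
- exact: continuous_subspaceT.
- have cF x : {for x, continuous F}.
    by apply/differentiable_continuous/derivable1_diffP; case: (dF x).
  split; first by move=> x _; case: (dF x).
  + by apply: cvg_at_right_filter; exact: cF.
  + by apply: cvg_at_left_filter; exact: cF.
- by move=> x _; rewrite derive1E; case: (dF x).
Qed.

(** A triangle rather than a sharp cutoff: its transform is a Fejer kernel, whose quadratic decay
    makes it integrable with a bound independent of [N]. *)
Definition tri (N x : R) : R := Num.max 0 (1 - `|x| / N).

Lemma tri_ge0 N x : 0 <= tri N x.
Proof. by rewrite /tri le_max lexx. Qed.

Lemma tri_le1 N x : 0 < N -> tri N x <= 1.
Proof. by move=> N0; rewrite /tri ge_max ler01 gerBl divr_ge0// ltW. Qed.

Lemma measurable_tri N : measurable_fun setT (tri N).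
Proof.
apply: measurable_maxr => //; apply: measurable_funB => //.
by apply: measurable_funM => //; exact: measurable_normr.
Qed.

Lemma tri_restrict N : 0 < N -> tri N = (fun x => 1 - `|x| / N) \_ `[- N, N].
Proof.
move=> N0; apply/funext => x; rewrite /patch /tri mem_setE in_itv/= -ler_norml.
case: ifPn => [xN|]; [rewrite max_r// subr_ge0 ler_pdivrMr// mul1r//|].
by rewrite -ltNge => xN; rewrite max_l// subr_le0 ler_pdivlMr// mul1r ltW.
Qed.

Lemma integrable_tri N : 0 < N -> leb.-integrable setT (EFin \o tri N).
Proof.
move=> N0; have := integrable_indic_itv (- N) N true false.
apply: le_integrableR => [|x]; first exact: measurable_tri.
rewrite ger0_norm ?tri_ge0// tri_restrict// /patch indicE.
case: ifPn => // _; rewrite ?lexx// gerBl divr_ge0// ltW//.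
Qed.

Lemma tri_nondecreasing N N' x : 0 < N -> N <= N' -> tri N x <= tri N' x.
Proof.
move=> N0 NN'; rewrite /tri ge_max !le_max lexx/=; apply/orP; right.
by rewrite lerB// ler_wpM2l// lef_pV2 ?posrE// (lt_le_trans N0).
Qed.

Definition kern (N u : R) : R := \int[leb]_x (tri N x * cos (x * u)).

Lemma integrable_tri_cos N (g : R -> R) : 0 < N -> measurable_fun setT g ->
  leb.-integrable setT (EFin \o (fun x => tri N x * cos (g x))).
Proof.
move=> N0 mg; apply: (le_integrableR _ _ (integrable_tri N0)).
  by apply: measurable_funM; [exact: measurable_tri|exact: measurable_cos_comp].
move=> x; rewrite normrM (ger0_norm (tri_ge0 _ _)) ler_piMr ?tri_ge0//.
by rewrite ler_norml cos_geN1 cos_le1.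
Qed.

(** The weight is bounded by the indicator of its support, of length 2 N. The loss is harmless, as
    this bound serves only near u = 0. *)
Lemma kern_le_linear N u : 0 < N -> `|kern N u| <= 2 * N.
Proof.
move=> N0; have lin : measurable_fun setT (fun x : R => x * u) by exact: measurable_funM.
have ind := integrable_indic_itv (- N) N true false.
apply: (le_trans (le_normr_Rintegral measurableT (integrable_tri_cos N0 lin))).
apply: (@le_trans _ _ (\int[leb]_x (\1_(`[(- N)%R, N]%classic) x))).
  apply: le_Rintegral => //.
    exact: (integrable_norm (integrable_tri_cos N0 lin)).
  move=> x _; rewrite normrM (ger0_norm (tri_ge0 _ _)).
  apply: (@le_trans _ _ (tri N x)).
    by rewrite ler_piMr ?tri_ge0// ler_norml cos_geN1 cos_le1.
  rewrite tri_restrict// /patch indicE.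
  by case: ifPn => // _; rewrite ?lexx// gerBl divr_ge0// ltW//.
rewrite /Rintegral integral_indic// setIT [X in fine X]lebesgue_measure_itv/= lte_fin.
by case: ifPn => _ /=; nra.
Qed.

Lemma Rintegral_tri_cos_neq0 N u b : 0 < N -> u != 0 ->
  \int[leb]_x (tri N x * cos (x * u + b)) =
  2 * (1 - cos (N * u)) / (N * u ^+ 2) * cos b.
Proof.
move=> N0 u0.
have lin : measurable_fun setT (fun x : R => x * u + b).
  by apply: measurable_funD => //; exact: measurable_funM.
have itc := integrable_tri_cos N0 lin.
have Nn0 : N != 0 by rewrite gt_eqF.
have ccos (k : R) : continuous (fun x : R => (1 + x * k) * cos (x * u + b)).
  move=> x; apply: cvgM; first by apply: cvgD; [exact: cvg_cst|apply: cvgMl; exact: cvg_id].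
  apply: (@cvg_comp _ _ _ (fun x => x * u + b) cos); last exact: continuous_cos.
  by apply: cvgD; [apply: cvgMl; exact: cvg_id|exact: cvg_cst].
(* A primitive of (1 + k x) cos (x u + b), used with k = 1/N on the left half of the triangle and k
   = -1/N on the right. Its sine term vanishes at both ends and cancels at 0 between the halves. *)
pose F (k x : R) := (1 + x * k) * (sin (x * u + b) / u) + k / u ^+ 2 * cos (x * u + b).
have dF (k x : R) : is_derive x (1 : R) (F k) ((1 + x * k) * cos (x * u + b)).
  rewrite /F; apply: is_derive_eq.
  by rewrite /GRing.scale /=; field.
have neg : \int[leb]_(x in `[(- N)%R, 0]) (tri N x * cos (x * u + b)) =
    F N^-1 0 - F N^-1 (- N).
  rewrite -Rintegral_derive ?oppr_lt0//; apply: eq_Rintegral => x.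
  rewrite inE/= in_itv/= => /andP[Nx x0]; rewrite /tri ler0_norm// mulNr opprK max_r//.
  by have : - x / N <= 1 by [rewrite ler_pdivrMr//; lra]; rewrite mulNr; lra.
have pos : \int[leb]_(x in `[0, N]) (tri N x * cos (x * u + b)) =
    F (- N^-1) N - F (- N^-1) 0.
  rewrite -Rintegral_derive//; apply: eq_Rintegral => x.
  rewrite inE/= in_itv/= => /andP[x0 Nx]; rewrite /tri ger0_norm// mulrN max_r//.
  by rewrite subr_ge0 ler_pdivrMr// mul1r.
have : \int[leb]_x (tri N x * cos (x * u + b)) =
    \int[leb]_(x in `[(- N)%R, 0]) (tri N x * cos (x * u + b)) +
    \int[leb]_(x in `[0, N]) (tri N x * cos (x * u + b)).
  transitivity (\int[leb]_(x in `[(- N)%R, N]) (tri N x * cos (x * u + b))).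
    rewrite [RHS]Rintegral_mkcond; apply: eq_Rintegral => x _.
    rewrite /patch; case: ifPn => // xN; rewrite tri_restrict// /patch.
    by rewrite (negbTE xN) mul0r.
  have iN : leb.-integrable `[(- N)%R, N] (EFin \o (fun x => tri N x * cos (x * u + b))).
    exact: (integrableS _ _ _ itc).
  have := Rintegral_itvB iN (x := 0); rewrite !bnd_simp oppr_le0 (ltW N0) => /(_ isT isT).
  rewrite Rintegral_itv_obnd_cbnd; first by move=> <-; ring.
  by apply: (integrableS _ _ _ itc).
move=> ->; rewrite neg pos /F.
have -> : cos (- N * u + b) = cos (N * u - b) by rewrite -cosN; congr cos; ring.
rewrite !mul0r !add0r cosB cosD.
by field; rewrite u0.
Qed.

End TriangleWeight.

(** * The Fejer kernel and its dyadic majorant *)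

Section KernelMajorant.
Variable R : realType.
Notation leb := (@lebesgue_measure R).

(** The weight is even, so only cos b comes out of the phase. The offset [b] is there to hold the
    remaining coordinates when a multiple integral is computed one variable at a time. *)
Lemma Rintegral_tri_cos (N u b : R) : 0 < N ->
  \int[leb]_x (tri N x * cos (x * u + b)) = kern N u * cos b.
Proof.
move=> N0; have [->|u0] := eqVneq u 0.
  rewrite /kern -RintegralZr//.
    by apply: eq_Rintegral => x _; rewrite !mulr0 add0r cos0 mulr1.
  by apply: integrable_tri_cos => //; exact: measurable_funM.
rewrite Rintegral_tri_cos_neq0// /kern; congr (_ * _).
under [RHS]eq_Rintegral => x _ do rewrite -[x * u]addr0.
by rewrite Rintegral_tri_cos_neq0// cos0 mulr1.
Qed.

Lemma kern_le_quadratic (N u : R) : 0 < N -> u != 0 -> `|kern N u| <= 4 / (N * u ^+ 2).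
Proof.
move=> N0 u0; have := Rintegral_tri_cos_neq0 0 N0 u0.
rewrite Rintegral_tri_cos// cos0 !mulr1 => ->.
have Nu : 0 < N * u ^+ 2 by rewrite mulr_gt0// exprn_even_gt0.
rewrite normrM (ger0_norm (x := (_)^-1)) ?invr_ge0 ?(ltW Nu)//.
rewrite ler_pM2r ?invr_gt0// ger0_norm; first by have := cos_geN1 (N * u); lra.
by have := cos_le1 (N * u); lra.
Qed.

(** A combination of indicators, so that integrating it against a function needs only the measures
    of slabs. The coefficient 16 N 4^-j is 4 / (N u^2) at the inner radius |u| = 2^(j-1) / N of the
    j-th annulus, and for j = 0 it exceeds the linear bound 2 N. *)
Definition kmaj (N u : R) : \bar R :=
  (\sum_(0 <= j <oo) (16 * N * 4^-1 ^+ j *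
     \1_(`[- (2 ^+ j / N), 2 ^+ j / N]%classic) u)%:E)%E.

Let kmaj_term_ge0 (N u : R) j : 0 < N -> (0 <= (16 * N * 4^-1 ^+ j *
     \1_(`[- (2 ^+ j / N), 2 ^+ j / N]%classic) u)%:E)%E.
Proof. by move=> N0; rewrite lee_fin !mulr_ge0// ?exprn_ge0// ?invr_ge0// ltW. Qed.

Lemma kmaj_ge0 N u : 0 < N -> (0 <= kmaj N u)%E.
Proof. by move=> N0; apply: nneseries_ge0 => *; exact: kmaj_term_ge0. Qed.

Lemma measurable_kmaj N : 0 < N -> measurable_fun setT (kmaj N).
Proof.
move=> N0; apply: ge0_emeasurable_sum => [j x _ _|j _]; first exact: kmaj_term_ge0.
by apply/measurable_EFinP; apply: measurable_funM => //; exact: measurable_indic.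
Qed.

(* The dyadic annulus containing [u] contributes at least [kern_le_quadratic]. *)
Lemma kern_le_kmaj N u : 0 < N -> (`|kern N u|%:E <= kmaj N u)%E.
Proof.
move=> N0.
have term j : `|kern N u| <= 16 * N * 4^-1 ^+ j -> `|u| <= 2 ^+ j / N ->
    (`|kern N u|%:E <= kmaj N u)%E.
  move=> kj uj; rewrite /kmaj (@nneseriesD1 _ _ j)//; last by move=> *; exact: kmaj_term_ge0.
  rewrite indicE mem_set; last by rewrite /= in_itv/= -ler_norml.
  rewrite mulr1 -[leLHS]adde0 leeD ?lee_fin//.
  by apply: nneseries_ge0 => *; exact: kmaj_term_ge0.
have ex : exists j, `|u| * N <= 2 ^+ j.
  exists (Num.trunc (`|u| * N)).+1.
  apply: (@le_trans _ _ ((Num.trunc (`|u| * N)).+1)%:R).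
    by rewrite ltW// truncnS_gt.
  by rewrite -natrX ler_nat ltnW// ltn_expl.
case: (ex_minnP ex) => -[|j] uj jmin.
  apply: (term 0%N); rewrite ?ler_pdivlMr//.
  by rewrite expr0 mulr1 (le_trans (kern_le_linear u N0))// ler_pM2r//; lra.
apply: (term j.+1); rewrite ?ler_pdivlMr//.
have ju : 2 ^+ j < `|u| * N.
  by rewrite ltNge; apply/negP => /jmin; rewrite ltnn.
have u0 : u != 0.
  by apply/eqP => u0; move: ju; rewrite u0 normr0 mul0r ltNge exprn_ge0.
apply: (le_trans (kern_le_quadratic N0 u0)).
have Nu : 0 < N * u ^+ 2 by rewrite mulr_gt0// exprn_even_gt0.
rewrite exprVn ler_pdivrMr// mulrAC ler_pdivlMr ?exprn_gt0//.
have : (2 ^+ j) ^+ 2 <= (`|u| * N) ^+ 2.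
  by rewrite ler_sqr ?nnegrE ?exprn_ge0 ?mulr_ge0// ltW.
rewrite exprMn real_normK ?num_real// -exprM mulnC exprM => h.
have {}h : 4 ^+ j <= u ^+ 2 * N ^+ 2 by rewrite (_ : 4 = 2 ^+ 2 :> R)// expr2; ring.
by rewrite exprS; lra.
Qed.

(** The j-th slab has width 2 * 2^j / N and coefficient 16 N 4^-j, hence contributes at most 32 C
    2^-j. The parameter N cancels and the geometric series sums to 64 C. *)
Lemma integral_kmaj_le d (X : measurableType d) (mu : {measure set X -> \bar R})
  (A : set X) (psi : X -> R) (C N c : R) : 0 < N -> 0 <= C ->
  measurable A -> measurable_fun setT psi ->
  (forall a b, a < b -> (mu (A `&` [set x | (a <= psi x <= b)%R]) <= (C * (b - a))%:E)%E) ->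
  (\int[mu]_x (kmaj N (c - psi x) * (\1_A x)%:E) <= (64 * C)%:E)%E.
Proof.
move=> N0 C0 mA mpsi slab.
pose S j := A `&` [set x | c - 2 ^+ j / N <= psi x <= c + 2 ^+ j / N].
have mS j : measurable (S j).
  apply: measurableI => //.
  rewrite (_ : [set x | _] = psi @^-1` `[c - 2 ^+ j / N, c + 2 ^+ j / N]).
    by rewrite -[X in measurable X]setTI; exact: mpsi.
  by apply/seteqP; split => x /=; rewrite in_itv.
have coef0 j : 0 <= 16 * N * 4^-1 ^+ j.
  by rewrite !mulr_ge0// ?exprn_ge0// ?invr_ge0// ltW.
rewrite (eq_integral (fun x => \sum_(0 <= j <oo)
    ((16 * N * 4^-1 ^+ j)%:E * (\1_(S j) x)%:E))%E); last first.
  move=> x _; rewrite /kmaj muleC -nneseriesZl; last by move=> *; exact: kmaj_term_ge0.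
  apply: eq_eseriesr => j _; rewrite -!EFinM; congr EFin.
  rewrite mulrCA; congr (_ * _); rewrite /S indicI/=; congr (_ * _).
  rewrite !indicE; congr ((nat_of_bool _)%:R); apply/idP/idP; rewrite !inE/= in_itv/=; lra.
rewrite integral_nneseries//; last 2 first.
- by move=> j; apply: measurable_funeM; apply/measurable_EFinP; exact: measurable_indic.
- by move=> j x _; rewrite mule_ge0 ?lee_fin.
apply: (@le_trans _ _ (\sum_(0 <= j <oo) (64 * C / (2 ^ j.+1)%:R)%:E)%E); last first.
  by apply: (epsilon_trick0 xpredT); rewrite mulr_ge0.
apply: lee_nneseries => [j _ _|j _]; first by apply: integral_ge0 => x _; rewrite mule_ge0 ?lee_fin.
rewrite ge0_integralZl//; first last.
- by rewrite lee_fin.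
- by apply/measurable_EFinP; exact: measurable_indic.
rewrite integral_indic// setIT.
apply: (@le_trans _ _ ((16 * N * 4^-1 ^+ j)%:E * (C * (2 * (2 ^+ j / N)))%:E)%E).
  apply: lee_wpmul2l; first by rewrite lee_fin.
  apply: (le_trans (slab _ _ _)).
    by have : 0 < 2 ^+ j / N by [rewrite divr_gt0 ?exprn_gt0]; lra.
  by rewrite lee_fin ler_wpM2l//; lra.
rewrite -EFinM lee_fin le_eqVlt; apply/orP; left; apply/eqP.
rewrite natrX exprS exprVn (_ : 4 = 2 * 2 :> R); last by ring.
by rewrite exprMn; field; rewrite expf_neq0//= gt_eqF.
Qed.

End KernelMajorant.

Section ParametricIntegral.
Context d1 d2 (T1 : measurableType d1) (T2 : measurableType d2) (R : realType).
Variable m2 : {sigma_finite_measure set T2 -> \bar R}.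

(** Positive and negative parts are treated separately by Tonelli, so measurability of the
    transforms is available before their integrability is proved. *)
Lemma measurable_Rintegral (f : T1 * T2 -> R) : measurable_fun setT f ->
  measurable_fun setT (fun x => \int[m2]_y f (x, y)).
Proof.
move=> mf; have mEf : measurable_fun setT (EFin \o f) by exact/measurable_EFinP.
apply: measurableT_comp => //.
rewrite (_ : (fun x => _) = (fun x => \int[m2]_y (EFin \o f)^\+ (x, y)) \-
    (fun x => \int[m2]_y (EFin \o f)^\- (x, y)))%E; last first.
  apply/funext=> x; rewrite [LHS]integralE.
  by congr (_ - _)%E; apply: eq_integral => y _; rewrite unlock.
apply: emeasurable_funB.
  apply: (measurable_fun_fubini_tonelli_F (EFin \o f)^\+)%E.
    exact: measurable_funepos.
  by move=> x; exact: funepos_ge0.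
apply: (measurable_fun_fubini_tonelli_F (EFin \o f)^\-)%E.
  exact: measurable_funeneg.
by move=> x; exact: funeneg_ge0.
Qed.

Lemma Rintegral_fubini (m1 : {sigma_finite_measure set T1 -> \bar R})
  (f : T1 * T2 -> R) (g : T1 -> R) :
  (m1 \x m2)%E.-integrable setT (EFin \o f) ->
  (forall x, m2.-integrable setT (EFin \o (fun y => f (x, y)))) ->
  (forall x, \int[m2]_y f (x, y) = g x) ->
  \int[(m1 \x m2)%E]_z f z = \int[m1]_x g x.
Proof.
move=> intf intfx fg; have := integral12_prod_meas1 intf; rewrite /Rintegral => <-.
congr fine; apply: eq_integral => x _; rewrite /fubini_F -fg.
by rewrite RintegralK.
Qed.

End ParametricIntegral.

(** * The three-variable transform and its truncated kernel *)

Section Transform.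
Context d (X : measurableType d) (R : realType).
Variable mu : {sigma_finite_measure set X -> \bar R}.
Variables (psi1 psi2 tau : X -> R).
Hypothesis mpsi1 : measurable_fun setT psi1.
Hypothesis mpsi2 : measurable_fun setT psi2.
Hypothesis mtau : measurable_fun setT tau.
Notation leb := (@lebesgue_measure R).

(** The phase of F for abstract frequencies: later [tau] is phi xi + phi eta, and [psi1], [psi2] are
    the coordinates of xi + eta. *)
Definition ph (zp : R * R * R * X) : R :=
  zp.1.2 * tau zp.2 + (zp.1.1.1 * psi1 zp.2 + zp.1.1.2 * psi2 zp.2).

Lemma measurable_ph : measurable_fun setT ph.
Proof.
have m1 : measurable_fun [set: R * R * R * X] (fun zp => zp.1.1).
  exact: (measurableT_comp measurable_fst measurable_fst).
have m2 : measurable_fun [set: R * R * R * X] (fun zp => zp.1.2).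
  exact: (measurableT_comp measurable_snd measurable_fst).
apply: measurable_funD; first by apply: measurable_funM => //; exact: measurableT_comp.
apply: measurable_funD; apply: measurable_funM.
- exact: (measurableT_comp measurable_fst m1).
- exact: measurableT_comp.
- exact: (measurableT_comp measurable_snd m1).
- exact: measurableT_comp.
Qed.

Definition tri3 (N : R) (z : R * R * R) : R := tri N z.1.1 * tri N z.1.2 * tri N z.2.

Lemma tri3_ge0 N z : 0 <= tri3 N z.
Proof. by rewrite !mulr_ge0// tri_ge0. Qed.

Let integrable_tri2 N : 0 < N ->
  (@leb2 R).-integrable setT (EFin \o (fun x : R * R => tri N x.1 * tri N x.2)).
Proof. by move=> N0; exact: (integrable_tensor (integrable_tri N0) (integrable_tri N0)). Qed.

Lemma integrable_tri3 N : 0 < N -> (@leb3 R).-integrable setT (EFin \o tri3 N).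
Proof.
by move=> N0; exact: (integrable_tensor (integrable_tri2 N0) (integrable_tri N0)).
Qed.

(** Each coordinate integrated out turns its linear phase into a factor [kern], with the other
    coordinates acting as the offset of [Rintegral_tri_cos]. *)
Lemma Rintegral_tri3_cos N (a b c : R) : 0 < N ->
  \int[@leb3 R]_z (tri3 N z * cos (z.2 * c + (z.1.1 * a + z.1.2 * b))) =
  kern N c * (kern N a * kern N b).
Proof.
move=> N0.
have mx1 : measurable_fun setT (fun x : R * R => x.1 * a + x.2 * b).
  by apply: measurable_funD; apply: measurable_funM.
have cos1 (u : R) : `|cos u| <= 1 by rewrite ler_norml cos_geN1 cos_le1.
have inner (x : R * R) : \int[leb]_s (tri N x.1 * tri N x.2 * tri N s *
    cos (s * c + (x.1 * a + x.2 * b))) =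
    kern N c * (tri N x.1 * tri N x.2 * cos (x.1 * a + x.2 * b)).
  rewrite mulrCA -Rintegral_tri_cos// -RintegralZl//.
    by apply: eq_Rintegral => s _; ring.
  by apply: integrable_tri_cos => //; apply: measurable_funD => //; exact: measurable_funM.
apply: etrans.
  apply: (Rintegral_fubini (m1 := @leb2 R) (m2 := leb)
    (f := fun z => tri3 N z * cos (z.2 * c + (z.1.1 * a + z.1.2 * b))) _ _ inner).
- apply: (le_integrableR _ _ (integrable_tri3 N0)).
    apply: measurable_funM; first exact: (integrable_mfun (integrable_tri3 N0)).
    apply: measurable_cos_comp; apply: measurable_funD; first exact: measurable_funM.
    exact: (measurableT_comp mx1).
  by move=> z; rewrite normrM (ger0_norm (tri3_ge0 _ _)) ler_piMr ?tri3_ge0.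
- move=> x; rewrite /tri3/=; apply: (le_integrableR _ _ (integrable_tri N0)).
    apply: measurable_funM; last first.
      by apply: measurable_cos_comp; apply: measurable_funD => //; exact: measurable_funM.
    by apply: measurable_funM; [exact: measurable_cst|exact: measurable_tri].
  move=> s; rewrite normrM ger0_norm ?mulr_ge0 ?tri_ge0//.
  rewrite (le_trans (y := tri N x.1 * tri N x.2 * tri N s))//.
    by rewrite ler_piMr ?mulr_ge0 ?tri_ge0.
  by rewrite ler_piMl ?tri_ge0// mulr_ile1 ?tri_ge0 ?tri_le1.
- rewrite RintegralZl//; last first.
    apply: (le_integrableR _ _ (integrable_tri2 N0)).
      apply: measurable_funM; last exact: measurable_cos_comp.
      exact: (integrable_mfun (integrable_tri2 N0)).
    by move=> x; rewrite normrM ger0_norm ?mulr_ge0 ?tri_ge0// ler_piMr ?mulr_ge0 ?tri_ge0.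
  congr (_ * _).
  have inner2 (x1 : R) : \int[leb]_x2 (tri N x1 * tri N x2 * cos (x1 * a + x2 * b)) =
      tri N x1 * cos (x1 * a) * kern N b.
    rewrite -mulrA [cos _ * _]mulrC -Rintegral_tri_cos// -RintegralZl//.
      by apply: eq_Rintegral => s _; rewrite -mulrA [x1 * a + _]addrC.
    by apply: integrable_tri_cos => //; apply: measurable_funD => //; exact: measurable_funM.
  apply: etrans.
    apply: (Rintegral_fubini (m1 := leb) (m2 := leb)
      (f := fun x => tri N x.1 * tri N x.2 * cos (x.1 * a + x.2 * b)) _ _ inner2).
  + apply: (le_integrableR _ _ (integrable_tri2 N0)).
      apply: measurable_funM; last exact: measurable_cos_comp.
      exact: (integrable_mfun (integrable_tri2 N0)).
    by move=> x; rewrite normrM ger0_norm ?mulr_ge0 ?tri_ge0// ler_piMr ?mulr_ge0 ?tri_ge0.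
  + move=> x1 /=; apply: (le_integrableR _ _ (integrable_tri N0)).
      apply: measurable_funM; last first.
        by apply: measurable_cos_comp; apply: measurable_funD => //; exact: measurable_funM.
      by apply: measurable_funM; [exact: measurable_cst|exact: measurable_tri].
    move=> x2; rewrite normrM ger0_norm ?mulr_ge0 ?tri_ge0//.
    rewrite (le_trans (y := tri N x1 * tri N x2))//.
      by rewrite ler_piMr ?mulr_ge0 ?tri_ge0.
    by rewrite ler_piMl ?tri_ge0// tri_le1.
  + rewrite RintegralZr//; apply: integrable_tri_cos => //; exact: measurable_funM.
Qed.

End Transform.

Lemma lee_mul3 (R : realType) (a b c : R) (x y z : \bar R) :
  (`|a|%:E <= x -> `|b|%:E <= y -> `|c|%:E <= z ->
   `|a|%:E * (`|b|%:E * `|c|%:E) <= x * (y * z))%E.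
Proof.
have n0 (r : R) : (0 <= `|r|%:E)%E by rewrite lee_fin.
by move=> ax bX cz; apply: lee_pmul => //; apply: lee_pmul.
Qed.

(** * The L^2 bound for the transform of real functions *)

Section ExtensionBound.
Context d (X : measurableType d) (R : realType).
Variable mu : {sigma_finite_measure set X -> \bar R}.
Variables (psi1 psi2 tau : X -> R) (E : set X) (C : R).
Hypothesis mpsi1 : measurable_fun setT psi1.
Hypothesis mpsi2 : measurable_fun setT psi2.
Hypothesis mtau : measurable_fun setT tau.
Hypothesis mE : measurable E.
Hypothesis C0 : 0 <= C.
Hypothesis schur : forall N a b c : R, 0 < N ->
  (\int[mu]_q (kmaj N (c - tau q) * (kmaj N (a - psi1 q) * kmaj N (b - psi2 q)) *
    (\1_E q)%:E) <= C%:E)%E.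

Notation th := (ph psi1 psi2 tau).

(** Evenness reduces the second Schur condition to the first. *)
Lemma kmajN N (u : R) : kmaj N (- u) = kmaj N u.
Proof.
rewrite /kmaj; apply: eq_eseriesr => j _; congr (_ * _)%:E.
by rewrite !indicE; congr ((nat_of_bool _)%:R); apply/idP/idP; rewrite !inE/= !in_itv/=; lra.
Qed.

Lemma measurable_cos_tr (h : X -> R) : measurable_fun setT h ->
  measurable_fun setT (cos_tr mu th h).
Proof.
move=> mh; apply: (measurable_Rintegral mu (f := fun zp => h zp.2 * cos (th zp))).
apply: measurable_funM; first exact: measurableT_comp.
by apply: measurable_cos_comp; exact: measurable_ph.
Qed.

Lemma measurable_sin_tr (h : X -> R) : measurable_fun setT h ->
  measurable_fun setT (sin_tr mu th h).
Proof.
move=> mh; apply: (measurable_Rintegral mu (f := fun zp => h zp.2 * sin (th zp))).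
apply: measurable_funM; first exact: measurableT_comp.
by apply: measurable_sin_comp; exact: measurable_ph.
Qed.

Lemma extension_bound_tri (h : X -> R) N : 0 < N ->
  mu.-integrable setT (EFin \o h) -> (forall x, ~ E x -> h x = 0) ->
  (\int[@leb3 R]_z (tri3 N z * (cos_tr mu th h z ^+ 2 + sin_tr mu th h z ^+ 2))%:E <=
   C%:E * \int[mu]_p (h p ^+ 2)%:E)%E.
Proof.
move=> N0 ih hE.
pose K (pq : X * X) := (kmaj N (tau pq.1 - tau pq.2) *
  (kmaj N (psi1 pq.1 - psi1 pq.2) * kmaj N (psi2 pq.1 - psi2 pq.2)))%E.
have mdiff (f : X -> R) : measurable_fun setT f ->
    measurable_fun setT (fun pq : X * X => kmaj N (f pq.1 - f pq.2)).
  move=> mf; apply: (measurableT_comp (measurable_kmaj N0)).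
  by apply: measurable_funB; exact: measurableT_comp.
have k0 u : (0 <= kmaj N u)%E by exact: kmaj_ge0.
have H := @schur_bound _ _ _ _ _ (@leb3 R) mu th (tri3 N) h E K C; apply: H => //.
- exact: measurable_ph.
- exact: tri3_ge0.
- exact: integrable_tri3.
- by apply: emeasurable_funM; [exact: mdiff|apply: emeasurable_funM; exact: mdiff].
- by move=> pq; rewrite !mule_ge0.
- move=> p q; rewrite /K /=.
  rewrite (_ : \int[_]_z _ = \int[@leb3 R]_z (tri3 N z * cos (z.2 * (tau p - tau q) +
    (z.1.1 * (psi1 p - psi1 q) + z.1.2 * (psi2 p - psi2 q))))); last first.
    by apply: eq_Rintegral => z _; congr (_ * cos _); rewrite /ph /=; ring.
  rewrite Rintegral_tri3_cos// !normrM !EFinM.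
  by apply: lee_mul3; exact: kern_le_kmaj.
- by move=> p; exact: (schur (psi1 p) (psi2 p) (tau p) N0).
- move=> q; rewrite (eq_integral (fun p => kmaj N (tau q - tau p) *
    (kmaj N (psi1 q - psi1 p) * kmaj N (psi2 q - psi2 p)) * (\1_E p)%:E)%E); first exact: (schur (psi1 q) (psi2 q) (tau q) N0).
  move=> p _; rewrite /K /= -[X in kmaj N X]opprB kmajN.
  by rewrite -[psi1 p - _]opprB kmajN -[psi2 p - _]opprB kmajN.
Qed.

(** The truncated bound holds with the same [C] for all widths and the weights increase to 1, so
    monotone convergence removes the cutoff. *)
Theorem extension_bound (h : X -> R) :
  mu.-integrable setT (EFin \o h) -> (forall x, ~ E x -> h x = 0) ->
  (\int[@leb3 R]_z (cos_tr mu th h z ^+ 2 + sin_tr mu th h z ^+ 2)%:E <=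
   C%:E * \int[mu]_p (h p ^+ 2)%:E)%E.
Proof.
move=> ih hE; have mh := integrable_mfun ih.
pose G z := cos_tr mu th h z ^+ 2 + sin_tr mu th h z ^+ 2.
have G0 z : 0 <= G z by rewrite addr_ge0 ?sqr_ge0.
have mG : measurable_fun setT G.
  by apply: measurable_funD; apply: measurable_funX;
    [exact: measurable_cos_tr|exact: measurable_sin_tr].
have mg n : measurable_fun setT (fun z => (tri3 n.+1%:R z * G z)%:E).
  apply/measurable_EFinP; apply: measurable_funM => //.
  exact: (integrable_mfun (integrable_tri3 (ltr0Sn R n))).
have tri_cvg (x : R) : tri n.+1%:R x @[n --> \oo] --> (1 : R).
  apply: (@squeeze_cvgr _ _ _ _ (fun n => 1 - `|x| * n.+1%:R^-1) (cst 1)).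
  - by apply: nearW => n; rewrite tri_le1// /tri le_max lexx orbT.
  - rewrite -[X in _ --> X]subr0 -[X in _ --> _ - X](mulr0 `|x|).
    by apply: cvgB; [exact: cvg_cst|apply: cvgMr; exact: cvg_harmonic].
  - exact: cvg_cst.
have limG z : limn (fun n => (tri3 n.+1%:R z * G z)%:E) = (G z)%:E.
  have h3 : tri3 n.+1%:R z @[n --> \oo] --> (1 * 1 * 1 : R).
    by apply: cvgM => //; apply: cvgM.
  apply/cvg_lim => //; apply: cvg_EFin; first exact: nearW.
  have : tri3 n.+1%:R z * G z @[n --> \oo] --> 1 * 1 * 1 * G z.
    by apply: cvgM => //; exact: cvg_cst.
  by rewrite !mul1r.
have tri3_homo z : {homo (fun n => (tri3 n.+1%:R z * G z)%:E) : m n / (m <= n)%N >-> (m <= n)%E}.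
  move=> m n mn; rewrite lee_fin ler_wpM2r// /tri3.
  have le (x : R) : tri m.+1%:R x <= tri n.+1%:R x.
    by apply: tri_nondecreasing => //; rewrite ler_nat.
  by apply: ler_pM; rewrite ?mulr_ge0 ?tri_ge0//; apply: ler_pM; rewrite ?tri_ge0.
have triG0 n z : (0 <= (tri3 n.+1%:R z * G z)%:E)%E by rewrite lee_fin mulr_ge0// tri3_ge0.
have -> : (\int[@leb3 R]_z (cos_tr mu th h z ^+ 2 + sin_tr mu th h z ^+ 2)%:E =
    limn (fun n => \int[@leb3 R]_z (tri3 n.+1%:R z * G z)%:E))%E.
  have <- := monotone_convergence (@leb3 R) measurableT mg (fun n z _ => triG0 n z)
    (fun z _ => tri3_homo z).
  by apply: eq_integral => z _; rewrite limG.
apply: lime_le.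
  apply: ereal_nondecreasing_is_cvgn => m n mn; apply: ge0_le_integral => //.
  - exact: mg.
  - exact: mg.
  - by move=> z _; exact: tri3_homo.
by apply: nearW => n; exact: extension_bound_tri.
Qed.

End ExtensionBound.

(** * Completely monotone quadratic forms *)

Section TrigEstimates.
Variable R : realType.

Let MVT0 (f f' : R -> R) (u : R) : (forall x, is_derive x (1 : R) f (f' x)) ->
  exists2 c, `|c| <= `|u| & f u - f 0 = f' c * u.
Proof.
move=> df; have cf : continuous f.
  by move=> x; apply/differentiable_continuous/derivable1_diffP; case: (df x).
have [u0|u0] := leP 0 u.
  have [c] := MVT_segment u0 (fun x _ => df x) (continuous_subspaceT cf).
  rewrite in_itv/= subr0 => /andP[c0 cu] e; exists c => //.
  by rewrite !ger0_norm.
have [c] := MVT_segment (ltW u0) (fun x _ => df x) (continuous_subspaceT cf).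
rewrite in_itv/= sub0r => /andP[c0 cu] e; exists c; last by lra.
by rewrite ler0_norm// ltr0_norm// lerN2.
Qed.

Lemma sin_abs_le (u : R) : `|sin u| <= `|u|.
Proof.
have [c _] := MVT0 u (fun x => is_derive_sin x); rewrite sin0 subr0 => ->.
by rewrite normrM ler_piMl// ler_norml cos_geN1 cos_le1.
Qed.

(** Only the quadratic order matters in this estimate and the next; the mean value theorem gives it
    with a crude constant. *)
Lemma cos_sub1_abs_le (u : R) : `|cos u - 1| <= u ^+ 2.
Proof.
have [c cu] := MVT0 u (fun x => is_derive_cos x); rewrite cos0 => ->.
rewrite normrM normrN -real_normK ?num_real// expr2 ler_wpM2r//.
exact: le_trans (sin_abs_le _) cu.
Qed.

Lemma sin_sub_abs_le (u : R) : `|sin u - u| <= u ^+ 2.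
Proof.
have [c cu] : exists2 c, `|c| <= `|u| & (sin u - u) - (sin 0 - 0) = (cos c - 1) * u.
  by apply: (MVT0 (f := fun x => sin x - x)) => x; apply: is_derive_eq.
rewrite sin0 !subr0 => ->; rewrite normrM -real_normK ?num_real// expr2 ler_wpM2r//.
have [d dc] := MVT0 c (fun x => is_derive_cos x); rewrite cos0 => ->.
rewrite normrM normrN (le_trans _ cu)// ler_piMl//.
by rewrite ler_norml sin_geN1 sin_le1.
Qed.

End TrigEstimates.

(** * Moving [tau] across a form invariant under rotations *)

Section RotationShift.
Context (X : Type) (R : realType).
Variables (tau : X -> R) (M : R) (adm : (X -> R) -> Prop).
Variables B S : (X -> R) -> (X -> R) -> R.
Variable K : R.
Hypothesis tauM : forall x, `|tau x| <= M.
Hypothesis K0 : 0 <= K.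
Hypothesis adm_bounded : forall a, adm a -> exists2 L, 0 <= L & forall x, `|a x| <= L.
Hypothesis admD : forall a b, adm a -> adm b -> adm (fun x => a x + b x).
Hypothesis admM : forall a b, adm a -> adm b -> adm (fun x => a x * b x).
Hypothesis adm_cst : forall c, adm (fun=> c).
Hypothesis adm_tau : adm tau.
Hypothesis adm_cos : forall h, adm (fun x => cos (h * tau x)).
Hypothesis adm_sin : forall h, adm (fun x => sin (h * tau x)).
Hypothesis BDl : forall a a' b, adm a -> adm a' -> adm b ->
  B (fun x => a x + a' x) b = B a b + B a' b.
Hypothesis BDr : forall a b b', adm a -> adm b -> adm b' ->
  B a (fun x => b x + b' x) = B a b + B a b'.
Hypothesis BZl : forall c a b, adm a -> adm b -> B (fun x => c * a x) b = c * B a b.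
Hypothesis BZr : forall c a b, adm a -> adm b -> B a (fun x => c * b x) = c * B a b.
Hypothesis SDl : forall a a' b, adm a -> adm a' -> adm b ->
  S (fun x => a x + a' x) b = S a b + S a' b.
Hypothesis SDr : forall a b b', adm a -> adm b -> adm b' ->
  S a (fun x => b x + b' x) = S a b + S a b'.
Hypothesis SZl : forall c a b, adm a -> adm b -> S (fun x => c * a x) b = c * S a b.
Hypothesis SZr : forall c a b, adm a -> adm b -> S a (fun x => c * b x) = c * S a b.
Hypothesis B_le : forall a b L, adm a -> adm b -> 0 <= L ->
  (forall x, `|a x| <= L) -> (forall x, `|b x| <= L) -> `|B a b| <= K * L ^+ 2.
Hypothesis S_le : forall a b L, adm a -> adm b -> 0 <= L ->
  (forall x, `|a x| <= L) -> (forall x, `|b x| <= L) -> `|S a b| <= K * L ^+ 2.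
(** With [B] + i [S] read as a sesquilinear form, this is the imaginary part of its invariance when
    both arguments are multiplied by e^{i h tau}. The imaginary part is the right one to
    differentiate: there [B] comes with exactly one sine, which is of first order in h. *)
Hypothesis rot : forall h a b, adm a -> adm b ->
  let ca := fun x => cos (h * tau x) * a x in
  let sa := fun x => sin (h * tau x) * a x in
  let cb := fun x => cos (h * tau x) * b x in
  let sb := fun x => sin (h * tau x) * b x in
  S ca cb + B sa cb - B ca sb + S sa sb = S a b.

(* Differentiate the invariance [rot] at [h = 0]: the [S]-terms vary to second order only. *)
Lemma form_shift a b : adm a -> adm b ->
  B (fun x => tau x * a x) b = B a (fun x => tau x * b x).
Proof.
move=> Aa Ab.
have [La La0 aL] := adm_bounded Aa; have [Lb Lb0 bL] := adm_bounded Ab.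
(* One bound for [a], [b] and all their products with cos, [tau] and the remainder quotients below,
   independent of h. *)
pose L := (La + Lb) * (1 + `|M| + M ^+ 2).
have M2 : 0 <= M ^+ 2 by exact: sqr_ge0.
have Mn : 0 <= `|M| by [].
have L0 : 0 <= L by rewrite mulr_ge0// ?addr_ge0.
have tauM' x : `|tau x| <= `|M| by rewrite (le_trans (tauM x))// ler_norm.
have tau2 x : tau x ^+ 2 <= M ^+ 2.
  by rewrite -real_normK ?num_real// -[leRHS]real_normK ?num_real// lerXn2r ?nnegrE.
have key (h : R) : 0 < h -> h <= 1 ->
    `|B (fun x => tau x * a x) b - B a (fun x => tau x * b x)| <= h * (7 * (K * L ^+ 2)).
  move=> h0 h1; have hn0 : h != 0 by rewrite gt_eqF.
  have hv0 : 0 < h^-1 by rewrite invr_gt0.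
  (* Normalised remainders: as multipliers, cos = 1 + h^2 p and sin = h tau + h^2 q = h rh, with p,
     q, rh bounded uniformly in h. After S a b cancels, dividing by h leaves the wanted difference
     and seven error terms, each of size at most h K L^2; hence the 7. *)
  pose p (f : X -> R) := fun x => h^-1 ^+ 2 * ((cos (h * tau x) - 1) * f x).
  pose q (f : X -> R) := fun x => h^-1 ^+ 2 * ((sin (h * tau x) - h * tau x) * f x).
  pose rh (f : X -> R) := fun x => h^-1 * (sin (h * tau x) * f x).
  pose cc (f : X -> R) := fun x => cos (h * tau x) * f x.
  pose ss (f : X -> R) := fun x => sin (h * tau x) * f x.
  pose tt (f : X -> R) := fun x => tau x * f x.
  have Ap f : adm f -> adm (p f).
    move=> Af; apply: admM; first exact: adm_cst.
    by apply: admM => //; apply: admD => //; exact: adm_cst.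
  have Aq f : adm f -> adm (q f).
    move=> Af; apply: admM; first exact: adm_cst.
    apply: admM => //; apply: admD => //.
    by under eq_fun do rewrite -mulN1r; apply: admM; [exact: adm_cst|apply: admM].
  have Ar f : adm f -> adm (rh f).
    by move=> Af; apply: admM; [exact: adm_cst|apply: admM].
  have Ac f : adm f -> adm (cc f) by move=> Af; apply: admM.
  have As f : adm f -> adm (ss f) by move=> Af; apply: admM.
  have At f : adm f -> adm (tt f) by move=> Af; apply: admM.
  have u2 x : (h * tau x) ^+ 2 <= h ^+ 2 * M ^+ 2 by rewrite exprMn ler_wpM2l// sqr_ge0.
  have bnd (f : X -> R) (Lf : R) (g : R) x : 0 <= Lf -> Lf <= La + Lb -> `|f x| <= Lf ->
      forall c, `|g| <= c -> c <= 1 + `|M| + M ^+ 2 -> `|g * f x| <= L.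
    move=> Lf0 LfL fL c gc c1; rewrite normrM /L mulrC; apply: ler_pM => //.
      exact: le_trans LfL.
    exact: le_trans c1.
  have bf (f : X -> R) (Lf : R) : 0 <= Lf -> Lf <= La + Lb -> (forall x, `|f x| <= Lf) ->
      [/\ forall x, `|f x| <= L, forall x, `|p f x| <= L, forall x, `|q f x| <= L,
        forall x, `|rh f x| <= L & forall x, `|cc f x| <= L] /\ forall x, `|tt f x| <= L.
    move=> Lf0 LfL fL; split; last first.
      by move=> x; apply: (bnd _ Lf _ _ _ _ _ `|M|) => //; lra.
    split => x.
    - by rewrite -[f x]mul1r; apply: (bnd _ Lf _ _ _ _ _ 1) => //; rewrite ?normr1//; lra.
    - rewrite /p mulrA; apply: (bnd _ Lf _ _ _ _ _ (M ^+ 2)) => //; last by lra.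
      rewrite normrM ger0_norm ?exprn_ge0 ?(ltW hv0)// exprVn ler_pdivrMl ?exprn_gt0//.
      exact: le_trans (cos_sub1_abs_le _) (u2 x).
    - rewrite /q mulrA; apply: (bnd _ Lf _ _ _ _ _ (M ^+ 2)) => //; last by lra.
      rewrite normrM ger0_norm ?exprn_ge0 ?(ltW hv0)// exprVn ler_pdivrMl ?exprn_gt0//.
      exact: le_trans (sin_sub_abs_le _) (u2 x).
    - rewrite /rh mulrA; apply: (bnd _ Lf _ _ _ _ _ `|M|) => //; last by lra.
      rewrite normrM ger0_norm ?(ltW hv0)// ler_pdivrMl//.
      by rewrite (le_trans (sin_abs_le _))// normrM gtr0_norm// ler_wpM2l// ltW.
    - apply: (bnd _ Lf _ _ _ _ _ 1) => //; last by lra.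
      by rewrite ler_norml cos_geN1 cos_le1.
  have [|[a1 pa qa ra ca] ta] := bf a La La0 _ aL; first by lra.
  have [|[b1 pb qb rb cb] tb] := bf b Lb Lb0 _ bL; first by lra.
  have eqc f : cc f = fun x => f x + h ^+ 2 * p f x.
    by apply/funext => x; rewrite /cc /p; field.
  have eqs f : ss f = fun x => h * tt f x + h ^+ 2 * q f x.
    by apply/funext => x; rewrite /ss /q /tt; field.
  have eqr f : ss f = fun x => h * rh f x.
    by apply/funext => x; rewrite /ss /rh; field.
  have admh2 f : adm f -> adm (fun x => h ^+ 2 * f x) by move=> Af; apply: admM.
  have admh f : adm f -> adm (fun x => h * f x) by move=> Af; apply: admM.
  have ecc f : cc f = fun x => cos (h * tau x) * f x by [].
  have ess f : ss f = fun x => sin (h * tau x) * f x by [].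
  have ett f : tt f = fun x => tau x * f x by [].
  clearbody p q rh cc ss tt.
  have [[Apa Aqa] [Ara Aca] Ata] := And3 (conj (Ap _ Aa) (Aq _ Aa)) (conj (Ar _ Aa) (Ac _ Aa)) (At _ Aa).
  have [[Apb Aqb] [Arb Acb] Atb] := And3 (conj (Ap _ Ab) (Aq _ Ab)) (conj (Ar _ Ab) (Ac _ Ab)) (At _ Ab).
  have Scc : S (cc a) (cc b) = S a b + h ^+ 2 * S a (p b) + h ^+ 2 * S (p a) (cc b).
    rewrite {1}(eqc a) SDl ?SZl; try by [|apply: admh2].
    by rewrite {1}(eqc b) SDr ?SZr; try by [|apply: admh2].
  have Sss : S (ss a) (ss b) = h ^+ 2 * S (rh a) (rh b).
    by rewrite !eqr SZl ?SZr; try by [rewrite mulrA expr2|apply: admh].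
  have Bsc : B (ss a) (cc b) =
      h * (B (tt a) b + h ^+ 2 * B (tt a) (p b)) + h ^+ 2 * B (q a) (cc b).
    rewrite (eqs a) BDl ?BZl; try by [|apply: admh|apply: admh2].
    by rewrite {1}(eqc b) BDr ?BZr; try by [|apply: admh2].
  have Bcs : B (cc a) (ss b) =
      h * (B a (tt b) + h ^+ 2 * B (p a) (tt b)) + h ^+ 2 * B (cc a) (q b).
    rewrite (eqs b) BDr ?BZr; try by [|apply: admh|apply: admh2].
    by rewrite {1}(eqc a) BDl ?BZl; try by [|apply: admh2].
  have e : S (cc a) (cc b) + B (ss a) (cc b) - B (cc a) (ss b) + S (ss a) (ss b) = S a b.
    by rewrite !ecc !ess; exact: rot.
  rewrite Scc Sss Bsc Bcs in e.
  have -> : B (fun x => tau x * a x) b - B a (fun x => tau x * b x) =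
      h * (B (cc a) (q b) - B (q a) (cc b) + h * B (p a) (tt b) - h * B (tt a) (p b)
       - S a (p b) - S (p a) (cc b) - S (rh a) (rh b)).
    by apply: (mulfI hn0); rewrite -(ett a) -(ett b); lra.
  rewrite normrM gtr0_norm// ler_wpM2l ?(ltW h0)//.
  have t1 := B_le (Ac _ Aa) (Aq _ Ab) L0 ca qb.
  have t2 := B_le (Aq _ Aa) (Ac _ Ab) L0 qa cb.
  have t3 := B_le (Ap _ Aa) (At _ Ab) L0 pa tb.
  have t4 := B_le (At _ Aa) (Ap _ Ab) L0 ta pb.
  have t5 := S_le Aa (Ap _ Ab) L0 a1 pb.
  have t6 := S_le (Ap _ Aa) (Ac _ Ab) L0 pa cb.
  have t7 := S_le (Ar _ Aa) (Ar _ Ab) L0 ra rb.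
  have t3' : `|h * B (p a) (tt b)| <= K * L ^+ 2.
    by rewrite normrM gtr0_norm// -[leRHS]mul1r ler_pM// ltW.
  have t4' : `|h * B (tt a) (p b)| <= K * L ^+ 2.
    by rewrite normrM gtr0_norm// -[leRHS]mul1r ler_pM// ltW.
  move: t1 t2 t3' t4' t5 t6 t7; rewrite !ler_norml.
  move=> /andP[? ?] /andP[? ?] /andP[? ?] /andP[? ?] /andP[? ?] /andP[? ?] /andP[? ?].
  by apply/andP; split; lra.
apply/eqP; rewrite -subr_eq0 -normr_le0 leNgt; apply/negP => pos.
set D := `|_| in pos key; set W := 7 * _ in key.
have W0 : 0 <= W by rewrite /W; have := mulr_ge0 K0 (sqr_ge0 L); lra.
(* Small enough that h W stays below D / 2, contradicting D <= h W. *)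
pose h := Num.min 1 (D / (2 * (W + 1))).
have W1 : 0 < 2 * (W + 1) by lra.
have h0 : 0 < h by rewrite lt_min ltr01 divr_gt0.
have := key h h0; rewrite ge_min lexx => /(_ isT) le1.
have : h * (2 * (W + 1)) <= D by rewrite -ler_pdivlMr// ge_min lexx orbT.
have := pos; nra.
Qed.

End RotationShift.

Section ExponentialEstimates.
Variable R : realType.

Lemma expR_sub1_abs (x : R) : `|expR x - 1| <= `|x| * expR `|x|.
Proof.
have e1 := expR_ge1Dx x; have e2 := expR_ge1Dx (- x).
have ex : expR x * expR (- x) = 1 by rewrite -expRD subrr expR0.
have p1 := expR_gt0 x; have p2 := expR_gt0 (- x).
have [x0|x0] := leP 0 x.
  rewrite ger0_norm ?subr_ge0 -?expR0 ?ler_expR// expR0 ger0_norm//; nra.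
rewrite ltr0_norm ?subr_lt0 -?[X in _ < X]expR0 ?ltr_expR// ltr0_norm//.
have : 1 <= expR (- x) by rewrite -[leLHS]expR0 ler_expR; lra.
nra.
Qed.

Lemma expR_taylor1_abs (x : R) : `|expR x - 1 - x| <= x ^+ 2 * expR `|x|.
Proof.
have e1 := expR_ge1Dx x; have e2 := expR_ge1Dx (- x).
have ex : expR x * expR (- x) = 1 by rewrite -expRD subrr expR0.
have p1 := expR_gt0 x; have p2 := expR_gt0 (- x).
rewrite ger0_norm; last by lra.
have up : expR x - 1 <= x * expR x by nra.
have [x0|x0] := leP 0 x.
  by rewrite ger0_norm//; nra.
rewrite ltr0_norm//.
have h1 : 1 <= expR (- x) by rewrite -[leLHS]expR0 ler_expR; lra.
have h2 : expR x - 1 - x <= x ^+ 2 by rewrite expr2; nra.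
have h3 : 0 <= x ^+ 2 by exact: sqr_ge0.
nra.
Qed.

(** The difference quotient differs from [a] by at most W |h|. In this form differentiability of D
    (tau^k e_t, e_t) needs bounds on the form only, and no differentiation under an integral. *)
Lemma is_derive_quadratic (f : R -> R) (t a W : R) :
  (forall h, `|h| <= 1 -> `|f (t + h) - f t - h * a| <= W * h ^+ 2) ->
  is_derive t (1 : R) f a.
Proof.
move=> hW.
have W0 : 0 <= W by have := hW 1; rewrite normr1 expr1n mulr1 => /(_ (lexx _)); exact: le_trans.
have cv : h^-1 *: (f (h *: (1 : R) + t) - f t) @[h --> 0^'] --> a.
  apply/cvgrPdist_le => /= e e0; near=> h.
  have h0 : h != 0 by near: h; exact: nbhs_dnbhs_neq.
  have h1 : `|h| <= 1.
    near: h; apply: dnbhs0_le; exact: ltr01.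
  have h2 : `|h| <= e / (W + 1).
    near: h; apply: dnbhs0_le; rewrite divr_gt0//; lra.
  rewrite /GRing.scale /= mulr1 [h + t]addrC distrC.
  rewrite (_ : _ - a = h^-1 * (f (t + h) - f t - h * a)); last by field.
  have hp : 0 < `|h| by rewrite normr_gt0.
  rewrite normrM normfV ler_pdivrMl//.
  apply: (le_trans (hW h h1)); rewrite -real_normK ?num_real//.
  have : `|h| * (W + 1) <= e by rewrite -ler_pdivlMr//; lra.
  nra.
apply: DeriveDef; first by apply/cvg_ex; exists a.
exact: cvg_lim.
Unshelve. all: by end_near. Qed.

(** A positive slope at t could only increase afterwards, so f would grow at least linearly and pass
    the bound [B]. *)
Lemma convex_bounded_derivative_le0 (f f1 f2 : R -> R) (B : R) :
  (forall t, is_derive t (1 : R) f (f1 t)) -> (forall t, is_derive t (1 : R) f1 (f2 t)) ->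
  (forall t, 0 <= f2 t) -> (forall t, 0 <= t -> f t <= B) ->
  forall t, 0 <= t -> f1 t <= 0.
Proof.
move=> df df1 f20 fB t t0; rewrite leNgt; apply/negP => f1t.
have cont (g g' : R -> R) : (forall t, is_derive t (1 : R) g (g' t)) -> continuous g.
  by move=> dg x; apply/differentiable_continuous/derivable1_diffP; case: (dg x).
have mono u : t <= u -> f1 t <= f1 u.
  rewrite le_eqVlt => /predU1P[->//|tu].
  have [c _ e] := MVT tu (fun x _ => df1 x) (continuous_subspaceT (cont _ _ df1)).
  by rewrite -subr_ge0 e mulr_ge0 ?f20// subr_ge0 ltW.
(* At slope f1 t this is the time needed to rise by |B - f t| + 1, which already exceeds [B]. *)
pose u := t + (`|B - f t| + 1) / f1 t.
have tu : t < u by rewrite ltrDl divr_gt0// ltr_wpDl.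
have [c ctu e] := MVT tu (fun x _ => df x) (continuous_subspaceT (cont _ _ df)).
have f1c : f1 t <= f1 c by apply: mono; move: ctu; rewrite in_itv/= => /andP[/ltW].
have : f1 t * (u - t) <= f u - f t by rewrite e ler_wpM2r// subr_ge0 ltW.
rewrite /u addrAC subrr add0r mulrC divfK ?gt_eqF// -/u.
have := fB u (le_trans t0 (ltW tu)); have := ler_norm (B - f t); lra.
Qed.

End ExponentialEstimates.

(** * Complete monotonicity from positivity and the shift property *)

Section MultiplierForms.
Context (X : Type) (R : realType).
Variables (tau : X -> R) (M : R) (adm : (X -> R) -> Prop).
Variable D : (X -> R) -> (X -> R) -> R.
Variable K : R.
Hypothesis tau0 : forall x, 0 <= tau x.
Hypothesis tauM : forall x, tau x <= M.
Hypothesis M0 : 0 <= M.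
Hypothesis admD : forall a b, adm a -> adm b -> adm (fun x => a x + b x).
Hypothesis admM : forall a b, adm a -> adm b -> adm (fun x => a x * b x).
Hypothesis adm_cst : forall c, adm (fun=> c).
Hypothesis adm_tau : adm tau.
Hypothesis adm_exp : forall t, adm (fun x => expR (- (t * tau x))).
Hypothesis DC : forall a b, adm a -> adm b -> D a b = D b a.
Hypothesis DD : forall a a' b, adm a -> adm a' -> adm b ->
  D (fun x => a x + a' x) b = D a b + D a' b.
Hypothesis DZ : forall c a b, adm a -> adm b -> D (fun x => c * a x) b = c * D a b.
Hypothesis D_ge0 : forall a, adm a -> 0 <= D a a.
Hypothesis D_le : forall a c, adm a -> 0 <= c -> (forall x, `|a x| <= c) -> D a a <= K * c ^+ 2.
Hypothesis D_shift : forall a b, adm a -> adm b ->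
  D (fun x => tau x * a x) b = D a (fun x => tau x * b x).

Let e t x := expR (- (t * tau x)).
Let E k t x := tau x ^+ k * e t x.
Let G k t := D (E k t) (e t).

Let adm_pow k : adm (fun x => tau x ^+ k).
Proof.
elim: k => [|k IHk]; first exact: adm_cst.
by under eq_fun do rewrite exprS; exact: admM.
Qed.

Let adm_e t : adm (e t). Proof. exact: adm_exp. Qed.

Let adm_E k t : adm (E k t). Proof. exact: admM. Qed.

Let D_addr a b b' : adm a -> adm b -> adm b' ->
  D a (fun x => b x + b' x) = D a b + D a b'.
Proof. by move=> Aa Ab Ab'; rewrite DC ?DD ?(DC Aa)//; exact: admD. Qed.

Let D_scaler c a b : adm a -> adm b -> D a (fun x => c * b x) = c * D a b.
Proof. by move=> Aa Ab; rewrite DC ?DZ ?(DC Aa)//; exact: admM. Qed.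

(** Positivity on a + b and on a - b gives 2 |D a b| <= D a a + D b b, so diagonal bounds control
    the off-diagonal values. *)
Let D_norm_le a b ca cb : adm a -> adm b -> 0 <= ca -> 0 <= cb ->
  (forall x, `|a x| <= ca) -> (forall x, `|b x| <= cb) ->
  `|D a b| <= K * (ca ^+ 2 + cb ^+ 2).
Proof.
move=> Aa Ab ca0 cb0 aca bcb.
have Am : adm (fun x => -1 * b x) by exact: admM.
have := D_ge0 (admD Aa Ab); have := D_ge0 (admD Aa Am).
rewrite !DD ?D_addr ?DZ ?D_scaler//; try exact: admD.
rewrite (DC Ab Aa).
have := D_le Aa ca0 aca; have := D_le Ab cb0 bcb.
have := D_ge0 Aa; have := D_ge0 Ab.
by rewrite ler_norml => *; apply/andP; split; lra.
Qed.

(** For j = k this exhibits [G (j + j)] as a diagonal value of [D], hence nonnegative. *)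
Let D_shift_pow j k t : D (E (j + k) t) (e t) = D (E j t) (E k t).
Proof.
elim: k j => [|k IHk] j.
  by rewrite addn0; congr (D _ _); apply/funext => x; rewrite /E mul1r.
rewrite addnS -addSn IHk.
rewrite (_ : E j.+1 t = fun x => tau x * E j t x); last first.
  by apply/funext => x; rewrite /E exprS mulrA.
rewrite D_shift//; congr (D _ _); apply/funext => x.
by rewrite /E exprS mulrA.
Qed.

Let e_le t x : e t x <= expR (`|t| * M).
Proof.
rewrite ler_expR -mulNr (le_trans (ler_norm _))// normrM normrN.
by rewrite ler_wpM2l// ger0_norm.
Qed.

Let e_pos t x : 0 <= e t x. Proof. exact: expR_ge0. Qed.

(* With [rho = (e_{t+h} - e_t) / h] and [r] the second-order remainder, the shift property
   collapses the first-order terms of [D (tau^k e_{t+h}) e_{t+h}] to [- 2 h G (k+1)]. *)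
Let is_derive_G k t : is_derive t (1 : R) (G k) (- 2 * G k.+1 t).
Proof.
pose B := expR (`|t| * M) * expR M.
pose c1 := M * B; pose c2 := M ^+ 2 * B.
have B0 : 0 <= B by rewrite mulr_ge0// expR_ge0.
(* Bounds the coefficient of h^2 in [expand]: [c1] dominates [rho], [c2] dominates [r], and
   [D_norm_le] is applied to each of the two values of [D]. *)
pose W := 2 * (K * ((M ^+ k * B) ^+ 2 + c2 ^+ 2)) + K * ((M ^+ k * c1) ^+ 2 + c1 ^+ 2).
have powM x j : tau x ^+ j <= M ^+ j by rewrite lerXn2r// nnegrE.
have pow0 x j : 0 <= tau x ^+ j by rewrite exprn_ge0.
have M1 : 1 <= expR M by rewrite -[leLHS]expR0 ler_expR.
have eB x : e t x <= B.
  by rewrite (le_trans (e_le t x))// ler_peMr// expR_ge0.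
apply: (@is_derive_quadratic _ _ _ _ W) => h h1.
have [->|h0] := eqVneq h 0.
  by rewrite addr0 subrr mul0r subr0 expr0n mulr0 normr0.
pose rho x := h^-1 * (e (t + h) x - e t x).
pose r x := h^-1 * h^-1 * (e (t + h) x - e t x + h * (tau x * e t x)).
have eD x : e (t + h) x = e t x * expR (- (h * tau x)).
  by rewrite /e -expRD; congr expR; ring.
have hM x : `|h * tau x| <= M.
  rewrite normrM (ger0_norm (tau0 x)).
  by rewrite -[leRHS]mul1r ler_pM.
have expM x : expR `|- (h * tau x)| <= expR M by rewrite ler_expR normrN.
have hn0 : 0 < `|h| by rewrite normr_gt0.
have rho_le x : `|rho x| <= c1.
  rewrite /rho normrM normfV ler_pdivrMl// eD.
  rewrite (_ : _ - _ = e t x * (expR (- (h * tau x)) - 1)); last by ring.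
  rewrite normrM (ger0_norm (e_pos t x)).
  apply: (@le_trans _ _ (expR (`|t| * M) * ((`|h| * M) * expR M))).
    apply: ler_pM => //; apply: (le_trans (expR_sub1_abs _)); apply: ler_pM => //.
    by rewrite normrN normrM (ger0_norm (tau0 x)) ler_wpM2l.
  by rewrite /c1 /B le_eqVlt; apply/orP; left; apply/eqP; ring.
have r_le x : `|r x| <= c2.
  rewrite /r normrM -invfM normfV -[h * h]expr2 normrX ler_pdivrMl ?exprn_gt0// eD.
  rewrite (_ : _ + _ = e t x * (expR (- (h * tau x)) - 1 - (- (h * tau x)))); last by ring.
  rewrite normrM (ger0_norm (e_pos t x)).
  apply: (@le_trans _ _ (expR (`|t| * M) * ((`|h| ^+ 2 * M ^+ 2) * expR M))).
    apply: ler_pM => //; apply: (le_trans (expR_taylor1_abs _)).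
    apply: ler_pM => //; first exact: sqr_ge0.
    rewrite sqrrN exprMn real_normK ?num_real// ler_wpM2l ?sqr_ge0//.
  by rewrite /c2 /B le_eqVlt; apply/orP; left; apply/eqP; ring.
have Arho : adm rho.
  apply: admM; first exact: adm_cst.
  have -> : (fun x => e (t + h) x - e t x) = (fun x => e (t + h) x + (-1) * e t x).
    by apply/funext => x; rewrite mulN1r.
  by apply: admD => //; apply: admM.
have Ar : adm r.
  apply: admM; first exact: adm_cst.
  apply: admD; last by apply: admM => //; apply: admM.
  have -> : (fun x => e (t + h) x - e t x) = (fun x => e (t + h) x + (-1) * e t x).
    by apply/funext => x; rewrite mulN1r.
  by apply: admD => //; apply: admM.
have Akrho : adm (fun x => tau x ^+ k * rho x) by exact: admM.
have Ate : adm (fun x => tau x * e t x) by exact: admM.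
have e1 : e (t + h) = fun x => e t x + h * rho x.
  by apply/funext => x; rewrite /rho; field.
have E1 : E k (t + h) = fun x => E k t x + h * (tau x ^+ k * rho x).
  by apply/funext => x; rewrite /E e1; ring.
have rho1 : rho = fun x => (-1) * (tau x * e t x) + h * r x.
  by apply/funext => x; rewrite /rho /r; field.
clearbody r rho.
(* The powers of [tau] cross one at a time, so the induction must run over an arbitrary multiplier
   in place of [rho]. *)
have sym : D (fun x => tau x ^+ k * rho x) (e t) = D (E k t) rho.
  rewrite (DC (adm_E k t) Arho) /E.
  elim: (k) rho Arho {Akrho rho_le e1 E1 rho1} => [|j IHj] u Au.
    rewrite (_ : (fun x => _ * u x) = u); last by apply/funext => x; rewrite mul1r.
    by congr (D _ _); apply/funext => x; rewrite mul1r.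
  rewrite (_ : (fun x => _ * u x) = (fun x => tau x ^+ j * (tau x * u x))); last first.
    by apply/funext => x; rewrite exprS; ring.
  rewrite IHj; last exact: admM.
  rewrite D_shift//; last exact: admM.
  by congr (D _ _); apply/funext => x; rewrite exprS; ring.
have expand : G k (t + h) - G k t - h * (- 2 * G k.+1 t) =
    h ^+ 2 * (2 * D (E k t) r + D (fun x => tau x ^+ k * rho x) rho).
  rewrite /G E1 e1 DD ?D_addr ?DZ ?D_scaler//; try exact: admM; try exact: admD.
    rewrite sym.
    have -> : D (E k t) rho = - G k.+1 t + h * D (E k t) r.
      rewrite {1}rho1 D_addr//; try exact: admM.
      rewrite !D_scaler// mulN1r; congr (- _ + _).
      rewrite /G -D_shift//; congr (D _ _); apply/funext => x.
      by rewrite /E exprS mulrA.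
    rewrite /G; ring.
  by apply: admD => //; exact: admM.
rewrite expand normrM normrX real_normK ?num_real// mulrC ler_wpM2r ?sqr_ge0//.
apply: (le_trans (ler_normD _ _)); apply: lerD.
  rewrite normrM ger0_norm// ler_wpM2l//; apply: D_norm_le => //.
  - by rewrite mulr_ge0// exprn_ge0.
  - by rewrite mulr_ge0// exprn_ge0.
  - by move=> x; rewrite normrM !ger0_norm ?ler_pM.
apply: D_norm_le => //.
- by rewrite !mulr_ge0// exprn_ge0.
- by rewrite mulr_ge0.
- by move=> x; rewrite normrM (ger0_norm (pow0 x k)) ler_pM.
Qed.

Let G_even_ge0 j t : 0 <= G (j + j) t.
Proof. by rewrite /G D_shift_pow D_ge0. Qed.

Let G_odd_ge0 j t : 0 <= t -> 0 <= G (j + j).+1 t.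
Proof.
move=> t0; suff : - 2 * G (j + j).+1 t <= 0 by lra.
apply: (@convex_bounded_derivative_le0 _ (G (j + j)) (fun t => - 2 * G (j + j).+1 t)
  (fun t => 4 * G (j.+1 + j.+1) t) (K * (M ^+ j) ^+ 2)) => // u.
- have := is_derive_G (j + j).+1 u => du; apply: is_derive_eq.
  by rewrite /GRing.scale /= addSn addnS; ring.
- by rewrite mulr_ge0.
(* Boundedness holds on the half-line only: for u >= 0 the exponential is at most 1, so |tau^j e_u|
   <= M^j. *)
- move=> u0; rewrite /G D_shift_pow; apply: D_le => //; first exact: exprn_ge0.
  move=> x; rewrite normrM !ger0_norm ?exprn_ge0// -[leRHS]mulr1.
  apply: ler_pM; rewrite ?exprn_ge0//; first by rewrite lerXn2r// nnegrE.
  by rewrite /e -expR0 ler_expR oppr_le0 mulr_ge0.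
Qed.

Let G_ge0 k t : 0 <= t -> 0 <= G k t.
Proof.
move=> t0; rewrite -(odd_double_half k) -addnn; case: (odd k) => /=.
  by rewrite add1n G_odd_ge0.
by rewrite add0n G_even_ge0.
Qed.

Lemma completely_monotone_form :
  completely_monotone (fun t => D (fun x => expR (- (t * tau x))) (fun x => expR (- (t * tau x)))).
Proof.
set Q := fun t => _.
have dQ k : derive1n k Q = fun t => (- 2) ^+ k * G k t.
  elim: k => [|k IHk].
    apply/funext => t; rewrite derive1n0 mul1r /Q /G; congr (D _ _).
    by apply/funext => x; rewrite /E mul1r.
  rewrite derive1nS IHk; apply/funext => t; rewrite derive1E.
  have dG := is_derive_G k t.
  have : is_derive t (1 : R) (fun t => (- 2) ^+ k * G k t) ((- 2) ^+ k.+1 * G k.+1 t).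
    by apply: is_derive_eq; rewrite /GRing.scale /= exprS; ring.
  by case.
split => [k t t0|k t k0 t0].
  rewrite dQ; have dG := is_derive_G k t.
  have : is_derive t (1 : R) (fun t => (- 2) ^+ k * G k t) ((- 2) ^+ k.+1 * G k.+1 t).
    by apply: is_derive_eq; rewrite /GRing.scale /= exprS; ring.
  by case.
by rewrite dQ mulrA -exprMn mulN1r opprK mulr_ge0 ?exprn_ge0 ?G_ge0 ?(ltW t0).
Qed.

End MultiplierForms.

Section ShiftInvariance.
Variable R : realType.
Notation leb := (@lebesgue_measure R).

Lemma Rintegral_shift3 (h : R) (H : R * R * R -> R) : measurable_fun setT H ->
  \int[@leb3 R]_z H (z.1, z.2 + h) = \int[@leb3 R]_z H z.
Proof.
move=> mH.
have ge0 (f : R * R * R -> \bar R) : measurable_fun setT f -> (forall z, 0 <= f z)%E ->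
    (\int[@leb3 R]_z f (z.1, (z.2 + h)%R) = \int[@leb3 R]_z f z)%E.
  move=> mf f0; have mfh : measurable_fun setT (fun z : R * R * R => f (z.1, (z.2 + h)%R)).
    apply: (measurableT_comp mf); apply: measurable_fun_pair => //=.
    by apply: measurable_funD.
  rewrite (fubini_tonelli1 (m1 := @leb2 R) (m2 := leb) _ mfh)//.
  apply: etrans (esym (fubini_tonelli1 (m1 := @leb2 R) (m2 := leb) f mf f0)).
  apply: eq_integral => x _; rewrite /fubini_F /=.
  apply: (ge0_integral_shift h (f := fun s => f (x, s))) => //.
  exact: measurableT_comp.
have mEH : measurable_fun setT (EFin \o H) by exact/measurable_EFinP.
rewrite /Rintegral; congr fine; rewrite integralE [RHS]integralE.
rewrite -(ge0 (EFin \o H)^\+%E)//; last exact: measurable_funepos.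
rewrite -[X in _ = (_ - X)%E](ge0 (EFin \o H)^\-%E)//; last exact: measurable_funeneg.
by congr (_ - _)%E; apply: eq_integral => z _; rewrite unlock.
Qed.

End ShiftInvariance.

(** * The form D attached to the transform *)

Section ExtensionForm.
Context d (X : measurableType d) (R : realType).
Variable mu : {sigma_finite_measure set X -> \bar R}.
Variables (psi1 psi2 tau fr fi : X -> R) (E : set X) (C M : R).
Hypothesis mpsi1 : measurable_fun setT psi1.
Hypothesis mpsi2 : measurable_fun setT psi2.
Hypothesis mtau : measurable_fun setT tau.
Hypothesis mE : measurable E.
Hypothesis C0 : 0 <= C.
Hypothesis schur : forall N a b c : R, 0 < N ->
  (\int[mu]_q (kmaj N (c - tau q) * (kmaj N (a - psi1 q) * kmaj N (b - psi2 q)) *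
    (\1_E q)%:E) <= C%:E)%E.
Hypothesis ifr : mu.-integrable setT (EFin \o fr).
Hypothesis ifi : mu.-integrable setT (EFin \o fi).
Hypothesis ifr2 : mu.-integrable setT (EFin \o (fun x => fr x ^+ 2)).
Hypothesis ifi2 : mu.-integrable setT (EFin \o (fun x => fi x ^+ 2)).
Hypothesis frE : forall x, ~ E x -> fr x = 0.
Hypothesis fiE : forall x, ~ E x -> fi x = 0.
Hypothesis tau0 : forall x, 0 <= tau x.
Hypothesis tauM : forall x, tau x <= M.
Hypothesis M0 : 0 <= M.

Notation th := (ph psi1 psi2 tau).
Notation leb3 := (@leb3 R).

(** The admissible class of the abstract argument: an algebra containing the constants, [tau], its
    sines and cosines, and the exponentials, on which the form is bounded by the square of the sup
    norm. *)
Definition multiplier (a : X -> R) :=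
  measurable_fun setT a /\ exists2 L, 0 <= L & forall x, `|a x| <= L.

Lemma multiplierD a b : multiplier a -> multiplier b -> multiplier (fun x => a x + b x).
Proof.
move=> [ma [L L0 aL]] [mb [L' L'0 bL]]; split; first exact: measurable_funD.
by exists (L + L'); [exact: addr_ge0|move=> x; rewrite (le_trans (ler_normD _ _))// lerD].
Qed.

Lemma multiplierM a b : multiplier a -> multiplier b -> multiplier (fun x => a x * b x).
Proof.
move=> [ma [L L0 aL]] [mb [L' L'0 bL]]; split; first exact: measurable_funM.
by exists (L * L'); [exact: mulr_ge0|move=> x; rewrite normrM ler_pM].
Qed.

Lemma multiplier_cst c : multiplier (fun=> c).
Proof. by split; [exact: measurable_cst|exists `|c|]. Qed.

Lemma multiplier_tau : multiplier tau.
Proof. by split => //; exists M => // x; rewrite ger0_norm. Qed.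

Let mhtau h : measurable_fun setT (fun x => h * tau x).
Proof. exact: measurable_funM. Qed.

Lemma multiplier_cos f : measurable_fun setT f -> multiplier (fun x => cos (f x)).
Proof.
move=> mf; split; first exact: measurable_cos_comp.
by exists 1 => // x; rewrite ler_norml cos_geN1 cos_le1.
Qed.

Lemma multiplier_sin f : measurable_fun setT f -> multiplier (fun x => sin (f x)).
Proof.
move=> mf; split; first exact: measurable_sin_comp.
by exists 1 => // x; rewrite ler_norml sin_geN1 sin_le1.
Qed.

Let multiplier_cos_tau h : multiplier (fun x => cos (h * tau x)).
Proof. exact: multiplier_cos (mhtau h). Qed.

Let multiplier_sin_tau h : multiplier (fun x => sin (h * tau x)).
Proof. exact: multiplier_sin (mhtau h). Qed.

Lemma multiplier_exp t : multiplier (fun x => expR (- (t * tau x))).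
Proof.
split; first by apply: measurableT_comp => //; apply: measurableT_comp => //; exact: mhtau.
exists (expR (`|t| * M)); first exact: expR_ge0.
move=> x; rewrite ger0_norm ?expR_ge0// ler_expR -mulNr (le_trans (ler_norm _))//.
by rewrite normrM normrN ler_wpM2l// ger0_norm.
Qed.

Lemma integrable_mult a g : multiplier a -> mu.-integrable setT (EFin \o g) ->
  mu.-integrable setT (EFin \o (fun x => a x * g x)).
Proof.
move=> [ma [L L0 aL]] ig; have := integrableZR L (integrable_norm ig).
apply: le_integrableR; first by apply: measurable_funM => //; exact: integrable_mfun ig.
by move=> x; rewrite normrM ler_wpM2r.
Qed.

Let mphz z : measurable_fun setT (fun x => th (z, x)).
Proof. by apply: measurableT_comp => //; exact: measurable_ph. Qed.

Let integrable_cos z g : mu.-integrable setT (EFin \o g) ->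
  mu.-integrable setT (EFin \o (fun x => g x * cos (th (z, x)))).
Proof.
move=> ig; apply: (le_integrableR _ _ (integrable_norm ig)).
  by apply: measurable_funM; [exact: integrable_mfun ig|exact: measurable_cos_comp].
by move=> x /=; rewrite normrM ler_piMr// ler_norml cos_geN1 cos_le1.
Qed.

Let integrable_sin z g : mu.-integrable setT (EFin \o g) ->
  mu.-integrable setT (EFin \o (fun x => g x * sin (th (z, x)))).
Proof.
move=> ig; apply: (le_integrableR _ _ (integrable_norm ig)).
  by apply: measurable_funM; [exact: integrable_mfun ig|exact: measurable_sin_comp].
by move=> x /=; rewrite normrM ler_piMr// ler_norml sin_geN1 sin_le1.
Qed.

Let ctr := cos_tr mu th.
Let str := sin_tr mu th.

Let ctrD g k z : mu.-integrable setT (EFin \o g) -> mu.-integrable setT (EFin \o k) ->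
  ctr (fun x => g x + k x) z = ctr g z + ctr k z.
Proof.
move=> ig ik; rewrite /ctr /cos_tr -RintegralD//; try exact: integrable_cos.
by apply: eq_Rintegral => x _; rewrite mulrDl.
Qed.

Let strD g k z : mu.-integrable setT (EFin \o g) -> mu.-integrable setT (EFin \o k) ->
  str (fun x => g x + k x) z = str g z + str k z.
Proof.
move=> ig ik; rewrite /str /sin_tr -RintegralD//; try exact: integrable_sin.
by apply: eq_Rintegral => x _; rewrite mulrDl.
Qed.

Let ctrZ c g z : mu.-integrable setT (EFin \o g) -> ctr (fun x => c * g x) z = c * ctr g z.
Proof.
move=> ig; rewrite /ctr /cos_tr -RintegralZl//; last exact: integrable_cos.
by apply: eq_Rintegral => x _; rewrite mulrA.
Qed.

Let strZ c g z : mu.-integrable setT (EFin \o g) -> str (fun x => c * g x) z = c * str g z.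
Proof.
move=> ig; rewrite /str /sin_tr -RintegralZl//; last exact: integrable_sin.
by apply: eq_Rintegral => x _; rewrite mulrA.
Qed.

(** Raising s by h adds h tau to the phase; the addition formula then moves the rotation onto the
    function. *)
Let ctr_shift g z h : mu.-integrable setT (EFin \o g) ->
  ctr g (z.1, z.2 + h) = ctr (fun x => cos (h * tau x) * g x) z -
    str (fun x => sin (h * tau x) * g x) z.
Proof.
move=> ig; rewrite /ctr /str /cos_tr /sin_tr -RintegralB//.
- apply: eq_Rintegral => x _; rewrite (_ : th _ = h * tau x + th (z, x)).
    by rewrite cosD; ring.
  by rewrite /ph /=; ring.
- by apply: integrable_cos; apply: integrable_mult => //; exact: multiplier_cos_tau.
- by apply: integrable_sin; apply: integrable_mult => //; exact: multiplier_sin_tau.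
Qed.

Let str_shift g z h : mu.-integrable setT (EFin \o g) ->
  str g (z.1, z.2 + h) = str (fun x => cos (h * tau x) * g x) z +
    ctr (fun x => sin (h * tau x) * g x) z.
Proof.
move=> ig; rewrite /ctr /str /cos_tr /sin_tr -RintegralD//.
- apply: eq_Rintegral => x _; rewrite (_ : th _ = h * tau x + th (z, x)).
    by rewrite sinD; ring.
  by rewrite /ph /=; ring.
- by apply: integrable_sin; apply: integrable_mult => //; exact: multiplier_cos_tau.
- by apply: integrable_cos; apply: integrable_mult => //; exact: multiplier_sin_tau.
Qed.

(* The transform of [a * f], [f = fr + i fi], split into real and imaginary parts. *)
Definition Fre a z := ctr (fun x => a x * fr x) z - str (fun x => a x * fi x) z.
Definition Fim a z := str (fun x => a x * fr x) z + ctr (fun x => a x * fi x) z.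

Let mFre a : multiplier a -> measurable_fun setT (Fre a).
Proof.
move=> Aa; apply: measurable_funB; [apply: measurable_cos_tr|apply: measurable_sin_tr] => //;
by apply: integrable_mfun; exact: integrable_mult.
Qed.

Let mFim a : multiplier a -> measurable_fun setT (Fim a).
Proof.
move=> Aa; apply: measurable_funD; [apply: measurable_sin_tr|apply: measurable_cos_tr] => //;
by apply: integrable_mfun; exact: integrable_mult.
Qed.

Let FreD a b z : multiplier a -> multiplier b -> Fre (fun x => a x + b x) z = Fre a z + Fre b z.
Proof.
move=> Aa Ab; rewrite /Fre; under eq_fun do rewrite mulrDl.
under [X in str X]eq_fun do rewrite mulrDl.
by rewrite ctrD ?strD; [ring|exact: integrable_mult..].
Qed.

Let FimD a b z : multiplier a -> multiplier b -> Fim (fun x => a x + b x) z = Fim a z + Fim b z.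
Proof.
move=> Aa Ab; rewrite /Fim; under eq_fun do rewrite mulrDl.
under [X in ctr X]eq_fun do rewrite mulrDl.
by rewrite ctrD ?strD; [ring|exact: integrable_mult..].
Qed.

Let FreZ c a z : multiplier a -> Fre (fun x => c * a x) z = c * Fre a z.
Proof.
move=> Aa; rewrite /Fre; under eq_fun do rewrite -mulrA.
under [X in str X]eq_fun do rewrite -mulrA.
by rewrite ctrZ ?strZ; [ring|exact: integrable_mult..].
Qed.

Let FimZ c a z : multiplier a -> Fim (fun x => c * a x) z = c * Fim a z.
Proof.
move=> Aa; rewrite /Fim; under eq_fun do rewrite -mulrA.
under [X in ctr X]eq_fun do rewrite -mulrA.
by rewrite ctrZ ?strZ; [ring|exact: integrable_mult..].
Qed.

Let Fre_shift a z h : multiplier a -> Fre a (z.1, z.2 + h) =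
  Fre (fun x => cos (h * tau x) * a x) z - Fim (fun x => sin (h * tau x) * a x) z.
Proof.
move=> Aa; rewrite /Fre /Fim ctr_shift ?str_shift; try exact: integrable_mult.
have assoc (g : X -> R) k : (fun x => g x * a x * k x) = (fun x => g x * (a x * k x)).
  by apply/funext => x; rewrite mulrA.
by rewrite !assoc; ring.
Qed.

Let Fim_shift a z h : multiplier a -> Fim a (z.1, z.2 + h) =
  Fim (fun x => cos (h * tau x) * a x) z + Fre (fun x => sin (h * tau x) * a x) z.
Proof.
move=> Aa; rewrite /Fre /Fim ctr_shift ?str_shift; try exact: integrable_mult.
have assoc (g : X -> R) k : (fun x => g x * a x * k x) = (fun x => g x * (a x * k x)).
  by apply/funext => x; rewrite mulrA.
by rewrite !assoc; ring.
Qed.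

Let nf x := fr x ^+ 2 + fi x ^+ 2.

Let inf : mu.-integrable setT (EFin \o nf).
Proof. exact: integrableDR. Qed.

Let nf0 x : 0 <= nf x. Proof. by rewrite addr_ge0 ?sqr_ge0. Qed.

Let inf_mult a : multiplier a -> mu.-integrable setT (EFin \o (fun x => a x * nf x)).
Proof. by move=> Aa; exact: integrable_mult. Qed.

Let inf_mult2 a b : multiplier a -> multiplier b ->
  mu.-integrable setT (EFin \o (fun x => a x * b x * nf x)).
Proof. by move=> Aa Ab; apply: inf_mult; exact: multiplierM. Qed.

(** [extension_bound] concerns real functions. It is applied to a fr and a fi, and |u + i v|^2 <= 2
    (|u|^2 + |v|^2) recombines them, whence the factor 2. *)
Let F_bound a : multiplier a ->
  (\int[leb3]_z (Fre a z ^+ 2 + Fim a z ^+ 2)%:E <=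
   (2 * C * \int[mu]_x (a x * a x * nf x))%:E)%E.
Proof.
move=> Aa; have i1 := integrable_mult Aa ifr; have i2 := integrable_mult Aa ifi.
have E1 x : ~ E x -> a x * fr x = 0 by move=> /frE ->; rewrite mulr0.
have E2 x : ~ E x -> a x * fi x = 0 by move=> /fiE ->; rewrite mulr0.
have b1 := extension_bound mpsi1 mpsi2 mtau mE C0 schur i1 E1.
have b2 := extension_bound mpsi1 mpsi2 mtau mE C0 schur i2 E2.
pose G1 z := ctr (fun x => a x * fr x) z ^+ 2 + str (fun x => a x * fr x) z ^+ 2.
pose G2 z := ctr (fun x => a x * fi x) z ^+ 2 + str (fun x => a x * fi x) z ^+ 2.
have mG1 : measurable_fun setT G1.
  by apply: measurable_funD; apply: measurable_funX;
    [apply: measurable_cos_tr|apply: measurable_sin_tr] => //; exact: integrable_mfun i1.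
have mG2 : measurable_fun setT G2.
  by apply: measurable_funD; apply: measurable_funX;
    [apply: measurable_cos_tr|apply: measurable_sin_tr] => //; exact: integrable_mfun i2.
have G10 z : 0 <= G1 z by rewrite addr_ge0 ?sqr_ge0.
have G20 z : 0 <= G2 z by rewrite addr_ge0 ?sqr_ge0.
apply: (@le_trans _ _ (\int[leb3]_z (2%:E * ((G1 z)%:E + (G2 z)%:E)))%E).
  apply: ge0_le_integral => //.
  - by move=> z _; rewrite lee_fin addr_ge0 ?sqr_ge0.
  - by apply/measurable_EFinP; apply: measurable_funD; apply: measurable_funX;
      [exact: mFre|exact: mFim].
  - by apply: measurable_funeM; apply: emeasurable_funD; exact/measurable_EFinP.
  move=> z _; rewrite -EFinD -EFinM lee_fin /G1 /G2 /Fre /Fim.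
  set c1 := ctr _ z; set s1 := str _ z; set c2 := ctr _ z; set s2 := str _ z.
  by have := sqr_ge0 (c1 + s1); have := sqr_ge0 (s2 - c2); rewrite !expr2; lra.
rewrite ge0_integralZl//; last 2 first.
- by apply: emeasurable_funD; exact/measurable_EFinP.
- by move=> z _; rewrite adde_ge0 ?lee_fin.
rewrite ge0_integralD//; try exact/measurable_EFinP; try by move=> z _; rewrite lee_fin.
apply: (@le_trans _ _ (2%:E * (C%:E * \int[mu]_x ((a x * fr x) ^+ 2)%:E +
    C%:E * \int[mu]_x ((a x * fi x) ^+ 2)%:E))%E).
  by rewrite lee_wpmul2l// ?lee_fin// leeD.
rewrite -ge0_muleDr; try by apply: integral_ge0 => x _; rewrite lee_fin sqr_ge0.
rewrite -ge0_integralD//; last 4 first.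
- by move=> x _; rewrite lee_fin sqr_ge0.
- by apply/measurable_EFinP; apply: measurable_funX; exact: integrable_mfun i1.
- by move=> x _; rewrite lee_fin sqr_ge0.
- by apply/measurable_EFinP; apply: measurable_funX; exact: integrable_mfun i2.
rewrite -mulrA 2!EFinM RintegralK; last exact: inf_mult2.
rewrite le_eqVlt; apply/orP; left; apply/eqP; congr (_ * (_ * _))%E.
by apply: eq_integral => x _; rewrite -EFinD; congr EFin; rewrite /nf; ring.
Qed.

Lemma integrable_F2 a : multiplier a ->
  leb3.-integrable setT (EFin \o (fun z => Fre a z ^+ 2 + Fim a z ^+ 2)).
Proof.
move=> Aa; apply: ge0_integrableR.
- by apply: measurable_funD; apply: measurable_funX; [exact: mFre|exact: mFim].
- by move=> z; rewrite addr_ge0 ?sqr_ge0.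
- by apply: (le_lt_trans (F_bound Aa)); rewrite ltry.
Qed.

Let iFre2 a : multiplier a -> leb3.-integrable setT (EFin \o (fun z => Fre a z ^+ 2)).
Proof.
move=> Aa; apply: (le_integrableR _ _ (integrable_F2 Aa)).
  by apply: measurable_funX; exact: mFre.
by move=> z; rewrite ger0_norm ?sqr_ge0// lerDl sqr_ge0.
Qed.

Let iFim2 a : multiplier a -> leb3.-integrable setT (EFin \o (fun z => Fim a z ^+ 2)).
Proof.
move=> Aa; apply: (le_integrableR _ _ (integrable_F2 Aa)).
  by apply: measurable_funX; exact: mFim.
by move=> z; rewrite ger0_norm ?sqr_ge0// lerDr sqr_ge0.
Qed.

Let F_boundR a L : multiplier a -> 0 <= L -> (forall x, `|a x| <= L) ->
  \int[leb3]_z (Fre a z ^+ 2 + Fim a z ^+ 2) <= 2 * C * (\int[mu]_x nf x) * L ^+ 2.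
Proof.
move=> Aa L0 aL.
rewrite -lee_fin RintegralK; last exact: integrable_F2.
apply: (le_trans (F_bound Aa)); rewrite lee_fin -[leRHS]mulrA ler_wpM2l ?mulr_ge0//.
rewrite -RintegralZr//; apply: le_Rintegral => //; first exact: inf_mult2.
  by under eq_fun do rewrite mulrC; exact: integrableZR.
move=> x _; rewrite mulrC ler_wpM2l// -expr2 -real_normK ?num_real//.
by rewrite lerXn2r ?nnegrE.
Qed.

(** [Bform] and [Sform] are the real and imaginary parts of the Hermitian product of F (a f) and F
    (b f). *)
Definition Bform a b := \int[leb3]_z (Fre a z * Fre b z + Fim a z * Fim b z).
Definition Sform a b := \int[leb3]_z (Fim a z * Fre b z - Fre a z * Fim b z).

Let iB a b : multiplier a -> multiplier b ->
  leb3.-integrable setT (EFin \o (fun z => Fre a z * Fre b z + Fim a z * Fim b z)).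
Proof.
move=> Aa Ab; apply: integrableDR; apply: integrable_mul2;
  [exact: mFre|exact: mFre|exact: iFre2|exact: iFre2
  |exact: mFim|exact: mFim|exact: iFim2|exact: iFim2].
Qed.

Let iS a b : multiplier a -> multiplier b ->
  leb3.-integrable setT (EFin \o (fun z => Fim a z * Fre b z - Fre a z * Fim b z)).
Proof.
move=> Aa Ab; apply: integrableBR; apply: integrable_mul2;
  [exact: mFim|exact: mFre|exact: iFim2|exact: iFre2
  |exact: mFre|exact: mFim|exact: iFre2|exact: iFim2].
Qed.

Let BC a b : Bform a b = Bform b a.
Proof. by apply: eq_Rintegral => z _; ring. Qed.

Let SC a b : multiplier a -> multiplier b -> Sform a b = - 1 * Sform b a.
Proof.
by move=> Aa Ab; rewrite /Sform -RintegralZl//; [apply: eq_Rintegral => z _; ring|exact: iS].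
Qed.

Let BDl a a' b : multiplier a -> multiplier a' -> multiplier b ->
  Bform (fun x => a x + a' x) b = Bform a b + Bform a' b.
Proof.
move=> Aa Aa' Ab; rewrite /Bform -RintegralD//; try exact: iB.
by apply: eq_Rintegral => z _; rewrite FreD// FimD//; ring.
Qed.

Let BZl c a b : multiplier a -> multiplier b -> Bform (fun x => c * a x) b = c * Bform a b.
Proof.
move=> Aa Ab; rewrite /Bform -RintegralZl//; last exact: iB.
by apply: eq_Rintegral => z _; rewrite FreZ// FimZ//; ring.
Qed.

Let SDl a a' b : multiplier a -> multiplier a' -> multiplier b ->
  Sform (fun x => a x + a' x) b = Sform a b + Sform a' b.
Proof.
move=> Aa Aa' Ab; rewrite /Sform -RintegralD//; try exact: iS.
by apply: eq_Rintegral => z _; rewrite FreD// FimD//; ring.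
Qed.

Let SZl c a b : multiplier a -> multiplier b -> Sform (fun x => c * a x) b = c * Sform a b.
Proof.
move=> Aa Ab; rewrite /Sform -RintegralZl//; last exact: iS.
by apply: eq_Rintegral => z _; rewrite FreZ// FimZ//; ring.
Qed.

Let K := 2 * C * \int[mu]_x nf x.

Let K0 : 0 <= K.
Proof. by rewrite !mulr_ge0// Rintegral_ge0. Qed.

(** Common to both forms: each integrand is at most half the sum of |F (a f)|^2 and |F (b f)|^2, and
    each of these integrates to at most K L^2. *)
Let form_le (u : R * R * R -> R) a b L : multiplier a -> multiplier b -> 0 <= L ->
  (forall x, `|a x| <= L) -> (forall x, `|b x| <= L) ->
  leb3.-integrable setT (EFin \o u) ->
  (forall z, `|u z| <= 2^-1 * (Fre a z ^+ 2 + Fim a z ^+ 2) + 2^-1 * (Fre b z ^+ 2 + Fim b z ^+ 2)) ->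
  `|\int[leb3]_z u z| <= K * L ^+ 2.
Proof.
move=> Aa Ab L0 aL bL iu uab.
apply: (le_trans (le_normr_Rintegral measurableT iu)).
have ia := integrableZR 2^-1 (integrable_F2 Aa).
have ib := integrableZR 2^-1 (integrable_F2 Ab).
apply: (@le_trans _ _ (\int[leb3]_z (2^-1 * (Fre a z ^+ 2 + Fim a z ^+ 2) +
    2^-1 * (Fre b z ^+ 2 + Fim b z ^+ 2)))).
  by apply: le_Rintegral => //; [exact: integrable_norm|exact: integrableDR].
rewrite RintegralD// !RintegralZl//; try exact: integrable_F2.
have := F_boundR Aa L0 aL; have := F_boundR Ab L0 bL; rewrite -/K.
set U := Rintegral _ _ _; set V := Rintegral _ _ _; set W := K * _.
by clearbody U V W; lra.
Qed.

Let B_le a b L : multiplier a -> multiplier b -> 0 <= L ->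
  (forall x, `|a x| <= L) -> (forall x, `|b x| <= L) -> `|Bform a b| <= K * L ^+ 2.
Proof.
move=> Aa Ab L0 aL bL; apply: (form_le Aa Ab) => // [|z]; first exact: iB.
rewrite !expr2 ler_norml; apply/andP.
have := sqr_ge0 (Fre a z + Fre b z); have := sqr_ge0 (Fim a z + Fim b z).
have := sqr_ge0 (Fre a z - Fre b z); have := sqr_ge0 (Fim a z - Fim b z).
by rewrite !expr2 => *; split; lra.
Qed.

Let S_le a b L : multiplier a -> multiplier b -> 0 <= L ->
  (forall x, `|a x| <= L) -> (forall x, `|b x| <= L) -> `|Sform a b| <= K * L ^+ 2.
Proof.
move=> Aa Ab L0 aL bL; apply: (form_le Aa Ab) => // [|z]; first exact: iS.
rewrite !expr2 ler_norml; apply/andP.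
have := sqr_ge0 (Fim a z + Fre b z); have := sqr_ge0 (Fre a z + Fim b z).
have := sqr_ge0 (Fim a z - Fre b z); have := sqr_ge0 (Fre a z - Fim b z).
by rewrite !expr2 => *; split; lra.
Qed.

Let rot h a b : multiplier a -> multiplier b ->
  let ca := fun x => cos (h * tau x) * a x in
  let sa := fun x => sin (h * tau x) * a x in
  let cb := fun x => cos (h * tau x) * b x in
  let sb := fun x => sin (h * tau x) * b x in
  Sform ca cb + Bform sa cb - Bform ca sb + Sform sa sb = Sform a b.
Proof.
move=> Aa Ab ca sa cb sb.
have Aca : multiplier ca by apply: multiplierM => //; exact: multiplier_cos_tau.
have Asa : multiplier sa by apply: multiplierM => //; exact: multiplier_sin_tau.
have Acb : multiplier cb by apply: multiplierM => //; exact: multiplier_cos_tau.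
have Asb : multiplier sb by apply: multiplierM => //; exact: multiplier_sin_tau.
rewrite [RHS]/Sform -(Rintegral_shift3 h); last exact: (integrable_mfun (iS Aa Ab)).
rewrite {1}/Sform /Bform -RintegralD//; [|exact: iS|exact: iB].
rewrite -RintegralB//; [|by apply: integrableDR; [exact: iS|exact: iB]|exact: iB].
rewrite /Sform -RintegralD//; last exact: iS.
  apply: eq_Rintegral => z _.
  by rewrite !Fre_shift// !Fim_shift// -/ca -/sa -/cb -/sb; ring.
by apply: integrableBR; [apply: integrableDR; [exact: iS|exact: iB]|exact: iB].
Qed.

Let BDr a b b' : multiplier a -> multiplier b -> multiplier b' ->
  Bform a (fun x => b x + b' x) = Bform a b + Bform a b'.
Proof.
move=> Aa Ab Ab'; apply: etrans (BC a _) _; apply: etrans (BDl Ab Ab' Aa) _.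
exact: (f_equal2 +%R (BC b a) (BC b' a)).
Qed.

Let BZr c a b : multiplier a -> multiplier b -> Bform a (fun x => c * b x) = c * Bform a b.
Proof.
move=> Aa Ab; apply: etrans (BC a _) _; apply: etrans (BZl c Ab Aa) _.
exact: (f_equal ( *%R c) (BC b a)).
Qed.

Let SDr a b b' : multiplier a -> multiplier b -> multiplier b' ->
  Sform a (fun x => b x + b' x) = Sform a b + Sform a b'.
Proof.
move=> Aa Ab Ab'; rewrite (SC Aa (multiplierD Ab Ab')) SDl//.
by rewrite (SC Aa Ab) (SC Aa Ab') mulrDr.
Qed.

Let SZr c a b : multiplier a -> multiplier b -> Sform a (fun x => c * b x) = c * Sform a b.
Proof.
move=> Aa Ab; rewrite (SC Aa (multiplierM (multiplier_cst c) Ab)) SZl//.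
by rewrite (SC Aa Ab) mulrCA.
Qed.

Let tau_norm x : `|tau x| <= M. Proof. by rewrite ger0_norm. Qed.

Let multiplier_bounded a : multiplier a -> exists2 L, 0 <= L & forall x, `|a x| <= L.
Proof. by case. Qed.

Let B_shift := form_shift tau_norm K0 multiplier_bounded multiplierD multiplierM
  multiplier_cst multiplier_tau multiplier_cos_tau multiplier_sin_tau BDl BDr BZl BZr
  SDl SDr SZl SZr B_le S_le rot.

Definition Dform a b := 2 * C * \int[mu]_x (a x * b x * nf x) - Bform a b.

Theorem completely_monotone_extension :
  completely_monotone (fun t =>
    2 * C * \int[mu]_x (expR (- (t * tau x)) ^+ 2 * (fr x ^+ 2 + fi x ^+ 2)) -
    \int[leb3]_z (Fre (fun x => expR (- (t * tau x))) z ^+ 2 +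
                  Fim (fun x => expR (- (t * tau x))) z ^+ 2)).
Proof.
have DC a b : multiplier a -> multiplier b -> Dform a b = Dform b a.
  move=> _ _; rewrite /Dform (BC a); congr (_ * _ - _).
  by apply: eq_Rintegral => x _; rewrite (mulrC (a x)).
have DD a a' b : multiplier a -> multiplier a' -> multiplier b ->
    Dform (fun x => a x + a' x) b = Dform a b + Dform a' b.
  move=> Aa Aa' Ab; rewrite /Dform (BDl Aa Aa' Ab).
  have e : \int[mu]_x ((a x + a' x) * b x * nf x) =
      \int[mu]_x (a x * b x * nf x) + \int[mu]_x (a' x * b x * nf x).
    by rewrite -RintegralD//; [apply: eq_Rintegral => x _; ring|exact: inf_mult2..].
  apply: etrans (f_equal (fun I => 2 * C * I - (Bform a b + Bform a' b)) e) _.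
  by rewrite mulrDr opprD addrACA.
have DZ c a b : multiplier a -> multiplier b -> Dform (fun x => c * a x) b = c * Dform a b.
  move=> Aa Ab; rewrite /Dform (BZl c Aa Ab).
  have e : \int[mu]_x (c * a x * b x * nf x) = c * \int[mu]_x (a x * b x * nf x).
    by rewrite -RintegralZl//; [apply: eq_Rintegral => x _; ring|exact: inf_mult2].
  apply: etrans (f_equal (fun I => 2 * C * I - c * Bform a b) e) _.
  by rewrite mulrBr mulrCA.
have D_ge0 a : multiplier a -> 0 <= Dform a a.
  move=> Aa; rewrite subr_ge0 -lee_fin /Bform RintegralK; last exact: iB.
  exact: F_bound.
(* Dropping the nonpositive term - [Bform a a] leaves only the weighted L^2 norm of [a]. *)
have D_le a L : multiplier a -> 0 <= L -> (forall x, `|a x| <= L) -> Dform a a <= K * L ^+ 2.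
  move=> Aa L0 aL; rewrite /Dform lerBlDr.
  apply: (@le_trans _ _ (K * L ^+ 2)); last first.
    by rewrite lerDl Rintegral_ge0// => z _; rewrite addr_ge0// -expr2 sqr_ge0.
  rewrite /K -[leRHS]mulrA ler_wpM2l ?mulr_ge0//.
  rewrite -RintegralZr//; apply: le_Rintegral => //; first exact: inf_mult2.
    by under eq_fun do rewrite mulrC; exact: integrableZR.
  move=> x _; rewrite mulrC ler_wpM2l// -expr2 -real_normK ?num_real//.
  by rewrite lerXn2r ?nnegrE.
have D_shift a b : multiplier a -> multiplier b ->
    Dform (fun x => tau x * a x) b = Dform a (fun x => tau x * b x).
  move=> Aa Ab; rewrite /Dform B_shift//; congr (_ * _ - _).
  by apply: eq_Rintegral => x _; rewrite [tau x * a x]mulrC !mulrA.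
have := completely_monotone_form (adm := multiplier) (D := Dform) tau0 tauM M0 multiplierD multiplierM multiplier_cst
  multiplier_tau multiplier_exp DC DD DZ D_ge0 D_le D_shift.
by congr completely_monotone; apply/funext => t.
Qed.

End ExtensionForm.

(** * Slabs of strongly convex functions *)

Section SlabEstimate.
Variable R : realType.
Variables (K : set (R * R)) (F : R * R -> R) (z0 : R * R) (c : R).
Hypothesis mK : measurable K.
Hypothesis mF : measurable_fun K F.
Hypothesis c0 : 0 < c.
Hypothesis F_min : forall z, K z -> F z0 <= F z.
Hypothesis K_star : forall z l, K z -> 0 <= l -> l <= 1 ->
  K (l * z.1 + (1 - l) * z0.1, l * z.2 + (1 - l) * z0.2).
Hypothesis F_star : forall z l, K z -> 0 <= l -> l <= 1 ->
  F (l * z.1 + (1 - l) * z0.1, l * z.2 + (1 - l) * z0.2) <= l * F z + (1 - l) * F z0.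
Hypothesis F_growth : forall z, K z ->
  c * ((z.1 - z0.1) ^+ 2 + (z.2 - z0.2) ^+ 2) <= F z - F z0.

Let S b := K `&` [set z | F z <= b].

Let mS b : measurable (S b).
Proof.
rewrite /S (_ : [set z | _] = F @^-1` `]-oo, b]); last first.
  by apply/seteqP; split => z /=; rewrite in_itv.
exact: mF.
Qed.

(** Quadratic growth confines the sublevel set to a square of side 2 r with r^2 = (b - F z0) / c. In
    dimension two this area is linear in b - F z0, the order the slab estimate needs. *)
Let S_le b : F z0 <= b -> (@leb2 R (S b) <= (4 * (b - F z0) / c)%:E)%E.
Proof.
move=> mb; pose r := Num.sqrt ((b - F z0) / c).
have q0 : 0 <= (b - F z0) / c by rewrite divr_ge0 ?subr_ge0// ltW.
have r0 : 0 <= r by exact: sqrtr_ge0.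
have r2 : r ^+ 2 = (b - F z0) / c by rewrite sqr_sqrtr.
pose I (x : R) := `[x - r, x + r]%classic : set R.
apply: (@le_trans _ _ (@leb2 R (I z0.1 `*` I z0.2))).
  apply: le_measure; rewrite ?inE//; [exact: mS|by apply: measurableX; exact: measurable_itv|].
  move=> z [Kz /= zb]; have := F_growth Kz => g.
  have h : (z.1 - z0.1) ^+ 2 + (z.2 - z0.2) ^+ 2 <= r ^+ 2.
    by rewrite r2 ler_pdivlMr// mulrC (le_trans g)// lerB.
  have abs (u v : R) : u ^+ 2 + v ^+ 2 <= r ^+ 2 -> `|u| <= r.
    move=> uv; rewrite -(ger0_norm r0) -ler_sqr ?nnegrE// !real_normK ?num_real//.
    by rewrite (le_trans _ uv)// lerDl sqr_ge0.
  have := abs _ _ h; rewrite addrC in h; have := abs _ _ h.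
  by rewrite !ler_norml => /andP[? ?] /andP[? ?]; split; rewrite /I/= in_itv/=; apply/andP; split; lra.
have leI x : lebesgue_measure (I x) = (2 * r)%:E.
  rewrite lebesgue_measure_itv/= lte_fin; case: ifPn => h1.
    by rewrite -EFinB; congr EFin; ring.
  by congr EFin; move: h1; rewrite -leNgt; lra.
rewrite /leb2 product_measure1E//; [|exact: measurable_itv|exact: measurable_itv].
apply: (@le_trans _ _ ((2 * r)%:E * (2 * r)%:E)%E).
  by rewrite -{1}(leI z0.1) -(leI z0.2).
by rewrite -EFinM lee_fin -mulrA -r2 expr2; lra.
Qed.

Let S_dilate (l b : R) : 0 < l -> l <= 1 ->
  ((l ^+ 2)%:E * @leb2 R (S b) <= @leb2 R (S (l * b + (1 - l) * F z0)%R))%E.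
Proof.
move=> l0 l1; set a := l * b + _.
have ind A : measurable A -> measurable_fun setT (fun z : R * R => (\1_A z : R)%:E).
  by move=> mA; apply/measurable_EFinP; exact: measurable_indic.
have integral_leb2 A : measurable A -> @leb2 R A = (\int[@leb2 R]_z (\1_A z)%:E)%E.
  by move=> mA; rewrite integral_indic// setIT.
rewrite (integral_leb2 _ (mS b)) [X in (_ <= X)%E](integral_leb2 _ (mS a)).
rewrite (ge0_integral_dilate2 ((1 - l) * z0.1, (1 - l) * z0.2) l0 (f := fun z => (\1_(S a) z)%:E)); last 2 first.
- exact: ind.
- by move=> z; rewrite lee_fin.
apply: lee_wpmul2l; first by rewrite lee_fin sqr_ge0.
apply: ge0_le_integral => //.
- exact: ind.
- have := ind _ (mS a) => ma.
  apply: (measurableT_comp ma); apply: measurable_fun_pair;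
  by apply: measurable_funD => //; apply: measurable_funM.
move=> z _; rewrite lee_fin !indicE.
have [/[!inE] -[Kz /= zb]|_ /=] := boolP (z \in S b); last by rewrite ler0n.
rewrite mem_set//; split; first by apply: K_star => //; exact: ltW.
by rewrite /= (le_trans (F_star Kz (ltW l0) l1))// lerD2r ler_wpM2l// (ltW l0).
Qed.

(* Convexity makes the dilation by [l] about the minimiser map [S b] into
   [S (l b + (1 - l) m)], so [|S b| - |S a| <= (1 - l^2) |S b|] while [|S b| = O(b - m)]. *)
Let slab_half_open a b : a < b ->
  (@leb2 R (K `&` [set z | (a < F z <= b)%R]) <= (8 / c * (b - a))%:E)%E.
Proof.
move=> ab; have [bm|mb] := ltP b (F z0).
  have -> : K `&` [set z | (a < F z <= b)%R] = set0.
    apply/seteqP; split => z //= [Kz /andP[_ zb]].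
    by have := F_min Kz; rewrite leNgt (le_lt_trans zb bm).
  by rewrite measure0 lee_fin mulr_ge0 ?divr_ge0 ?subr_ge0 ?(ltW ab) ?(ltW c0).
have [am|ma] := leP a (F z0).
  apply: (@le_trans _ _ (@leb2 R (S b))).
    apply: le_measure; rewrite ?inE//; last by move=> z [Kz /andP[_ ?]].
      rewrite (_ : [set z | _] = F @^-1` `]a, b]); first exact: mF.
      by apply/seteqP; split => z /=; rewrite in_itv.
    exact: mS.
  apply: (le_trans (S_le mb)); rewrite lee_fin mulrAC.
  have ci : 0 <= c^-1 by rewrite invr_ge0 ltW.
  have := ler_wpM2l ci (_ : b - F z0 <= b - a) => h; have := h (ltac:(lra)).
  by have := mulr_ge0 ci (ltac:(lra) : 0 <= b - a); lra.
(* The ratio for which the dilated level l b + (1 - l) F z0 is exactly [a]. *)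
pose l := (a - F z0) / (b - F z0).
have bm0 : 0 < b - F z0 by lra.
have l0 : 0 < l by rewrite divr_gt0// subr_gt0.
have l1 : l <= 1 by rewrite ler_pdivrMr// mul1r; lra.
have la : l * b + (1 - l) * F z0 = a by rewrite /l; field; rewrite gt_eqF.
have Sab : S a `<=` S b by move=> z [Kz /= za]; split => //=; rewrite (le_trans za)// ltW.
have Sfin u : F z0 <= u -> exists2 s, @leb2 R (S u) = s%:E & 0 <= s.
  move=> mu_; exists (fine (@leb2 R (S u))); last by rewrite fine_ge0// measure_ge0.
  rewrite fineK// ge0_fin_numE ?measure_ge0//.
  by rewrite (le_lt_trans (S_le mu_))// ltry.
have [sb Sb sb0] := Sfin b mb; have [sa Sa _] := Sfin a (ltW ma).
have -> : K `&` [set z | (a < F z <= b)%R] = S b `\` S a.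
  apply/seteqP; split => z /=.
    by move=> [Kz /andP[az zb]]; split => // -[_ /=]; rewrite leNgt az.
  move=> [[Kz zb] nza]; split => //; rewrite zb andbT ltNge; apply/negP => za.
  by apply: nza.
have Sb_lty : (@leb2 R (S b) < +oo)%E by rewrite Sb ltry.
have -> : @leb2 R (S b `\` S a) = (@leb2 R (S b) - @leb2 R (S a))%E.
  by have := measureD (mu := @leb2 R) (mS b) (mS a) Sb_lty; rewrite setIidr.
rewrite Sb Sa -EFinB lee_fin.
have := S_dilate b l0 l1; rewrite la Sb Sa -EFinM lee_fin => dil.
have := S_le mb; rewrite Sb lee_fin => Sble.
(* 1 - l^2 <= 2 (1 - l). Since (1 - l) (b - F z0) = b - a, the bound 4 (b - F z0) / c then gives the
   constant 8 / c. *)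
apply: (@le_trans _ _ ((1 - l) * (2 * sb))).
  have : 0 <= (1 - l) ^+ 2 * sb by rewrite mulr_ge0// sqr_ge0.
  by move: dil; rewrite !expr2; lra.
apply: (@le_trans _ _ ((1 - l) * (2 * (4 * (b - F z0) / c)))).
  by rewrite ler_wpM2l ?subr_ge0// ler_wpM2l.
rewrite le_eqVlt; apply/orP; left; apply/eqP; rewrite /l; field.
by rewrite !gt_eqF.
Qed.

(** The closed slab sits in the half-open one over (2 a - b, b], twice as long, which doubles the
    constant. *)
Lemma slab_measure_le a b : a < b ->
  (@leb2 R (K `&` [set z | (a <= F z <= b)%R]) <= (16 / c * (b - a))%:E)%E.
Proof.
move=> ab; have ab' : 2 * a - b < b by lra.
have mslab (I : set R) : measurable I -> measurable (K `&` F @^-1` I) by move=> mI; exact: mF.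
apply: (@le_trans _ _ (@leb2 R (K `&` [set z | (2 * a - b < F z <= b)%R]))).
  apply: le_measure; rewrite ?inE//.
  - rewrite (_ : [set z | _] = F @^-1` `[a, b]); first exact: mslab.
    by apply/seteqP; split => z /=; rewrite in_itv.
  - rewrite (_ : [set z | _] = F @^-1` `]2 * a - b, b]); first exact: mslab.
    by apply/seteqP; split => z /=; rewrite in_itv.
  - by move=> z [Kz /= /andP[az zb]]; split => //=; apply/andP; split; lra.
by apply: (le_trans (slab_half_open ab')); rewrite lee_fin le_eqVlt; apply/orP; left;
  apply/eqP; ring.
Qed.

End SlabEstimate.

(** * Derivatives along lines from continuous partials *)

Section LineDerivative.
Variable R : realType.
Implicit Types (f : R * R -> R) (v p : R * R).

Definition box p (r : R) : set (R * R) :=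
  [set q | `|q.1 - p.1| < r /\ `|q.2 - p.2| < r].

Lemma nbhs_box p (A : set (R * R)) : nbhs p A -> exists2 r : R, 0 < r & box p r `<=` A.
Proof.
move=> /nbhs_ballP[r /= r0 rA]; exists r => // q [q1 q2]; apply: rA.
by split; rewrite /= /ball/= distrC.
Qed.

Lemma MVT_unordered (g g' : R -> R) (a b : R) :
  (forall x, `|x - a| <= `|b - a| -> is_derive x (1 : R) g (g' x)) ->
  exists2 c, `|c - a| <= `|b - a| & g b - g a = g' c * (b - a).
Proof.
move=> dg.
have cont x : `|x - a| <= `|b - a| -> {for x, continuous g}.
  by move=> xab; apply/differentiable_continuous/derivable1_diffP; case: (dg x xab).
have [ab|ba] := leP a b.
  have inab x : a <= x -> x <= b -> `|x - a| <= `|b - a|.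
    by move=> ax xb; rewrite !ger0_norm ?subr_ge0//; lra.
  have [c||c] := @MVT_segment _ g g' a b ab.
  - by rewrite in_itv/= => /andP[ac cb]; apply: dg; apply: inab; exact: ltW.
  - apply: continuous_in_subspaceT => x; rewrite inE/= in_itv/= => /andP[ax xb].
    by apply: cont; exact: inab.
  - by rewrite in_itv/= => /andP[ac cb] e; exists c => //; exact: inab.
have inab x : b <= x -> x <= a -> `|x - a| <= `|b - a|.
  by move=> bx xa; rewrite !ler0_norm ?subr_le0//; lra.
have [c||c] := @MVT_segment _ g g' b a (ltW ba).
- by rewrite in_itv/= => /andP[ac cb]; apply: dg; apply: inab; exact: ltW.
- apply: continuous_in_subspaceT => x; rewrite inE/= in_itv/= => /andP[ax xb].
  by apply: cont; exact: inab.
- rewrite in_itv/= => /andP[ac cb] e; exists c; first exact: inab.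
  by rewrite -[LHS]opprB e; ring.
Qed.

Lemma is_derive_fst f (u y : R) : derivable f (u, y) (1, 0) ->
  is_derive u (1 : R) (fun u => f (u, y)) ('D_(1, 0) f (u, y)).
Proof.
rewrite /derivable /derive => df.
have e : (fun h : R => h^-1 *: (f (h *: (1 : R) + u, y) - f (u, y))) =
    (fun h : R => h^-1 *: (f (h *: ((1, 0) : R * R) + (u, y)) - f (u, y))).
  by apply/funext => h; congr (_ *: (f _ - _)); congr (_, _); rewrite /= /GRing.scale /= mulr0 add0r.
by apply: DeriveDef; rewrite /derivable /derive /shift /= e.
Qed.

Lemma is_derive_snd f (x u : R) : derivable f (x, u) (0, 1) ->
  is_derive u (1 : R) (fun u => f (x, u)) ('D_(0, 1) f (x, u)).
Proof.
rewrite /derivable /derive => df.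
have e : (fun h : R => h^-1 *: (f (x, h *: (1 : R) + u) - f (x, u))) =
    (fun h : R => h^-1 *: (f (h *: ((0, 1) : R * R) + (x, u)) - f (x, u))).
  by apply/funext => h; congr (_ *: (f _ - _)); congr (_, _); rewrite /= /GRing.scale /= mulr0 add0r.
by apply: DeriveDef; rewrite /derivable /derive /shift /= e.
Qed.

(** [smooth_on] speaks of coordinate derivatives only; this is the chain rule that gives derivatives
    along arbitrary segments. *)
Lemma is_derive_line (V : set (R * R)) f (x : R * R) v (t : R) : open V ->
  (forall p, V p -> derivable f p (1, 0) /\ derivable f p (0, 1)) ->
  (forall p, V p -> {for p, continuous ('D_(1, 0) f)} /\ {for p, continuous ('D_(0, 1) f)}) ->
  V (x.1 + t * v.1, x.2 + t * v.2) ->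
  is_derive t (1 : R) (fun t => f (x.1 + t * v.1, x.2 + t * v.2))
    (v.1 * 'D_(1, 0) f (x.1 + t * v.1, x.2 + t * v.2) +
     v.2 * 'D_(0, 1) f (x.1 + t * v.1, x.2 + t * v.2)).
Proof.
move=> oV df cf; set p := (_, _) => Vp.
have [c1 c2] := cf _ Vp.
pose m := `|v.1| + `|v.2| + 1.
have m0 : 0 < m by rewrite ltr_wpDl ?addr_ge0.
set a := _ + _.
have cv : h^-1 *: (f (x.1 + (h *: (1 : R) + t) * v.1, x.2 + (h *: (1 : R) + t) * v.2) - f p)
    @[h --> 0^'] --> a.
  apply/cvgrPdist_le => /= e e0.
  have em : 0 < e / m by rewrite divr_gt0.
  move/cvgrPdist_lt : (c1) => /(_ _ em) n1; move/cvgrPdist_lt : (c2) => /(_ _ em) n2.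
  have nV : nbhs p V by exact: open_nbhs_nbhs.
  have [r r0 rV] := nbhs_box (filterI nV (filterI n1 n2)).
  near=> h.
  have h0 : h != 0 by near: h; exact: nbhs_dnbhs_neq.
  have hr : `|h| <= r / 2 / m.
    by near: h; apply: dnbhs0_le; rewrite !divr_gt0.
  have hm : `|h| * m < r.
    by apply: (@le_lt_trans _ _ (r / 2)); [rewrite -ler_pdivlMr|lra].
  have hv1 : `|h * v.1| < r.
    by rewrite normrM (le_lt_trans _ hm)// ler_wpM2l// /m; have := normr_ge0 v.2; lra.
  have hv2 : `|h * v.2| < r.
    by rewrite normrM (le_lt_trans _ hm)// ler_wpM2l// /m; have := normr_ge0 v.1; lra.
  (* The increment is split at the corner (p.1, p.2 + h v.2) into two axis-parallel moves. The mean
     value theorem evaluates each at a point still in the box where the partials are e / m close to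
     their values at p. *)
  have [d1 d1h e1] : exists2 d, `|d - p.1| <= `|h * v.1| &
      f (p.1 + h * v.1, p.2 + h * v.2) - f (p.1, p.2 + h * v.2) =
      'D_(1, 0) f (d, p.2 + h * v.2) * (h * v.1).
    have := @MVT_unordered (fun u => f (u, p.2 + h * v.2))
      (fun u => 'D_(1, 0) f (u, p.2 + h * v.2)) p.1 (p.1 + h * v.1).
    rewrite addrAC subrr add0r; apply => u uh; apply: is_derive_fst; apply: (df _ _).1.
    by apply: (rV _ _).1; split => /=; [exact: le_lt_trans hv1|rewrite addrAC subrr add0r].
  have [d2 d2h e2] : exists2 d, `|d - p.2| <= `|h * v.2| &
      f (p.1, p.2 + h * v.2) - f (p.1, p.2) = 'D_(0, 1) f (p.1, d) * (h * v.2).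
    have := @MVT_unordered (fun u => f (p.1, u)) (fun u => 'D_(0, 1) f (p.1, u))
      p.2 (p.2 + h * v.2).
    rewrite addrAC subrr add0r; apply => u uh; apply: is_derive_snd; apply: (df _ _).2.
    by apply: (rV _ _).1; split => /=; [rewrite subrr normr0|exact: le_lt_trans hv2].
  have b1 : `|'D_(1, 0) f p - 'D_(1, 0) f (d1, p.2 + h * v.2)| < e / m.
    apply: (rV (d1, p.2 + h * v.2) _).2.1; split => /=; first exact: le_lt_trans hv1.
    by rewrite addrAC subrr add0r.
  have b2 : `|'D_(0, 1) f p - 'D_(0, 1) f (p.1, d2)| < e / m.
    apply: (rV (p.1, d2) _).2.2; split => /=; first by rewrite subrr normr0.
    exact: le_lt_trans hv2.
  rewrite (_ : f (_, _) - f p = 'D_(1, 0) f (d1, p.2 + h * v.2) * (h * v.1) +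
      'D_(0, 1) f (p.1, d2) * (h * v.2)); last first.
    rewrite -e1 -e2 /p /= addrA subrK; congr (f (_, _) - _); rewrite /GRing.scale /=; ring.
  rewrite (_ : a - _ = v.1 * ('D_(1, 0) f p - 'D_(1, 0) f (d1, p.2 + h * v.2)) +
      v.2 * ('D_(0, 1) f p - 'D_(0, 1) f (p.1, d2))); last first.
    by rewrite /a /GRing.scale /=; field.
  rewrite (le_trans (ler_normD _ _))// !normrM.
  have : m * (e / m) = e by field; rewrite gt_eqF.
  have := ler_wpM2l (normr_ge0 v.1) (ltW b1); have := ler_wpM2l (normr_ge0 v.2) (ltW b2).
  by rewrite /m !mulrDl mul1r; lra.
apply: DeriveDef; first by apply/cvg_ex; exists a.
exact: cvg_lim.
Unshelve. all: by end_near. Qed.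

End LineDerivative.

(** Strong convexity as an inequality between values: it passes directly to q |-> phi q + phi (y -
    q) and can be restricted to smaller sets. *)
Definition convex_box (R : realType) (V : set (R * R)) (phi : R * R -> R) (p : R * R) (r c : R) :=
  [/\ 0 < r, 0 < c, box p r `<=` V &
  forall (a b : R * R) (l : R), box p r a -> box p r b -> 0 <= l -> l <= 1 ->
    phi (l * b.1 + (1 - l) * a.1, l * b.2 + (1 - l) * a.2) <=
    l * phi b + (1 - l) * phi a -
    c * (l * (1 - l)) * ((b.1 - a.1) ^+ 2 + (b.2 - a.2) ^+ 2)].

Section StrongConvexity.
Variable R : realType.

(** u - k t^2 / 2 has a nondecreasing derivative. Comparing its mean slopes on [0, l] and [l, 1]
    gives convexity at l. *)
Lemma strongly_convex_of_derive2 (u u1 u2 : R -> R) (k : R) :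
  (forall t : R, 0 <= t <= 1 -> is_derive t (1 : R) u (u1 t)) ->
  (forall t : R, 0 <= t <= 1 -> is_derive t (1 : R) u1 (u2 t)) ->
  (forall t : R, 0 <= t <= 1 -> k <= u2 t) ->
  forall l : R, 0 <= l <= 1 -> u l <= (1 - l) * u 0 + l * u 1 - k / 2 * (l * (1 - l)).
Proof.
move=> du du1 ku2 l /andP[l0 l1].
pose w t := u t - k / 2 * t ^+ 2; pose w1 t := u1 t - k * t.
have dw (t : R) : 0 <= t <= 1 -> is_derive t (1 : R) w (w1 t).
  move=> t01; have dut := du t t01; rewrite /w; apply: is_derive_eq.
  by rewrite /w1 /GRing.scale /=; field.
have dw1 (t : R) : 0 <= t <= 1 -> is_derive t (1 : R) w1 (u2 t - k).
  move=> t01; have dut := du1 t t01; rewrite /w1; apply: is_derive_eq.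
  by rewrite /GRing.scale /=; ring.
have mvt (g g' : R -> R) (a b : R) : (forall t : R, 0 <= t <= 1 -> is_derive t (1 : R) g (g' t)) ->
    0 <= a -> a <= b -> b <= 1 -> exists2 c, a <= c <= b & g b - g a = g' c * (b - a).
  move=> dg a0 ab b1; have [c||c] := @MVT_segment _ g g' a b ab.
  - by rewrite in_itv/= => /andP[ac cb]; apply: dg; apply/andP; split; lra.
  - apply: continuous_in_subspaceT => x; rewrite inE/= in_itv/= => /andP[ax xb].
    apply/differentiable_continuous/derivable1_diffP.
    by have [] := dg x (ltac:(apply/andP; split; lra)).
  - by rewrite in_itv/= => cab e; exists c.
have [c1 /andP[c10 c1l] e1] := mvt w w1 0 l dw (lexx 0) l0 l1.
have [c2 /andP[c2l c21] e2] := mvt w w1 l 1 dw l0 l1 (lexx 1).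
have [d /andP[dc1 dc2] e] := mvt w1 _ c1 c2 dw1 c10 (le_trans c1l c2l) c21.
have w12 : w1 c1 <= w1 c2.
  rewrite -subr_ge0 e mulr_ge0 ?subr_ge0 ?(le_trans c1l)//.
  by apply: ku2; apply/andP; split; lra.
have : (1 - l) * (w l - w 0) <= l * (w 1 - w l).
  rewrite e1 e2 subr0; have : l * (1 - l) * w1 c1 <= l * (1 - l) * w1 c2.
    by rewrite ler_wpM2l// mulr_ge0// subr_ge0.
  lra.
rewrite /w !expr2; lra.
Qed.

Variables (V : set (R * R)) (phi : R * R -> R).
Hypothesis oV : open V.
Hypothesis phi_smooth : smooth_on V phi.
Hypothesis phi_posdef : forall x, V x -> hessian_posdef phi x.

Let qform x (v : R * R) := v.1 * v.1 * hess phi false false x +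
  v.1 * v.2 * hess phi false true x + v.2 * v.1 * hess phi true false x +
  v.2 * v.2 * hess phi true true x.

(* [det / trace] bounds a positive definite 2x2 form from below. *)
Let posdef_lower_bound (A B1 B2 D : R) :
  (forall v : R * R, v <> 0 ->
    0 < v.1 * v.1 * A + v.1 * v.2 * B1 + v.2 * v.1 * B2 + v.2 * v.2 * D) ->
  exists2 c, 0 < c & forall v : R * R, c * (v.1 ^+ 2 + v.2 ^+ 2) <=
    v.1 * v.1 * A + v.1 * v.2 * B1 + v.2 * v.1 * B2 + v.2 * v.2 * D.
Proof.
(* The quadratic form sees only the symmetric part of its matrix. *)
move=> pos; pose S := (B1 + B2) / 2.
have A0 : 0 < A.
  have := pos (1, 0); rewrite /= !mulr1 !mul1r !mulr0 !mul0r !addr0; apply.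
  by move=> [/eqP]; rewrite oner_eq0.
have det0 : 0 < A * D - S ^+ 2.
  have : 0 < A * (A * D - S ^+ 2).
    have := pos (S, - A) => /=.
    have -> : S * S * A + S * - A * B1 + - A * S * B2 + - A * - A * D = A * (A * D - S ^+ 2).
      by rewrite /S; field.
    by apply => -[_ /eqP]; rewrite oppr_eq0 gt_eqF.
  by rewrite pmulr_rgt0.
have D0 : 0 < D by rewrite -(pmulr_rgt0 _ A0); have := sqr_ge0 S; lra.
have tr0 : 0 < A + D by exact: addr_gt0.
exists ((A * D - S ^+ 2) / (A + D)); first exact: divr_gt0.
move=> v; rewrite mulrAC ler_pdivrMr//.
(* Cayley-Hamilton for the symmetric matrix m: trace times the form at v equals det |v|^2 + |m
   v|^2. *)
have -> : (v.1 * v.1 * A + v.1 * v.2 * B1 + v.2 * v.1 * B2 + v.2 * v.2 * D) * (A + D) =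
    (A * D - S ^+ 2) * (v.1 ^+ 2 + v.2 ^+ 2) + ((A * v.1 + S * v.2) ^+ 2 + (S * v.1 + D * v.2) ^+ 2).
  by rewrite /S; field.
by rewrite lerDl addr_ge0 ?sqr_ge0.
Qed.

(** With each entry moved by less than c / 4, the diagonal loses at most c / 4 and each of the two
    cross terms c / 8, so half of the lower bound survives. *)
Let qform_perturb (a00 a01 a10 a11 b00 b01 b10 b11 c : R) (v : R * R) :
  `|a00 - b00| < c / 4 -> `|a01 - b01| < c / 4 ->
  `|a10 - b10| < c / 4 -> `|a11 - b11| < c / 4 ->
  c * (v.1 ^+ 2 + v.2 ^+ 2) <=
    v.1 * v.1 * a00 + v.1 * v.2 * a01 + v.2 * v.1 * a10 + v.2 * v.2 * a11 ->
  c / 2 * (v.1 ^+ 2 + v.2 ^+ 2) <=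
    v.1 * v.1 * b00 + v.1 * v.2 * b01 + v.2 * v.1 * b10 + v.2 * v.2 * b11.
Proof.
rewrite !ltr_norml => /andP[h1 h1'] /andP[h2 h2'] /andP[h3 h3'] /andP[h4 h4'] cv.
have p1 : v.1 ^+ 2 * (a00 - b00) <= v.1 ^+ 2 * (c / 4).
  by rewrite ler_wpM2l ?sqr_ge0 ?(ltW h1').
have p4 : v.2 ^+ 2 * (a11 - b11) <= v.2 ^+ 2 * (c / 4).
  by rewrite ler_wpM2l ?sqr_ge0 ?(ltW h4').
have cross (g : R) : - (c / 4) < g -> g < c / 4 ->
    v.1 * v.2 * g <= (c / 8) * (v.1 ^+ 2 + v.2 ^+ 2).
  move=> g1 g2.
  have u1 : 0 <= (c / 4 - g) * (v.1 + v.2) ^+ 2 by rewrite mulr_ge0 ?sqr_ge0//; lra.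
  have u2 : 0 <= (c / 4 + g) * (v.1 - v.2) ^+ 2 by rewrite mulr_ge0 ?sqr_ge0//; lra.
  by move: u1 u2; rewrite !expr2; lra.
have := cross _ h2 h2'; have := cross _ h3 h3'.
by move: p1 p4 cv; rewrite !expr2; lra.
Qed.

Let hess_lower_bound x0 : V x0 -> exists r c : R, [/\ 0 < r, 0 < c, box x0 r `<=` V &
  forall y, box x0 r y -> forall v, c * (v.1 ^+ 2 + v.2 ^+ 2) <= qform y v].
Proof.
move=> Vx0; have [c c0 cq] := posdef_lower_bound (phi_posdef Vx0).
have c40 : 0 < c / 4 by lra.
have near_hess (i j : bool) : \forall y \near x0, `|hess phi i j x0 - hess phi i j y| < c / 4.
  have [+ _] := phi_smooth [:: i; j] Vx0.
  by move/cvgrPdist_lt => /(_ _ c40).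
have nV : nbhs x0 V by exact: open_nbhs_nbhs.
have [r r0 rV] := nbhs_box (filterI nV (filterI (filterI (near_hess false false) (near_hess false true))
  (filterI (near_hess true false) (near_hess true true)))).
exists r, (c / 2); split; [exact: r0|lra|by move=> y /rV[]|].
move=> y /rV[_ [[h00 h01] [h10 h11]]] v.
exact: (qform_perturb h00 h01 h10 h11 (cq v)).
Qed.

(** Along the segment from a to b the second derivative of phi is its Hessian form at b - a, bounded
    below on the whole box; the one-variable lemma then yields half of that bound. *)
Lemma locally_strongly_convex x0 : V x0 -> exists r c : R, convex_box V phi x0 r c.
Proof.
move=> Vx0; have [r [c [r0 c0 rV cq]]] := hess_lower_bound Vx0.
exists r, (c / 2); split; [exact: r0|lra|exact: rV|].
move=> a b l ra rb l0 l1; pose v : R * R := (b.1 - a.1, b.2 - a.2).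
pose pt (t : R) : R * R := (a.1 + t * v.1, a.2 + t * v.2).
have inbox (t : R) : 0 <= t <= 1 -> box x0 r (pt t).
  case: ra rb => [a1 a2] [b1 b2] /andP[t0 t1].
  have cvx (x y z : R) : `|x - z| < r -> `|y - z| < r -> `|x + t * (y - x) - z| < r.
    rewrite !ltr_norml => /andP[? ?] /andP[? ?].
    have -> : x + t * (y - x) - z = (1 - t) * (x - z) + t * (y - z) by ring.
    have [->|tn0] := eqVneq t 0; first by rewrite subr0 mul1r mul0r addr0; apply/andP.
    have tp : 0 < t by rewrite lt_neqAle eq_sym tn0.
    by apply/andP; split; nra.
  by split; apply: cvx.
have smooth_line k (t : R) : 0 <= t <= 1 ->
    is_derive t (1 : R) (fun t => iterpartial k phi (pt t))
      (v.1 * iterpartial (false :: k) phi (pt t) + v.2 * iterpartial (true :: k) phi (pt t)).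
  move=> t01; apply: (@is_derive_line _ V) => //; last exact: rV (inbox t t01).
  - by move=> p Vp; have [_ d] := phi_smooth k Vp; split; [exact: (d false)|exact: (d true)].
  - move=> p Vp; have c1 := (phi_smooth (false :: k) Vp).1.
    have c2 := (phi_smooth (true :: k) Vp).1.
    by split; [exact: c1|exact: c2].
have du := smooth_line [::].
have du1 (t : R) : 0 <= t <= 1 -> is_derive t (1 : R)
    (fun t => v.1 * iterpartial [:: false] phi (pt t) + v.2 * iterpartial [:: true] phi (pt t))
    (qform (pt t) v).
  move=> t01; have d1 := smooth_line [:: false] t t01; have d2 := smooth_line [:: true] t t01.
  apply: is_derive_eq; rewrite /qform /hess.
  move: (iterpartial [:: false; false] _ _) (iterpartial [:: false; true] _ _).
  move: (iterpartial [:: true; false] _ _) (iterpartial [:: true; true] _ _) => A B C D.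
  by rewrite /GRing.scale /=; ring.
have := strongly_convex_of_derive2 du du1 (fun t t01 => cq _ (inbox t t01) v) (l := l).
rewrite l0 l1 => /(_ isT).
rewrite /iterpartial /= /pt (_ : (a.1 + l * v.1, _) = (l * b.1 + (1 - l) * a.1, l * b.2 + (1 - l) * a.2)).
  rewrite (_ : (a.1 + 0 * v.1, _) = a); last first.
    by rewrite (surjective_pairing a) /=; congr (_, _); ring.
  rewrite (_ : (a.1 + 1 * v.1, _) = b); last first.
    by rewrite (surjective_pairing b) /= /v /=; congr (_, _); ring.
  by rewrite /v /=; lra.
by rewrite /v /=; congr (_, _); ring.
Qed.

End StrongConvexity.

(** * Open and compact sets of the plane are measurable *)

Section PlaneTopology.
Variable R : realType.
Implicit Types (A V : set (R * R)) (p : R * R).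

Lemma box_open p (r : R) : open (box p r).
Proof.
rewrite openE => q [q1 q2]; apply/nbhs_ballP.
exists (Num.min (r - `|q.1 - p.1|) (r - `|q.2 - p.2|)) => /=.
  by rewrite lt_min !subr_gt0 q1 q2.
move=> z [z1 z2]; move: z1 z2; rewrite /= /ball/= !lt_min => /andP[z1 _] /andP[_ z2].
split; first by rewrite -(subrK q.1 z.1) -addrA (le_lt_trans (ler_normD _ _))// distrC; lra.
by rewrite -(subrK q.2 z.2) -addrA (le_lt_trans (ler_normD _ _))// distrC; lra.
Qed.

Lemma box_setX p (r : R) :
  box p r = `]p.1 - r, p.1 + r[%classic `*` `]p.2 - r, p.2 + r[%classic.
Proof.
apply/seteqP; split => q; rewrite /box/= !in_itv/= !ltr_norml.
  by move=> [/andP[? ?] /andP[? ?]]; split; apply/andP; split; lra.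
by move=> [/andP[? ?] /andP[? ?]]; split; apply/andP; split; lra.
Qed.

Lemma measurable_box p (r : R) : measurable (box p r).
Proof. by rewrite box_setX; apply: measurableX; exact: measurable_itv. Qed.

(** Measurability on R * R refers to the product sigma-algebra, so an open set is exhausted by
    countably many boxes with rational centres and radii 1 / (k + 1). *)
Lemma open_measurable2 A : open A -> measurable A.
Proof.
move=> oA.
pose B (q : rat * rat * nat) : set (R * R) := box (ratr q.1.1, ratr q.1.2) (q.2.+1%:R^-1 : R).
pose F q := if `[<B q `<=` A>] then B q else set0.
rewrite (_ : A = \bigcup_q F q).
  apply: countable_bigcupT_measurable => // q; rewrite /F; case: asboolP => _ //.
  exact: measurable_box.
apply/seteqP; split => [x Ax|x [q _]]; last by rewrite /F; case: asboolP => // sub /sub.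
have [r r0 rA] := nbhs_box (open_nbhs_nbhs (conj oA Ax)).
(* Half of [r], because a box of radius e about a rational point within e of x reaches up to 2 e
   from x. *)
have [k k0 kr] : exists2 k : nat, True & k.+1%:R^-1 < r / 2.
  have [k _ kr] := near_infty_natSinv_lt (PosNum (divr_gt0 r0 (ltr0Sn R 1))).
  by exists k => //; apply: (kr k) => /=.
set e := k.+1%:R^-1 in kr.
have e0 : 0 < e by rewrite invr_gt0.
have near_rat (u : R) : exists q : rat, `|u - ratr q| < e.
  have [q] := rat_in_itvoo (ltac:(lra) : u - e < u + e).
  by rewrite in_itv/= => /andP[h1 h2]; exists q; rewrite ltr_norml; apply/andP; split; lra.
have [q1 xq1] := near_rat x.1; have [q2 xq2] := near_rat x.2.
exists (q1, q2, k) => //; rewrite /F; case: asboolP => [_|]; first by split.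
case=> z [z1 z2]; apply: rA; move: z1 z2 xq1 xq2 => /=; rewrite !ltr_norml -/e.
move=> /andP[? ?] /andP[? ?] /andP[? ?] /andP[? ?].
by split; rewrite ltr_norml; apply/andP; split; lra.
Qed.

Lemma compact_measurable2 A : compact A -> measurable A.
Proof.
move=> /compact_closed => /(_ (@norm_hausdorff _ _)) cA.
by rewrite -[A]setCK; apply: measurableC; apply: open_measurable2; exact: closed_openC.
Qed.

Lemma continuous_measurable_fun2 V (f : R * R -> R) : open V ->
  (forall p, V p -> {for p, continuous f}) -> measurable_fun V f.
Proof.
move=> oV cf; apply: (measurability _ (RGenOpens.measurableE R)).
move=> _ [_ [a [b ->] <-]]; apply: open_measurable2.
rewrite openE => p [Vp fp]; apply: filterI; first exact: open_nbhs_nbhs.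
by apply: (cf p Vp); exact: open_nbhs_nbhs (conj (interval_open _ _) fp).
Qed.

Lemma compact_segmentX (a b c d : R) : compact (`[a, b]%classic `*` `[c, d]%classic).
Proof. by apply: compact_setX; exact: segment_compact. Qed.

End PlaneTopology.

Lemma measure_cover_le d (T : measurableType d) (R : realType) (mu : {measure set T -> \bar R})
    (I : eqType) (s : seq I) (F : I -> set T) (v : I -> R) (A : set T) :
  measurable A -> (forall i, i \in s -> measurable (F i)) ->
  (forall i, i \in s -> (mu (F i) <= (v i)%:E)%E) ->
  (forall x, A x -> exists2 i, i \in s & F i x) ->
  (mu A <= (\sum_(i <- s) v i)%:E)%E.
Proof.
elim: s A => [|i s IH] A mA mF vF AF.
  rewrite big_nil (_ : A = set0) ?measure0//.
  by apply/seteqP; split => // x /AF[].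
have mFi : measurable (F i) by apply: mF; rewrite mem_head.
rewrite big_cons EFinD (le_trans _ (leeD (vF i (mem_head _ _)) (IH (A `\` F i) _ _ _ _)))//.
- apply: (@le_trans _ _ (mu (F i `|` A `\` F i))).
    apply: le_measure; rewrite ?inE//; first by apply: measurableU => //; exact: measurableD.
    by move=> x Ax; have [Fx|nFx] := pselect (F i x); [left|right].
  by apply: measureU2 => //; exact: measurableD.
- exact: measurableD.
- by move=> j js; apply: mF; rewrite inE js orbT.
- by move=> j js; apply: vF; rewrite inE js orbT.
- move=> x [/AF[j]]; rewrite inE => /orP[/eqP -> //|js Fj _]; by exists j.
Qed.

(** * Slabs of phi q + phi (y - q) on a pair of boxes *)

Section SumSlab.
Variable R : realType.
Variables (V : set (R * R)) (phi : R * R -> R).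
Hypothesis phi_cont : forall p, V p -> {for p, continuous phi}.

(** Closed, so that minima are attained; used at half radius, which keeps it inside the open box
    where convexity is known. *)
Definition cbox (p : R * R) (r : R) : set (R * R) :=
  [set q | `|q.1 - p.1| <= r /\ `|q.2 - p.2| <= r].

Lemma cbox_setX p r :
  cbox p r = `[p.1 - r, p.1 + r]%classic `*` `[p.2 - r, p.2 + r]%classic.
Proof.
apply/seteqP; split => q; rewrite /cbox/= !in_itv/= !ler_norml.
  by move=> [/andP[? ?] /andP[? ?]]; split; apply/andP; split; lra.
by move=> [/andP[? ?] /andP[? ?]]; split; apply/andP; split; lra.
Qed.

Lemma compact_cbox p r : compact (cbox p r).
Proof.
by rewrite cbox_setX; exact: compact_segmentX.
Qed.

Lemma cbox_convex p r (a b : R * R) l : cbox p r a -> cbox p r b -> 0 <= l -> l <= 1 ->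
  cbox p r (l * a.1 + (1 - l) * b.1, l * a.2 + (1 - l) * b.2).
Proof.
move=> [a1 a2] [b1 b2] l0 l1.
have cvx (x y z : R) : `|x - z| <= r -> `|y - z| <= r -> `|l * x + (1 - l) * y - z| <= r.
  rewrite !ler_norml => /andP[? ?] /andP[? ?].
  have -> : l * x + (1 - l) * y - z = l * (x - z) + (1 - l) * (y - z) by ring.
  by apply/andP; split; nra.
by split; apply: cvx.
Qed.

Lemma cbox_half p r : 0 < r -> cbox p (r / 2) `<=` box p r.
Proof. by move=> r0 q [q1 q2]; split; [move: q1|move: q2] => /= h; rewrite (le_lt_trans h)//; lra. Qed.

Lemma cbox_reflect (y p q : R * R) r : cbox (y - p) r q <-> cbox p r (y - q).
Proof.
have eq (u v w : R) : `|u - v - w| = `|v - (u - w)| by rewrite -normrN; congr `|_|; ring.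
have E1 : `|(y - q).1 - p.1| = `|q.1 - (y - p).1| by exact: eq.
have E2 : `|(y - q).2 - p.2| = `|q.2 - (y - p).2| by exact: eq.
by rewrite /cbox /mkset E1 E2.
Qed.

Lemma reflect_continuous (y : R * R) : continuous (fun q : R * R => y - q).
Proof. by move=> q; apply: cvgB; [exact: cvg_cst|exact: cvg_id]. Qed.

Lemma slab_sum_box (p1 : R * R) (r1 c1 : R) (p2 : R * R) (r2 c2 : R) (y : R * R) (a b : R) :
  convex_box V phi p1 r1 c1 -> convex_box V phi p2 r2 c2 -> a < b ->
  let S := cbox p1 (r1 / 2) `&` cbox (y - p2) (r2 / 2) `&`
    [set q | a <= phi q + phi (y - q) <= b] in
  measurable S /\ (@leb2 R S <= (32 / c1 * (b - a))%:E)%E.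
Proof.
move=> [r10 c10 V1 cv1] [r20 c20 V2 cv2] ab.
set K := cbox _ _ `&` cbox _ _; pose F q := phi q + phi (y - q).
have K1 q : K q -> box p1 r1 q by move=> [h _]; exact: cbox_half.
have K2 q : K q -> box p2 r2 (y - q) by move=> [_ /cbox_reflect h]; exact: cbox_half.
have cK : compact K.
  apply: compact_closedI; first exact: compact_cbox.
  by apply: compact_closed; [exact: norm_hausdorff|exact: compact_cbox].
have Fc q : K q -> {for q, continuous F}.
  move=> Kq; apply: cvgD; first exact: phi_cont (V1 _ (K1 _ Kq)).
  by apply: continuous_comp; [exact: reflect_continuous|exact: phi_cont (V2 _ (K2 _ Kq))].
have mK : measurable K by exact: compact_measurable2.
have [K0|/set0P K0] := eqVneq K set0.
  by split; rewrite K0 set0I// measure0 lee_fin mulr_ge0// ?subr_ge0 ?(ltW ab)// divr_ge0// ltW.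
(* The centre of the dilation. It may lie on the boundary of [K], so growth is later derived from
   minimality instead of a vanishing gradient. *)
have [z0 Kz0 z0min] : exists2 z0, K z0 & forall q, K q -> F z0 <= F q.
  have cFK : {within K, continuous F}.
    by apply: continuous_in_subspaceT => q /set_mem; exact: Fc.
  have [z0 /set_mem Kz0 h] := compact_EVT_min K0 cK cFK.
  by exists z0 => // q Kq; apply: h; rewrite inE.
have mF : measurable_fun K F.
  pose W := box p1 r1 `&` [set q | box p2 r2 (y - q)].
  have oW : open W.
    apply: openI; first exact: box_open.
    have := proj1 (continuousP _) (@reflect_continuous y) _ (@box_open _ p2 r2); exact: id.
  apply: (@measurable_funS _ _ _ _ W); [exact: open_measurable2|by move=> q Kq; split; [exact: K1|exact: K2]|].
  apply: continuous_measurable_fun2 => // q [q1 q2]; apply: cvgD; first exact: phi_cont (V1 _ q1).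
  by apply: continuous_comp; [exact: reflect_continuous|exact: phi_cont (V2 _ q2)].
split.
  rewrite (_ : [set q | _] = F @^-1` `[a, b]); first exact: mF.
  by apply/seteqP; split => q /=; rewrite in_itv.
have K_star z l : K z -> 0 <= l -> l <= 1 -> K (l * z.1 + (1 - l) * z0.1, l * z.2 + (1 - l) * z0.2).
  by move=> [k1 k2] l0 l1; case: Kz0 => k3 k4; split; exact: cbox_convex.
have F_conv z l : K z -> 0 <= l -> l <= 1 ->
    F (l * z.1 + (1 - l) * z0.1, l * z.2 + (1 - l) * z0.2) <= l * F z + (1 - l) * F z0
      - c1 * (l * (1 - l)) * ((z.1 - z0.1) ^+ 2 + (z.2 - z0.2) ^+ 2).
  move=> Kz l0 l1; have h1 := cv1 _ _ _ (K1 _ Kz0) (K1 _ Kz) l0 l1.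
  have h2 := cv2 _ _ _ (K2 _ Kz0) (K2 _ Kz) l0 l1.
  have e : y - (l * z.1 + (1 - l) * z0.1, l * z.2 + (1 - l) * z0.2) =
     (l * (y - z).1 + (1 - l) * (y - z0).1, l * (y - z).2 + (1 - l) * (y - z0).2).
    by rewrite [LHS]surjective_pairing /=; congr (_, _); ring.
  rewrite /F e; move: h1 h2.
  have : 0 <= c2 * (l * (1 - l)) * (((y - z).1 - (y - z0).1) ^+ 2 + ((y - z).2 - (y - z0).2) ^+ 2).
    by rewrite !mulr_ge0 ?subr_ge0 ?addr_ge0 ?sqr_ge0 ?(ltW c20).
  move: (c2 * _ * _) (c1 * _ * _) (phi (_, _)) (phi (_, _)) (phi z) (phi z0) (phi (y - z)) (phi (y - z0)).
  by move=> e1 e2 e3 e4 e5 e6 e7 e8; lra.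
(* The quadratic gain comes from the first summand, so the constant depends on neither the second
   box nor [y]. *)
have -> : 32 / c1 = 16 / (c1 / 2) by rewrite invf_div mulrA; congr (_ / _); ring.
apply: (@slab_measure_le R K F z0 (c1 / 2)) => //; first by lra.
- move=> z l Kz l0 l1; apply: le_trans (F_conv z l Kz l0 l1) _.
  by rewrite gerBl !mulr_ge0 ?subr_ge0 ?addr_ge0 ?sqr_ge0 ?(ltW c10).
(* Minimality at the midpoint of z and z0, where convexity gains c1 / 4 times the squared distance,
   gives growth with constant c1 / 2. *)
- move=> z Kz; have l0 : 0 <= 2^-1 :> R by lra.
  have l1 : 2^-1 <= 1 :> R by lra.
  have := F_conv z _ Kz l0 l1; have := z0min _ (K_star z _ Kz l0 l1).
  move: (F _) (F z) (F z0) (_ ^+ 2 + _) => u v w x; lra.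
Qed.

End SumSlab.

(** * Globalisation over the compact set *)

Section ConvexCover.
Variable R : realType.
Variables (U V : set (R * R)) (phi : R * R -> R).
Hypothesis cU : compact U.
Hypothesis oV : open V.
Hypothesis UV : U `<=` V.
Hypothesis phi_smooth : smooth_on V phi.
Hypothesis phi_posdef : forall x, V x -> hessian_posdef phi x.

Let phi_cont p : V p -> {for p, continuous phi}.
Proof. by move=> Vp; exact: (phi_smooth [::] Vp).1. Qed.

Lemma convex_cover : exists s : seq (R * R * (R * R)),
  (forall k, k \in s -> convex_box V phi k.1 k.2.1 k.2.2) /\
  (forall x, U x -> exists2 k, k \in s & cbox k.1 (k.2.1 / 2) x).
Proof.
have /choice[g gP] : forall x, exists rc : R * R, U x -> convex_box V phi x rc.1 rc.2.
  move=> x; have [Ux|nUx] := pselect (U x); last by exists 0.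
  by have [r [c h]] := locally_strongly_convex oV phi_smooth phi_posdef (UV Ux); exists (r, c).
pose T : ptopologicalType := HB.pack (R * R)%type (Pointed.class ((R * R)%type : pointedType))
  (Topological.class ((R * R)%type : topologicalType)).
have : @cover_compact T U by rewrite -(compact_cover T); exact: cU.
move=> /(_ (R * R)%type U (fun x => box x ((g x).1 / 2))) [x _|x Ux|D DU Dcov].
- exact: box_open.
- exists x => //; have [r0 _ _ _] := gP x Ux.
  by split; rewrite subrr normr0 divr_gt0.
exists [seq (x, g x) | x <- finmap.enum_fset D]; split.
  by move=> _ /mapP[x xD ->]; apply: gP; move/DU: xD; rewrite inE.
move=> x /Dcov [y /= yD [h1 h2]]; exists (y, g y); first exact: map_f.
by split => /=; rewrite ltW.
Qed.

(** Needed to pass from L^2 to L^1 on [U]; the finite cover by boxes gives it at once. *)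
Lemma measure_compact_lty : (@leb2 R U < +oo)%E.
Proof.
have [s [_ Us]] := convex_cover.
have mc (k : R * R * (R * R)) : measurable (cbox k.1 (k.2.1 / 2)).
  by apply: compact_measurable2; exact: compact_cbox.
pose v (k : R * R * (R * R)) := fine (@leb2 R (cbox k.1 (k.2.1 / 2))).
have vE k : (@leb2 R (cbox k.1 (k.2.1 / 2)) <= (v k)%:E)%E.
  rewrite /v fineK// ge0_fin_numE// cbox_setX /leb2.
  rewrite product_measure1E//.
  have fin (x y : R) : (@lebesgue_measure R `[x, y]%classic < +oo)%E.
    by rewrite lebesgue_measure_itv/=; case: ifP => _; rewrite -?EFinB ltry.
  by apply: lte_mul_pinfty; [exact: measure_ge0|rewrite ge0_fin_numE; [exact: fin|exact: measure_ge0]|exact: fin].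
have := measure_cover_le (mu := @leb2 R) (F := fun k => cbox k.1 (k.2.1 / 2)) (v := v)
  (compact_measurable2 cU) (fun k _ => mc k) (fun k _ => vE k) Us.
by move=> h; exact: le_lt_trans h (ltry _).
Qed.

(** A point q with q and y - q both in [U] lies in one box of the finite cover while y - q lies in
    another; summing the local estimates over all pairs of boxes gives a constant uniform in [y]. *)
Lemma slab_sum : exists2 C : R, 0 <= C & forall (y : R * R) (a b : R), a < b ->
  (@leb2 R ((U `&` [set q | U (y - q)%R]) `&`
    [set q | (a <= (phi \_ U) q + (phi \_ U) (y - q)%R <= b)%R]) <= (C * (b - a))%:E)%E.
Proof.
have [s [sc Us]] := convex_cover.
pose S := [seq (i, j) | i <- s, j <- s].
pose w (k : (R * R * (R * R)) * (R * R * (R * R))) := 32 / k.1.2.2.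
have mem k : k \in S -> convex_box V phi k.1.1 k.1.2.1 k.1.2.2 /\ convex_box V phi k.2.1 k.2.2.1 k.2.2.2.
  by move=> /allpairsP[[i j] /= [si sj ->]]; split; exact: sc.
exists (\sum_(k <- S) w k).
  by rewrite big_seq sumr_ge0// => k /mem[[_ c0 _ _] _]; rewrite /w divr_ge0// ltW.
move=> y a b ab; rewrite mulr_suml.
have mU : measurable U by exact: compact_measurable2.
have mrefl : measurable_fun setT (fun q : R * R => y - q).
  apply/measurable_fun_pairP; split => /=.
    by apply: measurable_funB => //; exact: measurable_fst.
  by apply: measurable_funB => //; exact: measurable_snd.
have mphi : measurable_fun setT (phi \_ U).
  apply/(measurable_restrictT _ mU); apply: (@measurable_funS _ _ _ _ V) => //.
    exact: open_measurable2.
  exact: continuous_measurable_fun2.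
pose K (k : (R * R * (R * R)) * (R * R * (R * R))) : set (R * R) := cbox k.1.1 (k.1.2.1 / 2) `&` cbox (y - k.2.1) (k.2.2.1 / 2) `&`
  [set q | a <= phi q + phi (y - q) <= b].
set A := _ `&` _.
have mA : measurable A.
  apply: measurableI; first by apply: measurableI => //; rewrite -[X in measurable X]setTI; exact: mrefl.
  rewrite (_ : [set q | _] = setT `&` (fun q => (phi \_ U) q + (phi \_ U) (y - q)) @^-1` `[a, b]); last first.
    by rewrite setTI; apply/seteqP; split => q /=; rewrite in_itv.
  by apply: measurable_funD => //; exact: measurableT_comp.
have := measure_cover_le (mu := @leb2 R) (F := K) (v := fun k => w k * (b - a)) mA; apply.
- by move=> k /mem[k1 k2]; exact: (slab_sum_box phi_cont y k1 k2 ab).1.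
- by move=> k /mem[k1 k2]; exact: (slab_sum_box phi_cont y k1 k2 ab).2.
- move=> q [[Uq Uyq]]; rewrite /= !patchE !mem_set// => h.
  have [i si qi] := Us _ Uq; have [j sj qj] := Us _ Uyq.
  exists (i, j); first by apply/allpairsP; exists (i, j).
  by split=> //; split=> //=; apply/cbox_reflect.
Qed.

End ConvexCover.

(** * Tensor squares and the theorem *)

Section SumSchur.
Variable R : realType.
Notation leb := (@lebesgue_measure R).
Notation leb4 := (prodm (@leb2 R) (@leb2 R)).

Let m11 : measurable_fun setT (fun q : (R * R) * (R * R) => q.1.1).
Proof. exact: (measurableT_comp measurable_fst measurable_fst). Qed.

Let m12 : measurable_fun setT (fun q : (R * R) * (R * R) => q.1.2).
Proof. exact: (measurableT_comp measurable_snd measurable_fst). Qed.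

Let m21 : measurable_fun setT (fun q : (R * R) * (R * R) => q.2.1).
Proof. exact: (measurableT_comp measurable_fst measurable_snd). Qed.

Let m22 : measurable_fun setT (fun q : (R * R) * (R * R) => q.2.2).
Proof. exact: (measurableT_comp measurable_snd measurable_snd). Qed.

Lemma measurable_sum_variable (f : (R * R) * (R * R) -> \bar R) : measurable_fun setT f ->
  measurable_fun setT (fun p : (R * R) * (R * R) => f (p.1, (p.2 - p.1)%R)).
Proof.
move=> mf; apply: (measurableT_comp mf); apply: measurable_fun_pair => //.
by apply: measurable_fun_pair => /=; apply: measurable_funB.
Qed.

(** The substitution y = xi + eta isolates the two kernel factors that depend on the sum, leaving
    the slab estimate for the inner integral. *)
Lemma ge0_integral_sum_variable (f : (R * R) * (R * R) -> \bar R) : measurable_fun setT f ->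
  (forall q, 0 <= f q)%E ->
  (\int[leb4]_q f q = \int[@leb2 R]_y \int[@leb2 R]_x f (x, (y - x)%R))%E.
Proof.
move=> mf f0; rewrite /prodm (fubini_tonelli1 (m1 := @leb2 R) (m2 := @leb2 R) f mf f0) /fubini_F /=.
have mg := measurable_sum_variable mf.
transitivity (\int[@leb2 R]_x \int[@leb2 R]_y f (x, (y - x)%R))%E; last first.
  exact: (fubini_tonelli (m1 := @leb2 R) (m2 := @leb2 R) _ mg (fun=> f0 _)).
apply: eq_integral => x _.
have mfx : measurable_fun setT (fun y => f (x, y)).
  by apply: (measurableT_comp mf); exact: measurable_fun_pair.
(* The translation by x is obtained as the composition of the reflections about 0 and x. *)
have mfx' : measurable_fun setT (fun y : R * R => f (x, ((0 - y.1)%R, (0 - y.2)%R))).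
  apply: (measurableT_comp mfx); apply: measurable_fun_pair; apply: measurable_funB => //.
have := ge0_integral_reflect2 0 mfx (fun=> f0 _) => /= <-.
have := ge0_integral_reflect2 x mfx' (fun=> f0 _) => /= <-.
apply: eq_integral => y _; congr (f (_, _)).
by rewrite [RHS]surjective_pairing /=; congr (_, _); ring.
Qed.

(** For the identity function slabs are intervals, so the slab estimate holds with constant 1. *)
Lemma integral_kmaj_line N a : 0 < N -> (\int[leb]_x kmaj N (a - x) <= 64%:E)%E.
Proof.
move=> N0; have := @integral_kmaj_le R _ _ leb setT id 1 N a N0 ler01 measurableT (@measurable_id _ _ _).
rewrite mulr1; under eq_integral do rewrite indicT mule1; apply => b c bc.
rewrite setTI (_ : [set x | _] = `[b, c]%classic).
  have <- : @lebesgue_measure R `[b, c]%classic = (1 * (c - b))%:E.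
    by rewrite lebesgue_measure_itv/= lte_fin bc mul1r EFinB.
  exact: lexx.
by apply/seteqP; split => x /=; rewrite in_itv.
Qed.

Lemma measurable_kmajB d (X : measurableType d) N c (f : X -> R) : 0 < N ->
  measurable_fun setT f -> measurable_fun setT (fun x => kmaj N (c - f x)).
Proof. by move=> N0 mf; apply: (measurableT_comp (measurable_kmaj N0)); exact: measurable_funB. Qed.

Lemma integral_kmaj_plane N a b : 0 < N ->
  (\int[@leb2 R]_y (kmaj N (a - y.1) * kmaj N (b - y.2)) <= (64 * 64)%:E)%E.
Proof.
move=> N0.
have m1 : measurable_fun setT (fun y : R * R => kmaj N (a - y.1) * kmaj N (b - y.2))%E.
  by apply: emeasurable_funM; apply: measurable_kmajB.
have p (u : R) : (0 <= kmaj N u)%E by exact: kmaj_ge0.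
rewrite /leb2 (fubini_tonelli1 (m1 := leb) (m2 := leb) _ m1 (fun=> mule_ge0 (p _) (p _))) /fubini_F /=.
have mk c : measurable_fun setT (fun y : R => kmaj N (c - y)) by exact: measurable_kmajB.
apply: (@le_trans _ _ (\int[leb]_x (kmaj N (a - x) * 64%:E)))%E.
  apply: ge0_le_integral => //.
  - by move=> x _; apply: integral_ge0 => y _; apply: mule_ge0; exact: p.
  - exact: (measurable_fun_fubini_tonelli_F (m2 := leb) _ m1 (fun=> mule_ge0 (p _) (p _))).
  - by apply: emeasurable_funM; [exact: mk|exact: measurable_cst].
  - move=> x _; rewrite ge0_integralZl//; last exact: mk.
    by apply: lee_wpmul2l => //; exact: integral_kmaj_line.
rewrite ge0_integralZr//; last exact: mk.
by rewrite EFinM lee_wpmul2r//; exact: integral_kmaj_line.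
Qed.

Variables (U : set (R * R)) (h : R * R -> R) (C : R).
Hypothesis mU : measurable U.
Hypothesis mh : measurable_fun setT h.
Hypothesis C0 : 0 <= C.
Hypothesis slab : forall (y : R * R) (a b : R), a < b ->
  (@leb2 R ((U `&` [set q | U (y - q)%R]) `&`
    [set q | (a <= h q + h (y - q)%R <= b)%R]) <= (C * (b - a))%:E)%E.

(** For a fixed sum y the inner integral costs 64 C by the slab estimate; what remains is a product
    of two one-dimensional kernels in y, costing 64 each. *)
Lemma schur_sum N a b c : 0 < N ->
  (\int[leb4]_q (kmaj N (c - (h q.1 + h q.2)) *
     (kmaj N (a - (q.1.1 + q.2.1)) * kmaj N (b - (q.1.2 + q.2.2))) * (\1_(U `*` U) q)%:E)
   <= (64 * C * (64 * 64))%:E)%E.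
Proof.
move=> N0; have p (u : R) : (0 <= kmaj N u)%E by exact: kmaj_ge0.
have i0 (X : Type) (A : set X) x : (0 <= (\1_A x : R)%:E)%E by rewrite lee_fin.
pose G (q : (R * R) * (R * R)) := (kmaj N (c - (h q.1 + h q.2)) *
  (kmaj N (a - (q.1.1 + q.2.1)) * kmaj N (b - (q.1.2 + q.2.2))) * (\1_(U `*` U) q)%:E)%E.
have G0 q : (0 <= G q)%E by rewrite !mule_ge0.
have mG : measurable_fun setT G.
  apply: emeasurable_funM; last first.
    by apply/measurable_EFinP; apply: measurable_indic; exact: measurableX.
  apply: emeasurable_funM; first apply: measurable_kmajB => //.
    by apply: measurable_funD; apply: (measurableT_comp mh).
  by apply: emeasurable_funM; apply: measurable_kmajB => //; apply: measurable_funD;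
    [exact: m11|exact: m21|exact: m12|exact: m22].
rewrite (ge0_integral_sum_variable mG G0).
have mrefl (y : R * R) : measurable_fun setT (fun q : R * R => y - q).
  by apply: measurable_fun_pair => /=; apply: measurable_funB.
pose A y := U `&` [set q | U (y - q)].
have mA y : measurable (A y).
  by apply: measurableI => //; rewrite -[X in measurable X]setTI; exact: mrefl.
pose F y x := h x + h (y - x).
have mF y : measurable_fun setT (F y).
  by apply: measurable_funD => //; exact: measurableT_comp.
have inner y : (\int[@leb2 R]_x (kmaj N (c - F y x) * (\1_(A y) x)%:E) <= (64 * C)%:E)%E.
  exact: (integral_kmaj_le (mu := @leb2 R) _ N0 C0 (mA y) (mF y) (slab y)).
have mouter : measurable_fun setT (fun y : R * R => kmaj N (a - y.1) * kmaj N (b - y.2))%E.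
  by apply: emeasurable_funM; apply: measurable_kmajB.
apply: (@le_trans _ _ (\int[@leb2 R]_y ((64 * C)%:E * (kmaj N (a - y.1) * kmaj N (b - y.2)))))%E; last first.
  rewrite ge0_integralZl//; first by rewrite [leRHS]EFinM lee_wpmul2l ?lee_fin ?mulr_ge0//; exact: integral_kmaj_plane.
  - by move=> y _; rewrite mule_ge0.
  - by rewrite lee_fin mulr_ge0.
apply: ge0_le_integral => //.
- by move=> y _; exact: integral_ge0.
- exact: (measurable_fun_fubini_tonelli_G (m1 := @leb2 R) (fun p : (R * R) * (R * R) => G (p.1, (p.2 - p.1)%R))
    (measurable_sum_variable mG) (fun=> G0 _)).
- exact: emeasurable_funM.
- move=> y _; apply: (@le_trans _ _ (\int[@leb2 R]_x ((kmaj N (a - y.1) * kmaj N (b - y.2)) *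
     (kmaj N (c - F y x) * (\1_(A y) x)%:E))))%E.
    rewrite le_eqVlt; apply/orP; left; apply/eqP; apply: eq_integral => x _; rewrite /G /=.
    rewrite (_ : x.1 + (y.1 - x.1) = y.1); last by ring.
    rewrite (_ : x.2 + (y.2 - x.2) = y.2); last by ring.
    rewrite (muleC (kmaj N (c - _))) -muleA; congr (_ * (_ * _))%E.
  rewrite ge0_integralZl//; first by rewrite muleC lee_wpmul2r ?mule_ge0.
  - by apply: emeasurable_funM; [exact: (measurable_kmajB c N0 (mF y))|apply/measurable_EFinP; exact: (measurable_indic (mA y))].
  - by move=> x _; rewrite mule_ge0.
  - by rewrite mule_ge0.
Qed.

End SumSchur.

(** * The square of the extension operator as a transform on U * U *)

Section TensorSquare.
Variable R : realType.
Notation leb2 := (@leb2 R).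
Notation leb3 := (@leb3 R).
Notation leb4 := (prodm leb2 leb2).
Variables (U : set (R * R)) (h ur ui : R * R -> R) (M C : R).
Hypothesis mU : measurable U.
Hypothesis mh : measurable_fun setT h.
Hypothesis h0 : forall xi, 0 <= h xi.
Hypothesis hM : forall xi, h xi <= M.
Hypothesis iur : leb2.-integrable setT (EFin \o ur).
Hypothesis iui : leb2.-integrable setT (EFin \o ui).
Hypothesis iur2 : leb2.-integrable setT (EFin \o (fun xi => ur xi ^+ 2)).
Hypothesis iui2 : leb2.-integrable setT (EFin \o (fun xi => ui xi ^+ 2)).
Hypothesis urU : forall xi, ~ U xi -> ur xi = 0.
Hypothesis uiU : forall xi, ~ U xi -> ui xi = 0.
Hypothesis C0 : 0 <= C.
Hypothesis slab : forall (y : R * R) (a b : R), a < b ->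
  (@Defs.leb2 R ((U `&` [set q | U (y - q)%R]) `&`
    [set q | (a <= h q + h (y - q)%R <= b)%R]) <= (C * (b - a))%:E)%E.

Let mur : measurable_fun setT ur. Proof. exact: integrable_mfun iur. Qed.
Let mui : measurable_fun setT ui. Proof. exact: integrable_mfun iui. Qed.

Definition damped_re t (z : R * R * R) xi :=
  expR (- (t * h xi)) * ur xi * cos (phase h z.1 z.2 xi) -
  expR (- (t * h xi)) * ui xi * sin (phase h z.1 z.2 xi).
Definition damped_im t (z : R * R * R) xi :=
  expR (- (t * h xi)) * ur xi * sin (phase h z.1 z.2 xi) +
  expR (- (t * h xi)) * ui xi * cos (phase h z.1 z.2 xi).
Definition damped_sq t xi := expR (- (t * h xi)) ^+ 2 * (ur xi ^+ 2 + ui xi ^+ 2).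

Let fr (q : (R * R) * (R * R)) := ur q.1 * ur q.2 - ui q.1 * ui q.2.
Let fi (q : (R * R) * (R * R)) := ur q.1 * ui q.2 + ui q.1 * ur q.2.
Let tau (q : (R * R) * (R * R)) := h q.1 + h q.2.
Let psi1 (q : (R * R) * (R * R)) := q.1.1 + q.2.1.
Let psi2 (q : (R * R) * (R * R)) := q.1.2 + q.2.2.

Let M0 : 0 <= M. Proof. exact: le_trans (h0 0) (hM 0). Qed.

Let ifr : leb4.-integrable setT (EFin \o fr).
Proof. by apply: integrableBR; exact: integrable_tensor. Qed.

Let ifi : leb4.-integrable setT (EFin \o fi).
Proof. by apply: integrableDR; exact: integrable_tensor. Qed.

Let normsq q : fr q ^+ 2 + fi q ^+ 2 = (ur q.1 ^+ 2 + ui q.1 ^+ 2) * (ur q.2 ^+ 2 + ui q.2 ^+ 2).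
Proof. by rewrite /fr /fi; ring. Qed.

Let inormsq : leb4.-integrable setT (EFin \o (fun q => fr q ^+ 2 + fi q ^+ 2)).
Proof.
rewrite (_ : (fun q => _) = fun q => (ur q.1 ^+ 2 + ui q.1 ^+ 2) * (ur q.2 ^+ 2 + ui q.2 ^+ 2)).
  have i2 := integrableDR iur2 iui2.
  exact: (integrable_tensor (m1 := leb2) (m2 := leb2) i2 i2).
by apply/funext => q; exact: normsq.
Qed.

Let ifr2 : leb4.-integrable setT (EFin \o (fun q => fr q ^+ 2)).
Proof.
apply: le_integrableR inormsq; first by apply: measurable_funX; exact: integrable_mfun ifr.
by move=> q; rewrite ger0_norm ?sqr_ge0// lerDl sqr_ge0.
Qed.

Let ifi2 : leb4.-integrable setT (EFin \o (fun q => fi q ^+ 2)).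
Proof.
apply: le_integrableR inormsq; first by apply: measurable_funX; exact: integrable_mfun ifi.
by move=> q; rewrite ger0_norm ?sqr_ge0// lerDr sqr_ge0.
Qed.

Let mtau : measurable_fun setT tau.
Proof. by apply: measurable_funD; apply: (measurableT_comp mh). Qed.

Let mpsi1 : measurable_fun setT psi1.
Proof.
by apply: measurable_funD; [exact: (measurableT_comp measurable_fst measurable_fst)|
  exact: (measurableT_comp measurable_fst measurable_snd)].
Qed.

Let mpsi2 : measurable_fun setT psi2.
Proof.
by apply: measurable_funD; [exact: (measurableT_comp measurable_snd measurable_fst)|
  exact: (measurableT_comp measurable_snd measurable_snd)].
Qed.

Let multt t : multiplier (fun q => expR (- (t * tau q))).
Proof.
apply: (@multiplier_exp _ _ R tau (2 * M) mtau).
- by move=> q; rewrite addr_ge0.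
- by move=> q; rewrite mulr2n mulrDl mul1r lerD.
Qed.

Let mphase z : measurable_fun setT (phase h z.1 z.2).
Proof.
apply: measurable_funD; first exact: measurable_funM.
by apply: measurable_funD; apply: measurable_funM.
Qed.

Let multh t : multiplier (fun xi => expR (- (t * h xi))).
Proof. exact: (@multiplier_exp _ _ R h M mh h0 hM t). Qed.

Let integrable_damped t u (v : R * R -> R) : leb2.-integrable setT (EFin \o u) -> multiplier v ->
  leb2.-integrable setT (EFin \o (fun xi => expR (- (t * h xi)) * u xi * v xi)).
Proof.
move=> iu mv; rewrite (_ : (fun xi => _) = fun xi => (expR (- (t * h xi)) * v xi) * u xi).
  exact: (integrable_mult (mu := leb2) (multiplierM (multh t) mv) iu).
by apply/funext => xi; rewrite mulrAC.
Qed.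

Let idre t z : leb2.-integrable setT (EFin \o damped_re t z).
Proof.
by apply: integrableBR; apply: integrable_damped => //; [apply: multiplier_cos|apply: multiplier_sin].
Qed.

Let idim t z : leb2.-integrable setT (EFin \o damped_im t z).
Proof.
by apply: integrableDR; apply: integrable_damped => //; [apply: multiplier_sin|apply: multiplier_cos].
Qed.

Let integrable_damped2 t (f v : (R * R) * (R * R) -> R) :
  leb4.-integrable setT (EFin \o f) -> multiplier v ->
  leb4.-integrable setT (EFin \o (fun q => expR (- (t * tau q)) * f q * v q)).
Proof.
move=> iu mv; rewrite (_ : (fun xi => _) = fun xi => (expR (- (t * tau xi)) * v xi) * f xi).
  exact: (integrable_mult (mu := leb4) (multiplierM (multt t) mv) iu).
by apply/funext => xi; rewrite mulrAC.
Qed.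

Let ph_sum z q : ph psi1 psi2 tau (z, q) = phase h z.1 z.2 q.1 + phase h z.1 z.2 q.2.
Proof. by rewrite /ph /phase /psi1 /psi2 /tau /=; ring. Qed.

Let mph z : measurable_fun setT (fun q => ph psi1 psi2 tau (z, q)).
Proof. by apply: measurableT_comp => //; exact: measurable_ph. Qed.

Let exp_tau t q : expR (- (t * tau q)) = expR (- (t * h q.1)) * expR (- (t * h q.2)).
Proof. by rewrite -expRD /tau; congr expR; ring. Qed.

Let Rintegral_square (u v : R * R -> R) : leb2.-integrable setT (EFin \o u) ->
  leb2.-integrable setT (EFin \o v) ->
  \int[leb4]_q (u q.1 * v q.2) = (\int[leb2]_xi u xi) * (\int[leb2]_xi v xi).
Proof. by move=> iu iv; exact: (Rintegral_tensor (m1 := leb2) (m2 := leb2) iu iv). Qed.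

(** Fubini turns the square of the integral of g_t e^{i phase} into an integral over pairs, where
    damping factors multiply and phases add. *)
Lemma damped_square_re t z : Fre leb4 psi1 psi2 tau fr fi (fun q => expR (- (t * tau q))) z =
  (\int[leb2]_xi damped_re t z xi) ^+ 2 - (\int[leb2]_xi damped_im t z xi) ^+ 2.
Proof.
rewrite !expr2 -!Rintegral_square//.
have irr := integrable_tensor (m1 := leb2) (m2 := leb2) (idre t z) (idre t z).
have iii := integrable_tensor (m1 := leb2) (m2 := leb2) (idim t z) (idim t z).
have ic := integrable_damped2 t ifr (multiplier_cos (mph z)).
have js := integrable_damped2 t ifi (multiplier_sin (mph z)).
rewrite /Fre /cos_tr /sin_tr -(RintegralB (mu := leb4) measurableT ic js).
rewrite -(RintegralB (mu := leb4) measurableT irr iii).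
apply: eq_Rintegral => q _; rewrite ph_sum exp_tau cosD sinD /damped_re /damped_im /fr /fi.
move: (expR _) (expR _) (cos _) (cos _) (sin _) (sin _) => *; ring.
Qed.

Lemma damped_square_im t z : Fim leb4 psi1 psi2 tau fr fi (fun q => expR (- (t * tau q))) z =
  2 * ((\int[leb2]_xi damped_re t z xi) * \int[leb2]_xi damped_im t z xi).
Proof.
rewrite mulr2n mulrDl mul1r [X in _ + X]mulrC -!Rintegral_square//.
have iri := integrable_tensor (m1 := leb2) (m2 := leb2) (idre t z) (idim t z).
have iir := integrable_tensor (m1 := leb2) (m2 := leb2) (idim t z) (idre t z).
have ic := integrable_damped2 t ifi (multiplier_cos (mph z)).
have js := integrable_damped2 t ifr (multiplier_sin (mph z)).
rewrite /Fim /cos_tr /sin_tr -(RintegralD (mu := leb4) measurableT js ic).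
rewrite -(RintegralD (mu := leb4) measurableT iri iir).
apply: eq_Rintegral => q _; rewrite ph_sum exp_tau cosD sinD /damped_re /damped_im /fr /fi.
move: (expR _) (expR _) (cos _) (cos _) (sin _) (sin _) => *; ring.
Qed.

Lemma damped_square_norm t : \int[leb4]_q (expR (- (t * tau q)) ^+ 2 * (fr q ^+ 2 + fi q ^+ 2)) =
  (\int[leb2]_xi damped_sq t xi) ^+ 2.
Proof.
have isq : leb2.-integrable setT (EFin \o damped_sq t).
  exact: (integrable_mult (mu := leb2) (multiplierM (multh t) (multh t)) (integrableDR iur2 iui2)).
rewrite expr2 -Rintegral_square//.
by apply: eq_Rintegral => q _; rewrite exp_tau normsq /damped_sq; ring.
Qed.

Let schur N a b c : 0 < N ->
  (\int[leb4]_q (kmaj N (c - tau q) * (kmaj N (a - psi1 q) * kmaj N (b - psi2 q)) *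
    (\1_(U `*` U) q)%:E) <= (64 * C * (64 * 64))%:E)%E.
Proof. exact: schur_sum. Qed.

Let frE q : ~ (U `*` U) q -> fr q = 0.
Proof.
move=> nUq; rewrite /fr; have [U1|U1] := pselect (U q.1); last by rewrite (urU U1) (uiU U1) !mul0r subr0.
have [U2|U2] := pselect (U q.2); first by case: nUq.
by rewrite (urU U2) (uiU U2) !mulr0 subr0.
Qed.

Let fiE q : ~ (U `*` U) q -> fi q = 0.
Proof.
move=> nUq; rewrite /fi; have [U1|U1] := pselect (U q.1); last by rewrite (urU U1) (uiU U1) !mul0r addr0.
have [U2|U2] := pselect (U q.2); first by case: nUq.
by rewrite (urU U2) (uiU U2) !mulr0 addr0.
Qed.

(** |w^2|^2 = |w|^4: this identifies the L^2 norm of the transform with the fourth power of the L^4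
    norm. *)
Let normF t z : Fre leb4 psi1 psi2 tau fr fi (fun q => expR (- (t * tau q))) z ^+ 2 +
    Fim leb4 psi1 psi2 tau fr fi (fun q => expR (- (t * tau q))) z ^+ 2 =
  ((\int[leb2]_xi damped_re t z xi) ^+ 2 + (\int[leb2]_xi damped_im t z xi) ^+ 2) ^+ 2.
Proof. by rewrite damped_square_re damped_square_im; ring. Qed.

Let mUU : measurable (U `*` U). Proof. exact: measurableX. Qed.

Let C'0 : 0 <= 64 * C * (64 * 64). Proof. by rewrite !mulr_ge0. Qed.

Let tau0 q : 0 <= tau q. Proof. by rewrite addr_ge0. Qed.

Let tauM q : tau q <= 2 * M. Proof. by rewrite mulr2n mulrDl mul1r lerD. Qed.

Let M'0 : 0 <= 2 * M. Proof. by rewrite mulr_ge0. Qed.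

Lemma integrable_damped_L4 t : leb3.-integrable setT (EFin \o (fun z =>
  ((\int[leb2]_xi damped_re t z xi) ^+ 2 + (\int[leb2]_xi damped_im t z xi) ^+ 2) ^+ 2)).
Proof.
have iF := integrable_F2 (mu := leb4) mpsi1 mpsi2 mtau mUU C'0 schur ifr ifi ifr2 ifi2 frE fiE (multt t).
apply: (eq_ind _ (fun f => leb3.-integrable setT (EFin \o f)) iF).
by apply/funext => z; exact: normF.
Qed.

Lemma completely_monotone_damped : completely_monotone (fun t =>
  2 * (64 * C * (64 * 64)) * (\int[leb2]_xi damped_sq t xi) ^+ 2 -
  \int[leb3]_z ((\int[leb2]_xi damped_re t z xi) ^+ 2 + (\int[leb2]_xi damped_im t z xi) ^+ 2) ^+ 2).
Proof.
have := completely_monotone_extension (mu := leb4) mpsi1 mpsi2 mtau mUU C'0 schur ifr ifi ifr2 ifi2 frE fiE tau0 tauM M'0.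
congr completely_monotone; apply/funext => t; rewrite damped_square_norm; congr (_ - _).
by apply: eq_Rintegral => z _; exact: normF.
Qed.

End TensorSquare.

Theorem theorem4p1 (R : realType) (U V : set (R * R)) (phi : R * R -> R) :
  compact U -> open V -> U `<=` V ->
  smooth_on V phi -> (forall x, V x -> hessian_posdef phi x) ->
  (forall xi, U xi -> 0 <= phi xi) ->
  exists c : R, forall gr gi : R * R -> R, in_L2 U gr gi ->
    let Q := fun t : R =>
      c * (L2sq U (damp phi t gr) (damp phi t gi)) ^+ 2
      - fine (ext_L4_4 U phi (damp phi t gr) (damp phi t gi)) in
    (forall t : R, 0 < t ->
       (ext_L4_4 U phi (damp phi t gr) (damp phi t gi) < +oo)%E) /\
    completely_monotone Q.
Proof.
move=> cU oV UV phi_smooth phi_posdef phi0.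
have mU := compact_measurable2 cU.
have phi_cont p : V p -> {for p, continuous phi} by move=> Vp; exact: (phi_smooth [::] p Vp).1.
(* Extension by zero makes [phi] measurable, nonnegative and bounded on the whole plane. The values
   outside [U] do no harm, since [ur] and [ui] vanish there. *)
pose h := phi \_ U.
have mh : measurable_fun setT h.
  apply/(measurable_restrictT _ mU); apply: (@measurable_funS _ _ _ _ V) => //.
    exact: open_measurable2.
  exact: continuous_measurable_fun2.
have h0 xi : 0 <= h xi by rewrite /h patchE; case: ifPn => // /set_mem; exact: phi0.
have [M hM] : exists M, forall xi, h xi <= M.
  have [U0|/set0P U0] := eqVneq U set0.
    by exists 0 => xi; rewrite /h U0 patchE in_set0.
  have cphi : {within U, continuous phi}.
    by apply: continuous_in_subspaceT => q /set_mem Uq; exact: phi_cont (UV _ Uq).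
  have [z /set_mem Uz zmax] := compact_EVT_max U0 cU cphi.
  exists (phi z) => xi; rewrite /h patchE; case: ifPn => [|_]; first exact: zmax.
  exact: phi0.
have [C C0 slab] := slab_sum cU oV UV phi_smooth phi_posdef.
have Ufin := measure_compact_lty cU oV UV phi_smooth phi_posdef.
(* The 2 recombines real and imaginary parts, 64 C integrates the majorant over slabs of phi xi +
   phi eta, and 64 * 64 integrates the two majorants in the coordinates of xi + eta. *)
exists (2 * (64 * C * (64 * 64))) => gr gi [mgr [mgi g2]] Q.
pose ur := gr \_ U; pose ui := gi \_ U.
have urU xi : ~ U xi -> ur xi = 0 by move=> nU; rewrite /ur patchE memNset.
have uiU xi : ~ U xi -> ui xi = 0 by move=> nU; rewrite /ui patchE memNset.
have mur : measurable_fun setT ur by apply/(measurable_restrictT _ mU).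
have mui : measurable_fun setT ui by apply/(measurable_restrictT _ mU).
have in2 : (@leb2 R).-integrable setT (EFin \o (fun xi => ur xi ^+ 2 + ui xi ^+ 2)).
  apply: ge0_integrableR.
  - by apply: measurable_funD; exact: measurable_funX.
  - by move=> xi; rewrite addr_ge0 ?sqr_ge0.
  - apply: (eq_ind _ (fun w => w < +oo)%E g2); rewrite [LHS]integral_mkcond.
    apply: eq_integral => xi _; rewrite patchE /ur /ui !patchE.
    by case: ifPn => // _; rewrite expr0n addr0.
have iur2 : (@leb2 R).-integrable setT (EFin \o (fun xi => ur xi ^+ 2)).
  apply: le_integrableR in2; first exact: measurable_funX.
  by move=> xi; rewrite ger0_norm ?sqr_ge0// lerDl sqr_ge0.
have iui2 : (@leb2 R).-integrable setT (EFin \o (fun xi => ui xi ^+ 2)).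
  apply: le_integrableR in2; first exact: measurable_funX.
  by move=> xi; rewrite ger0_norm ?sqr_ge0// lerDr sqr_ge0.
(* On a set of finite measure L^2 is contained in L^1, through |u| <= 1 + u^2. *)
have iL1 (u : R * R -> R) : measurable_fun setT u -> (forall xi, ~ U xi -> u xi = 0) ->
    (@leb2 R).-integrable setT (EFin \o (fun xi => u xi ^+ 2)) ->
    (@leb2 R).-integrable setT (EFin \o u).
  move=> mu uU iu2; have i1 : (@leb2 R).-integrable setT (EFin \o (\1_U : R * R -> R)).
    apply: ge0_integrableR; [exact: (measurable_indic mU)|by move=> xi; rewrite indicE|].
    by rewrite integral_indic// setIT.
  apply: le_integrableR (integrableDR i1 iu2) => // xi.
  have [Uxi|nUxi] := pselect (U xi); last by rewrite uU// normr0 addr_ge0 ?sqr_ge0// indicE.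
  rewrite indicE mem_set//= -[u xi ^+ 2]real_normK ?num_real//.
  have := normr_ge0 (u xi); move: `|u xi| => v v0; nra.
have iur := iL1 _ mur urU iur2; have iui := iL1 _ mui uiU iui2.
have reE t z : ext_re U phi (damp phi t gr) (damp phi t gi) z.1 z.2 =
    \int[@leb2 R]_xi damped_re h ur ui t z xi.
  rewrite /ext_re Rintegral_mkcond; apply: eq_Rintegral => xi _.
  rewrite patchE /damped_re /ur /ui /h /phase /damp !patchE.
  by case: ifPn => // _; rewrite !mulr0 !mul0r subr0.
have imE t z : ext_im U phi (damp phi t gr) (damp phi t gi) z.1 z.2 =
    \int[@leb2 R]_xi damped_im h ur ui t z xi.
  rewrite /ext_im Rintegral_mkcond; apply: eq_Rintegral => xi _.
  rewrite patchE /damped_im /ur /ui /h /phase /damp !patchE.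
  by case: ifPn => // _; rewrite !mulr0 !mul0r addr0.
have sqE t : L2sq U (damp phi t gr) (damp phi t gi) = \int[@leb2 R]_xi damped_sq h ur ui t xi.
  rewrite /L2sq integral_mkcond /Rintegral; congr fine; apply: eq_integral => xi _.
  rewrite patchE /damped_sq /ur /ui /h /damp !patchE.
  by case: ifPn => // _; [rewrite !exprMn mulrDr|rewrite expr0n addr0 mulr0].
have L4E t : ext_L4_4 U phi (damp phi t gr) (damp phi t gi) = (\int[@leb3 R]_z
    (((\int[@leb2 R]_xi damped_re h ur ui t z xi) ^+ 2 +
      (\int[@leb2 R]_xi damped_im h ur ui t z xi) ^+ 2) ^+ 2)%:E)%E.
  by apply: eq_integral => z _; rewrite reE imE.
(* Finiteness of the L^4 norm comes first: it ensures that [fine] in [Q] returns the true value and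
   not the default for an infinite one. *)
split=> [t _|].
  have iL4 := integrable_damped_L4 mU mh h0 hM iur iui iur2 iui2 urU uiU C0 slab t.
  by rewrite L4E -(RintegralK iL4) ltry.
have cm := completely_monotone_damped mU mh h0 hM iur iui iur2 iui2 urU uiU C0 slab.
apply: (eq_ind _ (@completely_monotone R) cm).
by apply/funext => t; rewrite /Q sqE L4E.
Qed.
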